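(* Let $\lambda\in\mathbb{C}$ with $|\lambda|=1$ and $\varphi(z)=\lambda z$, $z\in\mathbb{D}$. For every typical weight $v$ on $\mathbb{D}$ the composition operator $C_\varphi f=f\circ\varphi$ is power bounded on $H_v^\infty$. Moreover: (i) If there exists $k\in\mathbb{N}$, $k\ge1$, with $\lambda^k=1$ (take the smallest such $k$), then for every typical weight $v$, $C_\varphi$ is uniformly mean ergodic on $H_v^\infty$, and for every $f\in H_v^\infty$ the limit $\lim_n (C_\varphi)_{[n]}(f)$ is the function $z\mapsto\frac1k\sum_{m=0}^{k-1}f(\lambda^mz)$. (ii) If $\lambda$ is not a root of unity, then for every typical weight $v$, $C_\varphi$ is mean ergodic on $H_v^0$, with $\lim_{n\to\infty}(C_\varphi)_{[n]}=C_0$ in the strong operator topology. Furthermore, fix $0<\alpha<1$, $R>1$, $0<r_0<1$, and a sequence $(n_k)_{k\ge1}$ of natural numbers with $n_k\ge k$ and $|1-\lambda^{n_k}|\le R^{-k}$ for every $k\ge 1$. Let $v_\alpha$ be the typical weight $v_\alpha(z)=v_\alpha(|z|)$ given by $$v_\alpha(r)=\begin{cases} C\left(\sum_{k=1}^\infty r^{n_k}\right)^{-\alpha}, & r_0\le r<1,\\ 1,& 0\le r\le r_0,\end{cases}\qquad C=\left(\sum_{k=1}^\infty r_0^{n_k}\right)^{\alpha}.$$ Then $C_\varphi$ is not uniformly mean ergodic on $H^0_{v_\alpha}$, and it is not mean ergodic on $H^\infty_{v_\alpha}$.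
   Context: $\mathbb{D}$ is the open unit disc in $\mathbb{C}$ and $H(\mathbb{D})$ the space of holomorphic functions on $\mathbb{D}$. A weight is a bounded continuous function $v:\mathbb{D}\to(0,\infty)$; it is typical if it is radial ($v(z)=v(|z|)$), non-increasing in $|z|$, and $\lim_{|z|\to1}v(z)=0$. $H_v^\infty=\{f\in H(\mathbb{D}):\|f\|_v=\sup_{z\in\mathbb{D}}v(z)|f(z)|<\infty\}$ and $H_v^0=\{f\in H_v^\infty:\lim_{|z|\to1}v(z)|f(z)|=0\}$, both with the norm $\|\cdot\|_v$. $C_0$ is the operator sending $f$ to the constant function $f(0)$. For a bounded operator $T$ on a Banach space $X$, $T_{[n]}=\frac1n\sum_{m=1}^nT^m$; $T$ is power bounded if $\sup_n\|T^n\|<\infty$, mean ergodic if $(T_{[n]})_n$ converges in the strong operator topology to some bounded operator on $X$, and uniformly mean ergodic if it converges in operator norm. *)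

(* Defs.v *)
From Stdlib Require Export Reals.
From Stdlib Require Import Lra ClassicalEpsilon FunctionalExtensionality
  ProofIrrelevance.
From Coquelicot Require Export Coquelicot.

Open Scope R_scope.

(** Coquelicot's [is_linear] includes boundedness. *)
Record bounded_op (V : NormedModule C_AbsRing) := BoundedOp {
  op_fun :> V -> V;
  op_lin : is_linear op_fun
}.
Arguments op_fun {V}.
Arguments op_lin {V}.
Arguments BoundedOp {V}.

Section Operators.

Context {V : NormedModule C_AbsRing}.

Definition opnorm (T : V -> V) : Rbar :=
  Lub_Rbar (fun r : R => exists x : V, norm x <= 1 /\ r = norm (T x)).

(** Only limits in [n] are used, so the value at [n = 0] is irrelevant. *)
Definition cesaro (T : V -> V) (n : nat) (x : V) : V :=
  scal (RtoC (/ INR n) : C_AbsRing) (sum_n_m (fun m => Nat.iter m T x) 1 n).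

Definition power_bounded (T : bounded_op V) : Prop :=
  exists M : R, forall n : nat, Rbar_le (opnorm (Nat.iter n T)) M.

Definition sot_lim (T : nat -> V -> V) (P : V -> V) : Prop :=
  forall x : V, filterlim (fun n => T n x) eventually (locally (P x)).

Definition opnorm_lim (T : nat -> V -> V) (P : V -> V) : Prop :=
  forall eps : posreal,
    eventually (fun n => Rbar_lt (opnorm (fun x => minus (T n x) (P x))) eps).

Definition mean_ergodic (T : bounded_op V) : Prop :=
  exists P : bounded_op V, sot_lim (cesaro T) P.

Definition uniformly_mean_ergodic (T : bounded_op V) : Prop :=
  exists P : bounded_op V, opnorm_lim (cesaro T) P.

End Operators.

Record subspace (V : NormedModule C_AbsRing) := Subspace {
  sub_mem :> V -> Prop;
  sub_zero : sub_mem zero;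
  sub_plus : forall x y, sub_mem x -> sub_mem y -> sub_mem (plus x y);
  sub_scal : forall (k : C_AbsRing) x, sub_mem x -> sub_mem (scal k x)
}.
Arguments sub_mem {V}.
Arguments sub_zero {V}.
Arguments sub_plus {V}.
Arguments sub_scal {V}.
Arguments Subspace {V}.

Section SubNormedModule.

Context {V : NormedModule C_AbsRing} (S : subspace V).

Record sub_elt := SubElt { sub_val :> V; sub_valP : S sub_val }.

Lemma sub_elt_eq (x y : sub_elt) : sub_val x = sub_val y -> x = y.
Proof.
  destruct x as [x hx], y as [y hy]; simpl; intros <-.
  f_equal; apply proof_irrelevance.
Qed.

Definition sub_elt_plus (x y : sub_elt) : sub_elt :=
  SubElt (plus (sub_val x) (sub_val y)) (sub_plus S _ _ (sub_valP x) (sub_valP y)).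

Definition sub_elt_zero : sub_elt := SubElt zero (sub_zero S).

Lemma sub_oppP (x : sub_elt) : S (opp (sub_val x)).
Proof. rewrite <- (@scal_opp_one C_AbsRing V); apply sub_scal, sub_valP. Qed.

Definition sub_elt_opp (x : sub_elt) : sub_elt := SubElt (opp (sub_val x)) (sub_oppP x).

Definition sub_elt_scal (k : C_AbsRing) (x : sub_elt) : sub_elt :=
  SubElt (scal k (sub_val x)) (sub_scal S k _ (sub_valP x)).

Definition sub_elt_AbelianMonoid_mixin : AbelianMonoid.mixin_of sub_elt.
Proof.
  exists sub_elt_plus sub_elt_zero; intros; apply sub_elt_eq; simpl.
  - apply (@plus_comm V).
  - apply (@plus_assoc V).
  - apply (@plus_zero_r V).
Defined.

Canonical sub_elt_AbelianMonoid :=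
  AbelianMonoid.Pack sub_elt sub_elt_AbelianMonoid_mixin sub_elt.

Definition sub_elt_AbelianGroup_mixin : AbelianGroup.mixin_of sub_elt_AbelianMonoid.
Proof.
  exists sub_elt_opp; intros; apply sub_elt_eq; simpl; apply (@plus_opp_r V).
Defined.

Canonical sub_elt_AbelianGroup :=
  AbelianGroup.Pack sub_elt
    (AbelianGroup.Class _ _ sub_elt_AbelianGroup_mixin) sub_elt.

Definition sub_elt_ModuleSpace_mixin :
  ModuleSpace.mixin_of C_AbsRing sub_elt_AbelianGroup.
Proof.
  exists sub_elt_scal; intros; apply sub_elt_eq; simpl.
  - apply (@scal_assoc C_AbsRing V).
  - apply (@scal_one C_AbsRing V).
  - apply (@scal_distr_l C_AbsRing V).
  - apply (@scal_distr_r C_AbsRing V).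
Defined.

Canonical sub_elt_ModuleSpace :=
  ModuleSpace.Pack C_AbsRing sub_elt
    (ModuleSpace.Class _ _ _ sub_elt_ModuleSpace_mixin) sub_elt.

Definition sub_elt_UniformSpace_mixin : UniformSpace.mixin_of sub_elt.
Proof.
  refine (UniformSpace.Mixin _ sub_elt_zero
            (fun x e y => ball (sub_val x) e (sub_val y)) _ _ _).
  - intros; apply ball_center.
  - intros x y e; apply ball_sym.
  - intros x y z e1 e2; apply ball_triangle.
Defined.

Canonical sub_elt_UniformSpace :=
  UniformSpace.Pack sub_elt sub_elt_UniformSpace_mixin sub_elt.

Canonical sub_elt_NormedModuleAux :=
  NormedModuleAux.Pack C_AbsRing sub_elt
    (NormedModuleAux.Class C_AbsRing sub_elt
       (ModuleSpace.class _ sub_elt_ModuleSpace) sub_elt_UniformSpace_mixin) sub_elt.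

Definition sub_elt_NormedModule_mixin :
  NormedModule.mixin_of C_AbsRing sub_elt_NormedModuleAux.
Proof.
  refine (NormedModule.Mixin _ _ (fun x => norm (sub_val x))
            (@norm_factor C_AbsRing V) _ _ _ _ _).
  - intros x y; apply norm_triangle.
  - intros l x; apply (@norm_scal C_AbsRing V).
  - intros x y eps; apply (norm_compat1 (sub_val x) (sub_val y)).
  - intros x y eps; apply (norm_compat2 (sub_val x) (sub_val y)).
  - intros x h; apply sub_elt_eq; exact (norm_eq_zero _ h).
Defined.

Canonical sub_elt_NormedModule :=
  NormedModule.Pack C_AbsRing sub_elt
    (NormedModule.Class _ _ _ sub_elt_NormedModule_mixin) sub_elt.

Definition restrict_fun (T : V -> V) (hT : forall x, S x -> S (T x))
  (x : sub_elt) : sub_elt := SubElt (T x) (hT _ (sub_valP x)).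

Lemma restrict_lin (T : bounded_op V) (hT : forall x, S x -> S (T x)) :
  is_linear (restrict_fun T hT).
Proof.
  destruct T as [T [h1 h2 [M [hM h3]]]]; split; simpl in *.
  - intros x y; apply sub_elt_eq, h1.
  - intros k x; apply sub_elt_eq, h2.
  - exists M; split; [exact hM | intros x; apply h3].
Qed.

Definition restrict_op (T : bounded_op V) (hT : forall x, S x -> S (T x)) :
  bounded_op sub_elt_NormedModule :=
  BoundedOp (restrict_fun T hT : sub_elt_NormedModule -> sub_elt_NormedModule)
    (restrict_lin T hT).

End SubNormedModule.
Arguments SubElt {V S}.
Arguments sub_val {V S}.
Arguments sub_valP {V S}.
Arguments restrict_op {V S}.

Definition disc (z : C) : Prop := Cmod z < 1.

Definition vanishes_at_boundary (g : C -> R) : Prop :=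
  forall eps : posreal, exists r : R, r < 1 /\
    forall z : C, r < Cmod z < 1 -> Rabs (g z) < eps.

(** Weights live on the disc: values of [weight_fun] outside it are irrelevant. *)
Record weight := Weight {
  weight_fun :> C -> R;
  weight_cont : forall z, disc z -> continuous weight_fun z;
  weight_pos : forall z, disc z -> 0 < weight_fun z;
  weight_bounded : exists M, forall z, disc z -> weight_fun z <= M
}.

Record typical (v : weight) : Prop := Typical {
  typical_radial : forall z, disc z -> v z = v (RtoC (Cmod z));
  typical_noninc : forall z w, Cmod z <= Cmod w -> disc w -> v w <= v z;
  typical_lim : vanishes_at_boundary v
}.

(** A function on the disc is encoded as a function [C -> C] vanishing outside
    the disc, so that Leibniz equality of elements is equality on the disc. *)
Record Hinf_elt (v : weight) := HinfElt {
  hfun :> C -> C;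
  hfun_holo : forall z, disc z -> ex_derive (V := C_NormedModule) hfun z;
  hfun_bounded : exists M, forall z, disc z -> v z * Cmod (hfun z) <= M;
  hfun_out : forall z, ~ disc z -> hfun z = RtoC 0
}.
Arguments hfun {v}.
Arguments hfun_holo {v}.
Arguments hfun_bounded {v}.
Arguments hfun_out {v}.
Arguments HinfElt {v}.

Section Hinf.

Context (v : weight).

Lemma Hinf_eq (f g : Hinf_elt v) : (forall z, disc z -> f z = g z) -> f = g.
Proof.
  intros h.
  assert (e : hfun f = hfun g).
  { apply functional_extensionality; intros z.
    destruct (excluded_middle_informative (disc z)) as [hz | hz]; auto.
    now rewrite !hfun_out. }
  destruct f, g; simpl in e; subst; f_equal; apply proof_irrelevance.
Qed.

Definition vnorm (f : C -> C) : R :=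
  real (Lub_Rbar (fun r => exists z, disc z /\ r = v z * Cmod (f z))).

Lemma disc0 : disc (RtoC 0).
Proof. unfold disc; rewrite Cmod_0; lra. Qed.

Lemma vmod_ge0 (f : C -> C) z : disc z -> 0 <= v z * Cmod (f z).
Proof.
  intros hz; apply Rmult_le_pos; [apply Rlt_le, weight_pos, hz | apply Cmod_ge_0].
Qed.

Lemma vnorm_le (f : C -> C) M :
  (forall z, disc z -> v z * Cmod (f z) <= M) -> vnorm f <= M.
Proof.
  intros h; unfold vnorm.
  destruct (Lub_Rbar_correct (fun r => exists z, disc z /\ r = v z * Cmod (f z)))
    as [ub lub].
  assert (h1 := lub M); assert (h0 := ub _ (ex_intro _ _ (conj disc0 eq_refl))).
  destruct (Lub_Rbar _); simpl in *; try easy.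
  - apply h1; intros x [z [hz ->]]; apply h, hz.
  - exfalso; apply h1; intros x [z [hz ->]]; apply h, hz.
Qed.

Lemma vnorm_ub (f : Hinf_elt v) z : disc z -> v z * Cmod (f z) <= vnorm f.
Proof.
  intros hz; destruct (hfun_bounded f) as [M hM]; unfold vnorm.
  destruct (Lub_Rbar_correct (fun r => exists z, disc z /\ r = v z * Cmod (f z)))
    as [ub lub].
  assert (h1 := lub M); assert (h0 := ub _ (ex_intro _ _ (conj hz eq_refl))).
  destruct (Lub_Rbar _); simpl in *; try easy.
  exfalso; apply h1; intros x [w [hw ->]]; apply hM, hw.
Qed.

Definition Hinf_zero : Hinf_elt v.
Proof.
  exists (fun _ => RtoC 0).
  - intros z _; apply ex_derive_const.
  - exists 0; intros z _; rewrite Cmod_0; lra.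
  - reflexivity.
Defined.

Definition Hinf_plus (f g : Hinf_elt v) : Hinf_elt v.
Proof.
  exists (fun z => (f z + g z)%C).
  - intros z hz; apply (@ex_derive_plus C_AbsRing C_NormedModule); now apply hfun_holo.
  - exists (vnorm f + vnorm g); intros z hz.
    apply Rle_trans with (v z * (Cmod (f z) + Cmod (g z))).
    + apply Rmult_le_compat_l; [apply Rlt_le, weight_pos, hz | apply Cmod_triangle].
    + rewrite Rmult_plus_distr_l; apply Rplus_le_compat; now apply vnorm_ub.
  - intros z hz; rewrite !hfun_out by assumption; ring.
Defined.

Definition Hinf_scal (k : C) (f : Hinf_elt v) : Hinf_elt v.
Proof.
  exists (fun z => (k * f z)%C).
  - intros z hz; destruct (hfun_holo f z hz) as [l hl].
    exists (k * l)%C.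
    apply (@filterdiff_ext_lin C_AbsRing (AbsRing_NormedModule C_AbsRing) C_NormedModule
             _ _ _ (fun y => scal (k : C_AbsRing) (scal (y : C_AbsRing) (l : C_NormedModule)))).
    + apply (@filterdiff_scal_r_fct C_AbsRing (AbsRing_NormedModule C_AbsRing)
               C_NormedModule); [typeclasses eauto | apply Cmult_comm | exact hl].
    + intros y; change (k * (y * l) = y * (k * l))%C; ring.
  - exists (Cmod k * vnorm f); intros z hz.
    rewrite Cmod_mult, <- Rmult_assoc, (Rmult_comm (v z)), Rmult_assoc.
    apply Rmult_le_compat_l; [apply Cmod_ge_0 | now apply vnorm_ub].
  - intros z hz; rewrite hfun_out by assumption; ring.
Defined.

Definition Hinf_opp (f : Hinf_elt v) : Hinf_elt v := Hinf_scal (- RtoC 1)%C f.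

Definition Hinf_AbelianMonoid_mixin : AbelianMonoid.mixin_of (Hinf_elt v).
Proof.
  exists Hinf_plus Hinf_zero; intros; apply Hinf_eq; intros t _; simpl; ring.
Defined.

Canonical Hinf_AbelianMonoid :=
  AbelianMonoid.Pack (Hinf_elt v) Hinf_AbelianMonoid_mixin (Hinf_elt v).

Definition Hinf_AbelianGroup_mixin : AbelianGroup.mixin_of Hinf_AbelianMonoid.
Proof.
  exists Hinf_opp; intros; apply Hinf_eq; intros t _; simpl; ring.
Defined.

Canonical Hinf_AbelianGroup :=
  AbelianGroup.Pack (Hinf_elt v)
    (AbelianGroup.Class _ _ Hinf_AbelianGroup_mixin) (Hinf_elt v).

Definition Hinf_ModuleSpace_mixin :
  ModuleSpace.mixin_of C_AbsRing Hinf_AbelianGroup.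
Proof.
  exists Hinf_scal; intros; apply Hinf_eq; intros t _; simpl;
    unfold mult, one, plus; simpl; ring.
Defined.

Canonical Hinf_ModuleSpace :=
  ModuleSpace.Pack C_AbsRing (Hinf_elt v)
    (ModuleSpace.Class _ _ _ Hinf_ModuleSpace_mixin) (Hinf_elt v).

Lemma vnorm_minus (f g : Hinf_elt v) :
  vnorm (minus g f) = vnorm (fun z => g z - f z)%C.
Proof.
  f_equal; apply functional_extensionality; intros z; simpl; ring.
Qed.

Lemma vnorm_triangle (f g : Hinf_elt v) : vnorm (plus f g) <= vnorm f + vnorm g.
Proof.
  apply vnorm_le; intros z hz; simpl.
  apply Rle_trans with (v z * (Cmod (f z) + Cmod (g z))).
  - apply Rmult_le_compat_l; [apply Rlt_le, weight_pos, hz | apply Cmod_triangle].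
  - rewrite Rmult_plus_distr_l; apply Rplus_le_compat; now apply vnorm_ub.
Qed.

Definition Hinf_UniformSpace_mixin : UniformSpace.mixin_of (Hinf_elt v).
Proof.
  refine (UniformSpace.Mixin _ Hinf_zero (fun f e g => vnorm (minus g f) < e) _ _ _).
  - intros f e; apply Rle_lt_trans with 0; [| apply cond_pos].
    apply vnorm_le; intros z _; rewrite minus_eq_zero; simpl; rewrite Cmod_0; lra.
  - intros f g e; rewrite !vnorm_minus.
    replace (fun z => f z - g z)%C with (fun z => - (g z - f z))%C
      by (apply functional_extensionality; intros z; ring).
    unfold vnorm; erewrite Lub_Rbar_eqset; [intros h; exact h |].
    intros r; split; intros [z [hz ->]]; exists z; split; auto; now rewrite Cmod_opp.
  - intros f g h e1 e2 h1 h2.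
    rewrite (minus_trans g).
    eapply Rle_lt_trans; [apply vnorm_triangle | lra].
Defined.

Canonical Hinf_UniformSpace :=
  UniformSpace.Pack (Hinf_elt v) Hinf_UniformSpace_mixin (Hinf_elt v).

Canonical Hinf_NormedModuleAux :=
  NormedModuleAux.Pack C_AbsRing (Hinf_elt v)
    (NormedModuleAux.Class C_AbsRing (Hinf_elt v)
       (ModuleSpace.class _ Hinf_ModuleSpace) Hinf_UniformSpace_mixin) (Hinf_elt v).

Definition Hinf_NormedModule_mixin :
  NormedModule.mixin_of C_AbsRing Hinf_NormedModuleAux.
Proof.
  refine (NormedModule.Mixin _ _ (fun f : Hinf_elt v => vnorm f) 1 _ _ _ _ _).
  - exact vnorm_triangle.
  - intros k f; apply vnorm_le; intros z hz; simpl.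
    change (abs k) with (Cmod k).
    rewrite Cmod_mult, <- Rmult_assoc, (Rmult_comm (v z)), Rmult_assoc.
    apply Rmult_le_compat_l; [apply Cmod_ge_0 | now apply vnorm_ub].
  - intros f g eps h; exact h.
  - intros f g eps h; rewrite Rmult_1_l; exact h.
  - intros f h; apply Hinf_eq; intros z hz; apply Cmod_eq_0.
    assert (h1 := vnorm_ub f z hz); assert (h2 := weight_pos v z hz).
    assert (h3 := Cmod_ge_0 (f z)); rewrite h in h1.
    destruct h3 as [h3 | h3]; [| now symmetry].
    assert (0 < v z * Cmod (f z)) by now apply Rmult_lt_0_compat.
    lra.
Defined.

Canonical Hinf : NormedModule C_AbsRing :=
  NormedModule.Pack C_AbsRing (Hinf_elt v)
    (NormedModule.Class _ _ _ Hinf_NormedModule_mixin) (Hinf_elt v).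

End Hinf.

Definition H0_subspace (v : weight) : subspace (Hinf v).
Proof.
  exists (fun f : Hinf_elt v => vanishes_at_boundary (fun z => v z * Cmod (f z))).
  - intros eps; exists 0; split; [lra |]; intros z _; simpl.
    rewrite Cmod_0, Rmult_0_r, Rabs_R0; apply cond_pos.
  - intros f g hf hg eps.
    destruct (hf (pos_div_2 eps)) as [r [hr h1]].
    destruct (hg (pos_div_2 eps)) as [s [hs h2]].
    exists (Rmax r s); split; [now apply Rmax_lub_lt |]; intros z [hz hz1].
    specialize (h1 z (conj (Rle_lt_trans _ _ _ (Rmax_l r s) hz) hz1)).
    specialize (h2 z (conj (Rle_lt_trans _ _ _ (Rmax_r r s) hz) hz1)).
    rewrite Rabs_pos_eq in * by now apply (vmod_ge0 v).
    simpl in *.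
    assert (h3 := Cmod_triangle (f z) (g z)).
    apply (Rmult_le_compat_l (v z)) in h3; [| apply Rlt_le, weight_pos, hz1].
    change (v z * Cmod (f z + g z)%C < eps); lra.
  - intros k f hf eps.
    assert (hk : 0 < Cmod k + 1) by (assert (h := Cmod_ge_0 k); lra).
    destruct (hf (mkposreal _ (Rdiv_lt_0_compat _ _ (cond_pos eps) hk))) as [r [hr h1]].
    exists r; split; [exact hr |]; intros z hz; specialize (h1 z hz); simpl in *.
    destruct hz as [_ hz].
    rewrite Rabs_pos_eq in h1 by now apply (vmod_ge0 v).
    rewrite Cmod_mult, <- Rmult_assoc, (Rmult_comm (v z)), Rmult_assoc.
    assert (h0 := vmod_ge0 v f z hz).
    rewrite Rabs_pos_eq by (apply Rmult_le_pos; [apply Cmod_ge_0 | exact h0]).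
    apply Rle_lt_trans with ((Cmod k + 1) * (v z * Cmod (f z))); [nra |].
    apply (Rmult_lt_compat_l _ _ _ hk) in h1.
    replace ((Cmod k + 1) * (eps / (Cmod k + 1))) with (pos eps) in h1
      by (field; lra).
    exact h1.
Defined.

Definition H0 (v : weight) : NormedModule C_AbsRing :=
  sub_elt_NormedModule (H0_subspace v).

Section Rotation.

Context (lambda : C) (hl : Cmod lambda = 1) (v : weight) (hv : typical v).

Definition rotation (z : C) : C := (lambda * z)%C.

Lemma Cmod_rotation z : Cmod (rotation z) = Cmod z.
Proof. unfold rotation; rewrite Cmod_mult, hl; ring. Qed.

Lemma disc_rotation z : disc (rotation z) <-> disc z.
Proof. unfold disc; now rewrite Cmod_rotation. Qed.

Lemma weight_rotation z : disc z -> v (rotation z) = v z.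
Proof.
  intros hz; rewrite (typical_radial v hv z hz).
  rewrite (typical_radial v hv (rotation z)) by now apply disc_rotation.
  now rewrite Cmod_rotation.
Qed.

Definition comp_rotation_fun (f : Hinf v) : Hinf v.
Proof.
  exists (fun z => hfun f (rotation z)).
  - intros z hz.
    apply (@ex_derive_comp C_AbsRing C_NormedModule).
    + apply hfun_holo; now apply disc_rotation.
    + exists lambda; unfold rotation.
      apply (@filterdiff_ext_lin C_AbsRing (AbsRing_NormedModule C_AbsRing)
               (AbsRing_NormedModule C_AbsRing) _ _ _
               (fun y => scal (lambda : C_AbsRing) y)); [| intros y; apply Cmult_comm].
      apply (@filterdiff_linear C_AbsRing (AbsRing_NormedModule C_AbsRing)
               (AbsRing_NormedModule C_AbsRing)).
      apply (@is_linear_scal_r C_AbsRing (AbsRing_NormedModule C_AbsRing)).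
      apply Cmult_comm.
  - destruct (hfun_bounded f) as [M hM]; exists M; intros z hz.
    rewrite <- weight_rotation by exact hz; apply hM; now apply disc_rotation.
  - intros z hz; apply hfun_out; now rewrite disc_rotation.
Defined.

Lemma comp_rotation_lin : is_linear comp_rotation_fun.
Proof.
  split.
  - intros f g; now apply Hinf_eq.
  - intros k f; now apply Hinf_eq.
  - exists 1; split; [lra |]; intros f; rewrite Rmult_1_l.
    apply vnorm_le; intros z hz; simpl.
    rewrite <- weight_rotation by exact hz.
    apply (vnorm_ub v f); now apply disc_rotation.
Qed.

Definition comp_rotation : bounded_op (Hinf v) :=
  BoundedOp comp_rotation_fun comp_rotation_lin.

Lemma comp_rotation_H0 (f : Hinf v) :
  H0_subspace v f -> H0_subspace v (comp_rotation f).
Proof.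
  intros hf eps; destruct (hf eps) as [r [hr h]]; exists r; split; [exact hr |].
  intros z hz; simpl; rewrite <- weight_rotation by apply hz.
  apply h; now rewrite Cmod_rotation.
Qed.

Definition comp_rotation0 : bounded_op (H0 v) :=
  restrict_op comp_rotation comp_rotation_H0.

End Rotation.

Section EvalZero.

Context (v : weight) (hv : typical v).

Definition Hinf_const (c : C) : Hinf v.
Proof.
  exists (fun z => if excluded_middle_informative (disc z) then c else RtoC 0).
  - intros z hz.
    apply (@ex_derive_ext_loc C_AbsRing C_NormedModule (fun _ => c)); [| apply ex_derive_const].
    assert (he : 0 < 1 - Cmod z) by (unfold disc in hz; lra).
    exists (mkposreal _ he); intros w hw.
    destruct (excluded_middle_informative (disc w)) as [_ | h]; [reflexivity |].
    exfalso; apply h; unfold disc.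
    change (Cmod (w - z) < 1 - Cmod z) in hw.
    replace w with ((w - z) + z)%C by ring.
    assert (h1 := Cmod_triangle (w - z) z); lra.
  - destruct (weight_bounded v) as [M hM]; exists (M * Cmod c); intros z hz.
    destruct (excluded_middle_informative (disc z)); [| easy].
    apply Rmult_le_compat_r; [apply Cmod_ge_0 | now apply hM].
  - intros z hz; now destruct (excluded_middle_informative (disc z)).
Defined.

Lemma Hinf_constE c z : disc z -> Hinf_const c z = c.
Proof. intros hz; simpl; now destruct (excluded_middle_informative (disc z)). Qed.

Definition eval_zero_fun (f : Hinf v) : Hinf v := Hinf_const (hfun f (RtoC 0)).

Lemma eval_zero_lin : is_linear eval_zero_fun.
Proof.
  split.
  - intros f g; apply Hinf_eq; intros z hz; unfold eval_zero_fun.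
    change (plus (Hinf_const (f (RtoC 0))) (Hinf_const (g (RtoC 0))) : C -> C) with
      (fun z => Hinf_const (f (RtoC 0)) z + Hinf_const (g (RtoC 0)) z)%C.
    now rewrite !Hinf_constE.
  - intros k f; apply Hinf_eq; intros z hz; unfold eval_zero_fun.
    change (scal k (Hinf_const (f (RtoC 0))) : C -> C) with
      (fun z => k * Hinf_const (f (RtoC 0)) z)%C.
    now rewrite !Hinf_constE.
  - destruct (weight_bounded v) as [M hM].
    assert (h0 := weight_pos v _ disc0); assert (h1 := hM _ disc0).
    assert (hpos : 0 < M / v (RtoC 0)) by (apply Rdiv_lt_0_compat; lra).
    exists (M / v (RtoC 0)); split; [exact hpos |]; intros f.
    apply vnorm_le; intros z hz; unfold eval_zero_fun; rewrite Hinf_constE by exact hz.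
    apply Rle_trans with (M * Cmod (f (RtoC 0))).
    + apply Rmult_le_compat_r; [apply Cmod_ge_0 | now apply hM].
    + replace (M * Cmod (f (RtoC 0))) with
        (M / v (RtoC 0) * (v (RtoC 0) * Cmod (f (RtoC 0)))) by (field; lra).
      apply Rmult_le_compat_l; [lra |]; apply (vnorm_ub v f), disc0.
Qed.

Definition eval_zero : bounded_op (Hinf v) := BoundedOp eval_zero_fun eval_zero_lin.

Lemma eval_zero_H0 (f : Hinf v) : H0_subspace v f -> H0_subspace v (eval_zero f).
Proof.
  intros _ eps; set (c := hfun f (RtoC 0)).
  assert (hc : 0 < Cmod c + 1) by (assert (h := Cmod_ge_0 c); lra).
  destruct (typical_lim v hv (mkposreal _ (Rdiv_lt_0_compat _ _ (cond_pos eps) hc)))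
    as [r [hr h]].
  exists r; split; [exact hr |]; intros z hz; specialize (h z hz); simpl in h.
  change (eval_zero f) with (Hinf_const c).
  rewrite Hinf_constE by apply hz.
  assert (hp := weight_pos v z (proj2 hz)).
  rewrite Rabs_pos_eq in h by lra.
  assert (hc0 := Cmod_ge_0 c).
  rewrite Rabs_pos_eq by nra.
  apply Rle_lt_trans with ((Cmod c + 1) * v z); [nra |].
  apply (Rmult_lt_compat_l _ _ _ hc) in h.
  replace ((Cmod c + 1) * (eps / (Cmod c + 1))) with (pos eps) in h by (field; lra).
  exact h.
Qed.

Definition eval_zero0 : bounded_op (H0 v) := restrict_op eval_zero eval_zero_H0.

End EvalZero.

(** The sequence [n] is indexed from 1; [n 0] is not used. *)
Definition lacunary_sum (n : nat -> nat) (r : R) : R :=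
  Series (fun k => r ^ n (S k)).

Definition v_alpha (alpha r0 : R) (n : nat -> nat) (z : C) : R :=
  if Rle_dec r0 (Cmod z)
  then Rpower (lacunary_sum n r0) alpha * Rpower (lacunary_sum n (Cmod z)) (- alpha)
  else 1.

(* Main.v *)
From Stdlib Require Import ZArith Lra Lia List ClassicalEpsilon.
Require Import Defs.

(** (i) holds because the partial sums of a [k]-periodic sequence differ from
    [n] times its mean by a bounded amount.

    (ii), convergence on [H_v^0]: the values outside a smaller disc
    [|z| <= r] are uniformly small, so it suffices that the averages of
    [f (lambda^m z)] converge to [f 0] uniformly on [|z| <= r].  As [lambda^q] is
    a rotation by a tiny nonzero angle for some [q], these averages are close to
    Riemann sums of the mean of [f] over a circle, which is [f 0] by a Goursat
    argument.

    (ii), failure of uniform convergence: the averages of [z^j] with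
    [j = n_k] stay close to [z^j] for a long time.

    (ii), failure of convergence on [H_v^infty]: if [f o phi - f] is bounded then
    so is each [(C_phi)_[n] f - f], hence the means could converge to [f 0] only
    if [f] belonged to [H_v^0].  Put [w r = sum_k r^(n_k)].  Such an [f] outside
    [H_v^0] is [sum_j w(r_j)^(alpha - 1) g(r_j z)] with [g z = sum_k z^(n_k)] and
    radii [r_j] tending to [1] along which [w(r_j^2) >= w(r_j) / 4]. *)

(** * Green's theorem on rectangles without continuity of the derivatives *)

(** [ex_derive] gives pointwise complex differentiability with no continuity of the derivative, so
    Green's theorem is proved by Goursat's bisection before the mean value property is available.
    The analysis on circles treats real parts only; imaginary parts are recovered from [- Ci * f].

    The series g itself is not a usable test function: on the positive radius it grows like w, while
    H_v^infty allows only growth of order w^alpha. The factor w(r_j)^(alpha - 1) damps the j-th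
    summand to the order w(r_j)^alpha. At z = r_j this summand equals w(r_j)^(alpha - 1) w(r_j^2),
    which is why w must not drop much between r_j and r_j^2. All Taylor coefficients of f lie below
    sum_j w(r_j)^(alpha - 1), which converges because alpha < 1 and w(r_j) grows geometrically.
    Bounded coefficients and the summable bounds on |1 - lambda^(n_k)| make f o phi - f bounded. *)

Lemma dependent_choice_inv {A : Type} (Inv : nat -> A -> Prop)
    (Q : nat -> A -> A -> Prop) (a0 : A) :
  Inv 0%nat a0 ->
  (forall n a, Inv n a -> exists b, Inv (S n) b /\ Q n a b) ->
  exists s : nat -> A, s 0%nat = a0 /\ forall n, Inv n (s n) /\ Q n (s n) (s (S n)).
Proof.
  intros h0 hS.
  pose (next := fun n (p : {a | Inv n a}) =>
    constructive_indefinite_description _ (hS n (proj1_sig p) (proj2_sig p))).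
  pose (s := fix s n : {a | Inv n a} :=
    match n with
    | 0%nat => exist _ a0 h0
    | S m => exist _ (proj1_sig (next m (s m))) (proj1 (proj2_sig (next m (s m))))
    end).
  exists (fun n => proj1_sig (s n)); split; [reflexivity |]; intros n; split.
  - exact (proj2_sig (s n)).
  - exact (proj2 (proj2_sig (next n (s n)))).
Qed.

(** The integral of the form Q dx + P dy along the boundary of [a,b] x [c,d], counterclockwise. In
    [hPQ] below, the shared [p] says that P_x = Q_y, that is, that this form is closed. *)
Definition boundary_integral (P Q : R -> R -> R) (a b c d : R) : R :=
  (RInt (P b) c d - RInt (P a) c d)
  - (RInt (fun x => Q x d) a b - RInt (fun x => Q x c) a b).

Section Goursat.

Context (P Q : R -> R -> R) (a b c d : R) (hab : a <= b) (hcd : c <= d).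
Context (hPQ : forall x y, a <= x <= b -> c <= y <= d ->
  exists p p' q, differentiable_pt_lim P x y p p' /\ differentiable_pt_lim Q x y q p).

Local Notation J := (boundary_integral P Q).

Lemma continuous_of_differentiable_pt_lim (F : R -> R -> R) x y lx ly :
  differentiable_pt_lim F x y lx ly ->
  continuous (F x) y /\ continuous (fun u => F u y) x.
Proof.
  intros h.
  assert (hc : continuity_2d_pt F x y)
    by (apply differentiable_continuity_pt; exists lx, ly; exact h).
  split; intros S [e hS]; destruct (hc e) as [de hde]; exists de; intros t ht;
    apply hS; apply hde; auto; rewrite Rminus_eq_0, Rabs_R0; apply cond_pos.
Qed.

Lemma ex_RInt_vertical x y1 y2 : a <= x <= b -> c <= y1 -> y1 <= y2 -> y2 <= d ->
  ex_RInt (P x) y1 y2.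
Proof.
  intros hx h1 h2 h3; apply (@ex_RInt_continuous R_CompleteNormedModule).
  intros y; rewrite Rmin_left, Rmax_right by assumption; intros hy.
  destruct (hPQ x y hx ltac:(lra)) as (p & p' & q & hP & _).
  exact (proj1 (continuous_of_differentiable_pt_lim _ _ _ _ _ hP)).
Qed.

Lemma ex_RInt_horizontal x1 x2 y : c <= y <= d -> a <= x1 -> x1 <= x2 -> x2 <= b ->
  ex_RInt (fun x => Q x y) x1 x2.
Proof.
  intros hy h1 h2 h3; apply (@ex_RInt_continuous R_CompleteNormedModule).
  intros x; rewrite Rmin_left, Rmax_right by assumption; intros hx.
  destruct (hPQ x y ltac:(lra) hy) as (p & p' & q & _ & hQ).
  exact (proj2 (continuous_of_differentiable_pt_lim _ _ _ _ _ hQ)).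
Qed.

Lemma boundary_integral_split x1 x x2 y1 y y2 :
  a <= x1 -> x1 <= x -> x <= x2 -> x2 <= b ->
  c <= y1 -> y1 <= y -> y <= y2 -> y2 <= d ->
  J x1 x2 y1 y2 = J x1 x y1 y + J x x2 y1 y + J x1 x y y2 + J x x2 y y2.
Proof.
  intros; unfold boundary_integral.
  assert (hv : forall t, a <= t <= b ->
    RInt (P t) y1 y2 = RInt (P t) y1 y + RInt (P t) y y2).
  { intros t ht; symmetry; apply (RInt_Chasles (P t)); apply ex_RInt_vertical; lra. }
  assert (hh : forall t, c <= t <= d ->
    RInt (fun s => Q s t) x1 x2 = RInt (fun s => Q s t) x1 x + RInt (fun s => Q s t) x x2).
  { intros t ht; symmetry; apply (RInt_Chasles (fun s => Q s t));
      apply ex_RInt_horizontal; lra. }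
  rewrite !hv, !hh by lra; ring.
Qed.

Lemma RInt_near_const (F : R -> R) u w k m :
  u <= w -> ex_RInt F u w -> (forall t, u <= t <= w -> Rabs (F t - k) <= m) ->
  Rabs (RInt F u w - k * (w - u)) <= (w - u) * m.
Proof.
  intros h1 h2 h3.
  assert (hc : ex_RInt (fun _ : R => k) u w) by apply (@ex_RInt_const R_NormedModule).
  replace (RInt F u w - k * (w - u)) with (RInt (fun t => F t - k) u w).
  - apply abs_RInt_le_const; auto; exact (@ex_RInt_minus R_NormedModule F (fun _ => k) u w h2 hc).
  - transitivity (minus (RInt F u w) (RInt (fun _ => k) u w));
      [now apply (@RInt_minus R_CompleteNormedModule) | rewrite RInt_const].
    unfold minus, plus, opp, scal; simpl; unfold mult; simpl; ring.
Qed.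

(** The affine parts of P and Q at (X, Y) contribute p w h - p h w = 0, because P_x = Q_y there.
    What remains is an error of at most eps (w + h) at each point of the boundary, whose length is 2
    (w + h). *)
Lemma boundary_integral_local X Y (eps : posreal) :
  a <= X <= b -> c <= Y <= d ->
  exists delta : posreal, forall x y w h,
    a <= x -> x <= X <= x + w -> x + w <= b ->
    c <= y -> y <= Y <= y + h -> y + h <= d ->
    w + h < delta -> Rabs (J x (x + w) y (y + h)) <= 2 * eps * (w + h) ^ 2.
Proof.
  intros hX hY; destruct (hPQ X Y hX hY) as (p & p' & q & hP & hQ).
  destruct (hP eps) as [d1 h1]; destruct (hQ eps) as [d2 h2].
  assert (hd : 0 < Rmin d1 d2) by (apply Rmin_pos; apply cond_pos).
  exists (mkposreal _ hd); simpl; intros x y w h ? hx ? ? hy ? hwh.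
  assert (hwh1 := Rlt_le_trans _ _ _ hwh (Rmin_l _ _)).
  assert (hwh2 := Rlt_le_trans _ _ _ hwh (Rmin_r _ _)).
  assert (hm : forall u v, x <= u <= x + w -> y <= v <= y + h ->
    Rabs (u - X) <= w + h /\ Rabs (v - Y) <= w + h /\
    Rmax (Rabs (u - X)) (Rabs (v - Y)) <= w + h).
  { intros u v hu hv.
    assert (Rabs (u - X) <= w + h) by (apply Rabs_le; lra).
    assert (Rabs (v - Y) <= w + h) by (apply Rabs_le; lra).
    repeat split; auto; now apply Rmax_lub. }
  assert (e0 := cond_pos eps).
  assert (kP : forall u v, x <= u <= x + w -> y <= v <= y + h ->
    Rabs (P u v - P X Y - (p * (u - X) + p' * (v - Y))) <= eps * (w + h)).
  { intros u v hu hv; destruct (hm u v hu hv) as (m1 & m2 & m3).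
    eapply Rle_trans; [apply h1; lra | apply Rmult_le_compat_l; lra]. }
  assert (kQ : forall u v, x <= u <= x + w -> y <= v <= y + h ->
    Rabs (Q u v - Q X Y - (q * (u - X) + p * (v - Y))) <= eps * (w + h)).
  { intros u v hu hv; destruct (hm u v hu hv) as (m1 & m2 & m3).
    eapply Rle_trans; [apply h2; lra | apply Rmult_le_compat_l; lra]. }
  assert (iP : Rabs (RInt (P (x + w)) y (y + h) - RInt (P x) y (y + h) - p * w * h)
               <= h * (2 * eps * (w + h))).
  { assert (i1 : ex_RInt (P (x + w)) y (y + h)) by (apply ex_RInt_vertical; lra).
    assert (i2 : ex_RInt (P x) y (y + h)) by (apply ex_RInt_vertical; lra).
    assert (e := @RInt_minus R_CompleteNormedModule _ _ _ _ i1 i2).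
    change (minus ?x ?y) with (x - y) in e; rewrite <- e.
    replace (p * w * h) with (p * w * (y + h - y)) by ring.
    replace (h * _) with ((y + h - y) * (2 * eps * (w + h))) by ring.
    apply RInt_near_const; [lra | now apply (@ex_RInt_minus R_NormedModule) |].
    intros t ht.
    assert (k1 := kP (x + w) t ltac:(lra) ht); assert (k2 := kP x t ltac:(lra) ht).
    change (Rabs (P (x + w) t - P x t - p * w) <= 2 * eps * (w + h)).
    apply Rabs_le_between in k1; apply Rabs_le_between in k2; apply Rabs_le; lra. }
  assert (iQ : Rabs (RInt (fun s => Q s (y + h)) x (x + w) - RInt (fun s => Q s y) x (x + w)
                     - p * h * w) <= w * (2 * eps * (w + h))).
  { assert (i1 : ex_RInt (fun s => Q s (y + h)) x (x + w))
      by (apply ex_RInt_horizontal; lra).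
    assert (i2 : ex_RInt (fun s => Q s y) x (x + w)) by (apply ex_RInt_horizontal; lra).
    assert (e := @RInt_minus R_CompleteNormedModule _ _ _ _ i1 i2).
    change (minus ?x ?y) with (x - y) in e; rewrite <- e.
    replace (p * h * w) with (p * h * (x + w - x)) by ring.
    replace (w * _) with ((x + w - x) * (2 * eps * (w + h))) by ring.
    apply RInt_near_const; [lra | now apply (@ex_RInt_minus R_NormedModule) |].
    intros t ht.
    assert (k1 := kQ t (y + h) ht ltac:(lra)); assert (k2 := kQ t y ht ltac:(lra)).
    change (Rabs (Q t (y + h) - Q t y - p * h) <= 2 * eps * (w + h)).
    apply Rabs_le_between in k1; apply Rabs_le_between in k2; apply Rabs_le; lra. }
  unfold boundary_integral.
  apply Rabs_le_between in iP; apply Rabs_le_between in iQ; apply Rabs_le.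
  simpl; split; nra.
Qed.

(** The four quarters add up to the whole rectangle, so one of them carries at least a fourth of the
    modulus. *)
Lemma boundary_integral_quarter x y w h :
  0 <= w -> 0 <= h -> a <= x -> x + w <= b -> c <= y -> y + h <= d ->
  exists x' y', x <= x' <= x + w / 2 /\ y <= y' <= y + h / 2 /\
    Rabs (J x (x + w) y (y + h)) <= 4 * Rabs (J x' (x' + w / 2) y' (y' + h / 2)).
Proof.
  intros hw hh hx1 hx2 hy1 hy2.
  rewrite (boundary_integral_split x (x + w / 2) (x + w) y (y + h / 2) (y + h)) by lra.
  set (j1 := J x (x + w / 2) y (y + h / 2)); set (j2 := J (x + w / 2) (x + w) y (y + h / 2)).
  set (j3 := J x (x + w / 2) (y + h / 2) (y + h)).
  set (j4 := J (x + w / 2) (x + w) (y + h / 2) (y + h)).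
  assert (tri : Rabs (j1 + j2 + j3 + j4) <= Rabs j1 + Rabs j2 + Rabs j3 + Rabs j4).
  { eapply Rle_trans; [apply Rabs_triang |]; apply Rplus_le_compat_r.
    eapply Rle_trans; [apply Rabs_triang |]; apply Rplus_le_compat_r; apply Rabs_triang. }
  assert (ew : x + w / 2 + w / 2 = x + w) by field.
  assert (eh : y + h / 2 + h / 2 = y + h) by field.
  destruct (Rle_dec (Rabs (j1 + j2 + j3 + j4)) (4 * Rabs j1)) as [h1 | h1].
  { exists x, y; repeat split; try lra; exact h1. }
  destruct (Rle_dec (Rabs (j1 + j2 + j3 + j4)) (4 * Rabs j2)) as [h2 | h2].
  { exists (x + w / 2), y; rewrite ew; repeat split; try lra; exact h2. }
  destruct (Rle_dec (Rabs (j1 + j2 + j3 + j4)) (4 * Rabs j3)) as [h3 | h3].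
  { exists x, (y + h / 2); rewrite eh; repeat split; try lra; exact h3. }
  exists (x + w / 2), (y + h / 2); rewrite ew, eh; fold j4; repeat split; lra.
Qed.

Lemma nested_intervals (s : nat -> R) (w : R) :
  0 <= w -> (forall k, s k <= s (S k) <= s k + w / 2 ^ S k) ->
  exists X, forall k, s k <= X <= s k + w / 2 ^ k.
Proof.
  intros hw hs.
  assert (hp : forall k, 0 < 2 ^ k) by (intros k; apply pow_lt; lra).
  assert (hd : forall k, 0 <= w / 2 ^ k).
  { intros k; apply Rmult_le_pos; [exact hw | left; apply Rinv_0_lt_compat, hp]. }
  assert (h1 : forall k n, s k <= s (k + n)%nat /\
                           s (k + n)%nat + w / 2 ^ (k + n) <= s k + w / 2 ^ k).
  { intros k; induction n as [| n IH].
    - rewrite Nat.add_0_r; lra.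
    - rewrite Nat.add_succ_r; destruct (hs (k + n)%nat) as [h2 h3].
      assert (e : w / 2 ^ (k + n) = 2 * (w / 2 ^ S (k + n)))
        by (simpl; field; apply Rgt_not_eq, hp).
      lra. }
  assert (h2 : forall j k, s j <= s k + w / 2 ^ k).
  { intros j k; destruct (Nat.le_ge_cases j k) as [h | h].
    - destruct (h1 j (k - j)%nat) as [h3 _].
      replace (j + (k - j))%nat with k in h3 by lia; assert (h4 := hd k); lra.
    - destruct (h1 k (j - k)%nat) as [_ h3].
      replace (k + (j - k))%nat with j in h3 by lia; assert (h4 := hd j); lra. }
  destruct (completeness (fun r => exists j, r = s j)) as [X [ub lub]].
  - exists (s 0%nat + w / 2 ^ 0); intros r [j ->]; apply h2.
  - exists (s 0%nat); now exists 0%nat.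
  - exists X; intros k; split; [apply ub; now exists k |].
    apply lub; intros r [j ->]; apply h2.
Qed.

(** Goursat's argument: the k-th nested quarter keeps at least 4^(-k) |J|, while near the common
    point of the quarters the local estimate gives a small multiple of the squared perimeter, which
    also scales as 4^(-k). *)
Lemma boundary_integral_eq_0 : J a b c d = 0.
Proof.
  set (W := b - a); set (H := d - c).
  assert (hW : 0 <= W) by (unfold W; lra); assert (hH : 0 <= H) by (unfold H; lra).
  assert (hp : forall k, 0 < 2 ^ k) by (intros k; apply pow_lt; lra).
  assert (hpd : forall w k, 0 <= w -> 0 <= w / 2 ^ k).
  { intros w k hw; apply Rmult_le_pos; [exact hw | left; apply Rinv_0_lt_compat, hp]. }
  assert (half : forall w k, w / 2 ^ k / 2 = w / 2 ^ S k)
    by (intros w k; simpl; field; apply Rgt_not_eq, hp).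
  destruct (dependent_choice_inv
    (fun k (z : R * R) =>
       (a <= fst z /\ fst z + W / 2 ^ k <= b) /\ (c <= snd z /\ snd z + H / 2 ^ k <= d) /\
       Rabs (J a b c d) <=
         4 ^ k * Rabs (J (fst z) (fst z + W / 2 ^ k) (snd z) (snd z + H / 2 ^ k)))
    (fun k z z' => (fst z <= fst z' <= fst z + W / 2 ^ S k) /\
                   (snd z <= snd z' <= snd z + H / 2 ^ S k)) (a, c)) as [s [_ hs]].
  - simpl; replace (a + W / 1) with b by (unfold W; field).
    replace (c + H / 1) with d by (unfold H; field); lra.
  - intros k [x y]; simpl fst; simpl snd; intros ([x1 x2] & [y1 y2] & hJ).
    destruct (boundary_integral_quarter x y (W / 2 ^ k) (H / 2 ^ k))
      as (x' & y' & hx & hy & hJ'); auto.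
    rewrite !half in *; exists (x', y'); simpl fst; simpl snd.
    assert (eW : W / 2 ^ k = 2 * (W / 2 ^ S k)) by (simpl; field; apply Rgt_not_eq, hp).
    assert (eH : H / 2 ^ k = 2 * (H / 2 ^ S k)) by (simpl; field; apply Rgt_not_eq, hp).
    repeat split; try lra.
    eapply Rle_trans; [exact hJ |].
    replace (4 ^ S k) with (4 ^ k * 4) by (simpl; ring).
    rewrite Rmult_assoc; apply Rmult_le_compat_l; [left; apply pow_lt; lra | exact hJ'].
  - destruct (nested_intervals (fun k => fst (s k)) W hW) as [X hX].
    { intros k; apply (hs k). }
    destruct (nested_intervals (fun k => snd (s k)) H hH) as [Y hY].
    { intros k; apply (hs k). }
    assert (hXab : a <= X <= b).
    { generalize (hs 0%nat) (hX 0%nat); simpl; lra. }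
    assert (hYcd : c <= Y <= d).
    { generalize (hs 0%nat) (hY 0%nat); simpl; lra. }
    destruct (Req_dec (J a b c d) 0) as [| hne]; [assumption | exfalso].
    apply Rabs_pos_lt in hne; set (A := Rabs (J a b c d)) in *.
    (* With this eps the local estimate, multiplied by 4^N, yields A <= A / 2. The summand 1 covers
       a degenerate rectangle. *)
    assert (he : 0 < A / (2 * ((W + H) ^ 2 + 1)) / 2).
    { assert (0 <= (W + H) ^ 2) by apply pow2_ge_0.
      apply Rdiv_lt_0_compat; [apply Rdiv_lt_0_compat |]; lra. }
    destruct (boundary_integral_local X Y (mkposreal _ he) hXab hYcd) as [de hde].
    destruct (pow_lt_1_zero (/ 2) ltac:(rewrite Rabs_pos_eq; lra) (de / (W + H + 1))) as [N hN].
    { apply Rdiv_lt_0_compat; [apply cond_pos | lra]. }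
    specialize (hN N (le_n N)); rewrite Rabs_pos_eq, pow_inv in hN
      by (apply pow_le; lra).
    destruct (hs N) as [((x1 & x2) & (y1 & y2) & hJ) _].
    assert (hi : 0 < / 2 ^ N) by apply Rinv_0_lt_compat, hp.
    assert (k1 := hde (fst (s N)) (snd (s N)) (W / 2 ^ N) (H / 2 ^ N) x1 (hX N) x2 y1 (hY N) y2).
    assert (k2 : W / 2 ^ N + H / 2 ^ N < de).
    { unfold Rdiv; rewrite <- Rmult_plus_distr_r.
      apply Rle_lt_trans with ((W + H + 1) * / 2 ^ N); [nra |].
      apply (Rmult_lt_compat_l (W + H + 1)) in hN; [| lra].
      replace ((W + H + 1) * (de / (W + H + 1))) with (pos de) in hN by (field; lra); lra. }
    specialize (k1 k2); cbn [pos] in k1.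
    apply (Rmult_le_compat_l (4 ^ N)) in k1; [| left; apply pow_lt; lra].
    assert (e4 : 4 ^ N = 2 ^ N * 2 ^ N) by (rewrite <- Rpow_mult_distr; f_equal; lra).
    replace (4 ^ N * (2 * (A / (2 * ((W + H) ^ 2 + 1)) / 2) * (W / 2 ^ N + H / 2 ^ N) ^ 2))
      with (A * ((W + H) ^ 2 / ((W + H) ^ 2 + 1)) / 2) in k1.
    2: { rewrite e4; assert (hs2 := pow2_ge_0 (W + H)).
         assert (hpN := hp N); field; split; lra. }
    assert (k3 : (W + H) ^ 2 / ((W + H) ^ 2 + 1) <= 1).
    { assert (0 <= (W + H) ^ 2) by apply pow2_ge_0.
      apply Rmult_le_reg_r with ((W + H) ^ 2 + 1); [lra |].
      unfold Rdiv; rewrite Rmult_assoc, Rinv_l; lra. }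
    nra.
Qed.

End Goursat.

(** * The mean value property *)

Definition cis (t : R) : C := (cos t, sin t).

(** Unfolds the filter-based derivative to a remainder estimate in [Cmod], the form in which complex
    derivatives are handled below. *)
Lemma is_derive_C_iff (f : C -> C) (z l : C) :
  is_derive (V := C_NormedModule) f z l <->
  forall eps : posreal, exists delta : posreal, forall w,
    Cmod (w - z) < delta -> Cmod (f w - f z - (w - z) * l) <= eps * Cmod (w - z).
Proof.
  split.
  - intros [_ h] eps; specialize (h z (fun P hP => hP) eps).
    destruct h as [de h]; exists de; intros w hw; exact (h w hw).
  - intros h; split; [apply is_linear_scal_l |].
    intros x hx eps.
    apply (@is_filter_lim_locally_unique C_AbsRing (AbsRing_NormedModule C_AbsRing)) in hx.
    subst x; destruct (h eps) as [de hde]; exists de; intros w hw; exact (hde w hw).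
Qed.
(** The Cauchy-Riemann equations, read off from the real and imaginary parts of (w - z) l. Since |w
    - z| is at most twice the larger coordinate of w - z, both eps and delta are halved. *)
Lemma differentiable_pt_lim_Re_Im (f : C -> C) (x y : R) (l : C) :
  is_derive (V := C_NormedModule) f (x, y) l ->
  differentiable_pt_lim (fun x y => Re (f (x, y))) x y (Re l) (- Im l) /\
  differentiable_pt_lim (fun x y => Im (f (x, y))) x y (Im l) (Re l).
Proof.
  intros h; rewrite is_derive_C_iff in h.
  assert (key : forall eps : posreal, locally_2d (fun u v =>
    Cmod (f (u, v) - f (x, y) - ((u, v) - (x, y)) * l)%C <=
      eps * Rmax (Rabs (u - x)) (Rabs (v - y))) x y).
  { intros eps; destruct (h (pos_div_2 eps)) as [de hde].
    exists (pos_div_2 de); intros u v hu hv.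
    assert (h1 : Cmod ((u, v) - (x, y)) <= 2 * Rmax (Rabs (u - x)) (Rabs (v - y))).
    { eapply Rle_trans; [apply Cmod_2Rmax |].
      change (sqrt 2 * Rmax (Rabs (u - x)) (Rabs (v - y)) <=
              2 * Rmax (Rabs (u - x)) (Rabs (v - y))).
      apply Rmult_le_compat_r; [eapply Rle_trans; [apply Rabs_pos | apply Rmax_l] |].
      rewrite <- (sqrt_square 2) at 2 by lra; apply sqrt_le_1_alt; lra. }
    eapply Rle_trans; [apply hde |].
    - eapply Rle_lt_trans; [exact h1 |].
      simpl in hu, hv; assert (Rmax (Rabs (u - x)) (Rabs (v - y)) < de / 2)
        by now apply Rmax_lub_lt.
      lra.
    - simpl; assert (h0 := cond_pos eps).
      apply (Rmult_le_compat_l (eps / 2)) in h1; lra. }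
  split; intros eps; destruct (key eps) as [de hde]; exists de; intros u v hu hv;
    eapply Rle_trans; try exact (hde u v hu hv).
  - eapply Rle_trans; [| apply re_le_Cmod]; right; f_equal; unfold Re, Im; simpl; ring.
  - eapply Rle_trans; [| eapply Rle_trans; [apply Rmax_r | apply Rmax_Cmod]].
    right; f_equal; unfold Re, Im; simpl; ring.
Qed.

(** Made for polar coordinates, whose components are products of a function of the radius variable
    and a function of the angle. *)
Lemma differentiable_pt_lim_mult (f g : R -> R) x y f' g' :
  is_derive f x f' -> is_derive g y g' ->
  differentiable_pt_lim (fun u v => f u * g v) x y (f' * g y) (f x * g').
Proof.
  intros hf hg.
  assert (hm : forall a b, differentiable_pt_lim Rmult a b b a).
  { intros a b eps; exists eps; intros u v hu hv.
    replace (_ - _) with ((u - a) * (v - b)) by ring.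
    rewrite Rabs_mult, Rmult_comm; apply Rmult_le_compat; try apply Rabs_pos; [lra |].
    apply Rmax_l. }
  assert (hf2 : differentiable_pt_lim (fun u _ => f u) x y f' 0).
  { apply differentiable_pt_lim_proj1_0; now apply is_derive_Reals. }
  assert (hg2 : differentiable_pt_lim (fun _ v => g v) x y 0 g').
  { assert (h : differentiable_pt_lim (fun u _ => g u) y x g' 0)
      by (apply differentiable_pt_lim_proj1_0; now apply is_derive_Reals).
    intros eps; destruct (h eps) as [de hde]; exists de; intros u v hu hv.
    rewrite Rmax_comm, (Rplus_comm (0 * _)); exact (hde v u hv hu). }
  assert (h := differentiable_pt_lim_comp _ _ _ _ _ _ _ _ _ _ _ (hm (f x) (g y)) hf2 hg2).
  simpl in h; replace (f' * g y) with (g y * f' + f x * 0) by ring.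
  replace (f x * g') with (g y * 0 + f x * g') by ring; exact h.
Qed.

Section MeanValue.

Context (f : C -> C).
Context (hf : forall z, disc z -> ex_derive (V := C_NormedModule) f z).

(* Logarithmic polar coordinates turn the Cauchy-Riemann equations into
   [P_s = Q_t] without any weight, which is the hypothesis of Green's theorem. *)
Let P (s t : R) : R := Re (f (exp s * cos t, exp s * sin t)).
Let Q (s t : R) : R := Im (f (exp s * cos t, exp s * sin t)).

Lemma Cmod_polar (rho t : R) : 0 <= rho -> Cmod (rho * cos t, rho * sin t) = rho.
Proof.
  intros h; unfold Cmod; simpl.
  replace (_ + _) with (rho * rho).
  - now apply sqrt_square.
  - assert (e := sin2_cos2 t); unfold Rsqr in e.
    replace (rho * rho) with (rho * rho * (sin t * sin t + cos t * cos t)) by (rewrite e; ring).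
    ring.
Qed.

(** By the chain rule both P_s and Q_t are Re (z f'(z)) at z = exp s (cos t + i sin t); s < 0 keeps
    z in the disc. *)
Lemma log_polar_differentiable s t : s < 0 -> exists p p' q,
  differentiable_pt_lim P s t p p' /\ differentiable_pt_lim Q s t q p.
Proof.
  intros hs.
  assert (hd : disc (exp s * cos t, exp s * sin t)).
  { unfold disc; rewrite Cmod_polar by (left; apply exp_pos).
    rewrite <- exp_0; now apply exp_increasing. }
  destruct (hf _ hd) as [l hl].
  destruct (differentiable_pt_lim_Re_Im _ _ _ _ hl) as [hR hI].
  assert (hx := differentiable_pt_lim_mult exp cos s t _ _ (is_derive_exp s) (is_derive_cos t)).
  assert (hy := differentiable_pt_lim_mult exp sin s t _ _ (is_derive_exp s) (is_derive_sin t)).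
  assert (h1 := differentiable_pt_lim_comp _ _ _ _ _ _ _ _ _ _ _ hR hx hy).
  assert (h2 := differentiable_pt_lim_comp _ _ _ _ _ _ _ _ _ _ _ hI hx hy).
  eexists _, _, _; split; [exact h1 |].
  match type of h2 with differentiable_pt_lim _ _ _ _ ?e =>
    replace e with (Re l * (exp s * cos t) + - Im l * (exp s * sin t)) in h2
      by (change scal with Rmult; simpl; ring) end.
  exact h2.
Qed.

(** Green's theorem on [s1, s2] x [0, 2 PI]: the two horizontal edges cancel because Q has period 2
    PI in the angle. *)
Lemma circle_mean_const s1 s2 : s1 <= s2 -> s2 < 0 ->
  RInt (P s1) 0 (2 * PI) = RInt (P s2) 0 (2 * PI).
Proof.
  intros h1 h2; assert (hpi := PI_RGT_0).
  assert (h : boundary_integral P Q s1 s2 0 (2 * PI) = 0).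
  { apply boundary_integral_eq_0; try lra.
    intros x y hx _; apply log_polar_differentiable; lra. }
  unfold boundary_integral in h.
  rewrite (RInt_ext (fun x => Q x (2 * PI)) (fun x => Q x 0)) in h; [lra |].
  intros x _; unfold Q; now rewrite cos_2PI, sin_2PI, cos_0, sin_0.
Qed.

Lemma holo_continuous_eps z : disc z -> forall eps : posreal,
  exists delta : posreal, forall w, Cmod (w - z) < delta -> Cmod (f w - f z) < eps.
Proof.
  intros hz eps; destruct (hf z hz) as [l hl]; rewrite is_derive_C_iff in hl.
  destruct (hl (mkposreal 1 Rlt_0_1)) as [de hde].
  assert (hl0 := Cmod_ge_0 l).
  assert (hp : 0 < eps / (2 + Cmod l)) by (apply Rdiv_lt_0_compat; [apply cond_pos | lra]).
  assert (hd : 0 < Rmin de (eps / (2 + Cmod l)))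
    by (apply Rmin_pos; [apply cond_pos | exact hp]).
  exists (mkposreal _ hd); simpl; intros w hw.
  assert (hw1 := Rlt_le_trans _ _ _ hw (Rmin_l _ _)).
  assert (hw2 := Rlt_le_trans _ _ _ hw (Rmin_r _ _)).
  specialize (hde w hw1); simpl in hde.
  replace (f w - f z)%C with ((f w - f z - (w - z) * l) + (w - z) * l)%C by ring.
  eapply Rle_lt_trans; [apply Cmod_triangle |]; rewrite Cmod_mult.
  assert (h0 := Cmod_ge_0 (w - z)).
  apply (Rmult_lt_compat_l (2 + Cmod l)) in hw2; [| lra].
  replace ((2 + Cmod l) * (eps / (2 + Cmod l))) with (pos eps) in hw2 by (field; lra).
  nra.
Qed.

(** The integral does not depend on the radius, and on small circles it is close to 2 PI Re (f 0) by
    continuity. The circle of radius 0 is treated apart, having no logarithmic radius. *)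
Lemma circle_mean_Re rho : 0 <= rho < 1 ->
  is_RInt (fun t => Re (f (rho * cis t)%C)) 0 (2 * PI) (2 * PI * Re (f (RtoC 0))).
Proof.
  intros [h0 h1]; assert (hpi := PI_RGT_0).
  destruct h0 as [h0 | <-].
  2: { apply (is_RInt_ext (fun _ => Re (f (RtoC 0)))).
       - intros t _; do 2 f_equal; ring.
       - replace (2 * PI * Re (f (RtoC 0))) with (scal (2 * PI - 0) (Re (f (RtoC 0))))
           by (unfold scal; simpl; unfold mult; simpl; ring).
         apply (@is_RInt_const R_NormedModule). }
  set (s := ln rho).
  assert (hs : s < 0) by (rewrite <- ln_1; now apply ln_increasing).
  assert (he : exp s = rho) by now apply exp_ln.
  assert (hex : forall s', s' < 0 -> ex_RInt (P s') 0 (2 * PI)).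
  { intros s' hs'; apply (ex_RInt_vertical P Q s' s' 0 (2 * PI)); try lra.
    intros x y hx _; apply log_polar_differentiable; lra. }
  apply (is_RInt_ext (P s)).
  { intros t _; unfold P; rewrite he; do 2 f_equal.
    unfold cis, Cmult; simpl; f_equal; ring. }
  replace (2 * PI * Re (f (RtoC 0))) with (RInt (P s) 0 (2 * PI));
    [now apply (@RInt_correct R_CompleteNormedModule), hex |].
  apply Rminus_diag_uniq.
  destruct (Req_dec (RInt (P s) 0 (2 * PI) - 2 * PI * Re (f (RtoC 0))) 0) as [| hne];
    [assumption | exfalso].
  apply Rabs_pos_lt in hne.
  set (A := Rabs _) in hne.
  (* Within this distance of f 0 on a small circle, the integral is off by at most A / 2, against
     the assumed gap A. *)
  assert (hA : 0 < A / (4 * PI)) by (apply Rdiv_lt_0_compat; lra).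
  destruct (holo_continuous_eps _ disc0 (mkposreal _ hA)) as [de hde].
  (* Below s, so that [circle_mean_const] applies, and with radius exp s' less than [de]. *)
  set (s' := Rmin s (ln (de / 2))).
  assert (hs' : s' <= s) by apply Rmin_l.
  assert (hs2 : exp s' < de).
  { apply Rle_lt_trans with (de / 2); [| assert (k := cond_pos de); lra].
    rewrite <- (exp_ln (de / 2)) by (assert (k := cond_pos de); lra).
    destruct (Rmin_r s (ln (de / 2))) as [k | k];
      [left; now apply exp_increasing | right; now f_equal]. }
  assert (h2 := RInt_near_const (P s') 0 (2 * PI) (Re (f (RtoC 0))) (A / (4 * PI))
                  ltac:(lra) (hex s' ltac:(lra))).
  rewrite (circle_mean_const s' s) in h2 by lra.
  rewrite Rminus_0_r, (Rmult_comm (Re _)) in h2; fold A in h2.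
  assert (h3 : A <= 2 * PI * (A / (4 * PI))).
  { apply h2; intros t _; unfold P; left.
    set (w := (exp s' * cos t, exp s' * sin t) : C).
    change (Rabs (Re (f w - f (RtoC 0))) < A / (4 * PI)).
    eapply Rle_lt_trans; [apply re_le_Cmod |]; apply hde.
    replace (w - 0)%C with w by ring.
    unfold w; rewrite Cmod_polar; [exact hs2 | left; apply exp_pos]. }
  replace (2 * PI * (A / (4 * PI))) with (A / 2) in h3 by (field; lra); lra.
Qed.

End MeanValue.

(** * Equidistribution *)

Lemma pigeonhole_nat (g : nat -> nat) (N : nat) :
  (forall m, (m <= N)%nat -> (g m < N)%nat) ->
  exists i j, (i < j)%nat /\ (j <= N)%nat /\ g i = g j.
Proof.
  intros hg.
  destruct (classic (exists i j, (i < j)%nat /\ (j <= N)%nat /\ g i = g j)) as [| hn];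
    [assumption | exfalso].
  assert (h1 : NoDup (map g (seq 0 (S N)))).
  { apply NoDup_map_NoDup_ForallPairs; [| apply seq_NoDup].
    intros i j hi hj e; apply in_seq in hi; apply in_seq in hj.
    destruct (Nat.lt_trichotomy i j) as [h | [h | h]]; auto; exfalso; apply hn.
    - exists i, j; repeat split; auto; lia.
    - exists j, i; repeat split; auto; lia. }
  assert (h2 : incl (map g (seq 0 (S N))) (seq 0 N)).
  { intros x hx; apply in_map_iff in hx; destruct hx as [i [<- hi]].
    apply in_seq in hi; apply in_seq; generalize (hg i); lia. }
  apply (NoDup_incl_length h1) in h2; rewrite length_map, !length_seq in h2; lia.
Qed.

(** Pigeonhole on the fractional parts of m tau / T for m = 0, ..., N, with N boxes of length 1 / N
    < delta / T; the difference of two indices sharing a box is q. *)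
Lemma dirichlet_approximation (tau T delta : R) : 0 < T -> 0 < delta ->
  exists (q : nat) (p : Z), (1 <= q)%nat /\ Rabs (INR q * tau - IZR p * T) < delta.
Proof.
  intros hT hd.
  destruct (archimed_cor1 (delta / T)) as [N [hN hN0]]; [now apply Rdiv_lt_0_compat |].
  assert (hNp : 0 < INR N) by now apply lt_0_INR.
  set (x := fun m => INR m * tau / T).
  (* The number of the box [i / N, (i + 1) / N) that contains the fractional part. *)
  set (g := fun m => Z.to_nat (Int_part (INR N * frac_part (x m)))).
  assert (hfl : forall m, INR (g m) <= INR N * frac_part (x m) < INR (g m) + 1).
  { intros m; destruct (base_fp (x m)) as [h1 h2].
    destruct (base_Int_part (INR N * frac_part (x m))) as [h3 h4].
    assert (h5 : (0 <= Int_part (INR N * frac_part (x m)))%Z).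
    { apply Z.lt_succ_r, lt_IZR; rewrite succ_IZR.
      assert (0 <= INR N * frac_part (x m)) by (apply Rmult_le_pos; lra); lra. }
    unfold g; rewrite INR_IZR_INZ, Z2Nat.id by exact h5; lra. }
  destruct (pigeonhole_nat g N) as (i & j & hij & _ & e).
  { intros m _; apply INR_lt; destruct (hfl m) as [h1 _].
    destruct (base_fp (x m)) as [h2 h3]; nra. }
  exists (j - i)%nat, (Int_part (x j) - Int_part (x i))%Z; split; [lia |].
  assert (h : INR N * Rabs (frac_part (x j) - frac_part (x i)) < 1).
  { rewrite <- (Rabs_pos_eq (INR N)) at 1 by lra; rewrite <- Rabs_mult.
    assert (h1 := hfl i); assert (h2 := hfl j); rewrite e in h1; apply Rabs_def1; nra. }
  replace (INR (j - i) * tau - _) with (T * (frac_part (x j) - frac_part (x i))).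
  - rewrite Rabs_mult, (Rabs_pos_eq T) by lra.
    apply Rmult_lt_reg_l with (/ T); [now apply Rinv_0_lt_compat |].
    rewrite <- Rmult_assoc, Rinv_l, Rmult_1_l by lra.
    rewrite (Rmult_comm (/ T)); apply Rlt_trans with (/ INR N); [| exact hN].
    apply Rmult_lt_reg_l with (INR N); [exact hNp |]; rewrite Rinv_r by lra; exact h.
  - unfold frac_part, x; rewrite minus_INR, minus_IZR by lia; field; lra.
Qed.

Lemma sum_from_1_S {G : AbelianMonoid} (u : nat -> G) n :
  sum_n_m u 1 (S n) = plus (sum_n_m u 1 n) (u (S n)).
Proof. apply sum_n_Sm; lia. Qed.

Lemma sum_from_1_0 {G : AbelianMonoid} (u : nat -> G) : sum_n_m u 1 0 = zero.
Proof. apply sum_n_m_zero; lia. Qed.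

Lemma sum_from_1_add {G : AbelianMonoid} (u : nat -> G) n k :
  sum_n_m u 1 (n + k) = plus (sum_n_m u 1 n) (sum_n_m (fun j => u (n + j)%nat) 1 k).
Proof.
  induction k as [| k IH].
  - now rewrite Nat.add_0_r, sum_from_1_0, plus_zero_r.
  - rewrite Nat.add_succ_r, !sum_from_1_S, IH, <- plus_assoc; do 3 f_equal; lia.
Qed.

(** Groups 1, ..., J q by residue class modulo q: along one class the rotation angle advances by q
    tau, which is tiny modulo the period. [pred j] starts each class at its representative a in 1,
    ..., q. *)
Lemma sum_from_1_blocks {G : AbelianMonoid} (u : nat -> G) q J :
  sum_n_m u 1 (J * q) =
  sum_n_m (fun a => sum_n_m (fun j => u (a + pred j * q)%nat) 1 J) 1 q.
Proof.
  induction J as [| J IH].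
  - rewrite sum_from_1_0; symmetry.
    transitivity (sum_n_m (fun _ : nat => zero : G) 1 q); [| apply sum_n_m_const_zero].
    apply sum_n_m_ext; intros a; apply sum_from_1_0.
  - rewrite Nat.mul_succ_l, sum_from_1_add, IH, <- sum_n_m_plus.
    apply sum_n_m_ext; intros a; rewrite sum_from_1_S; simpl; do 2 f_equal; lia.
Qed.

Lemma norm_sum_from_1_le {K : AbsRing} {V : NormedModule K} (u : nat -> V) n M :
  (forall m, (1 <= m <= n)%nat -> norm (u m) <= M) -> norm (sum_n_m u 1 n) <= INR n * M.
Proof.
  induction n as [| n IH]; intros h.
  - rewrite sum_from_1_0, norm_zero; simpl; lra.
  - rewrite sum_from_1_S, S_INR; eapply Rle_trans; [apply norm_triangle |].
    assert (h1 := h (S n) ltac:(lia)); assert (h2 := IH ltac:(intros; apply h; lia)); lra.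
Qed.

Section Periodic.

Context {A : Type} (g : R -> A) (T : R) (hT : 0 < T) (hper : forall t, g (t + T) = g t).

Lemma periodic_Z t (k : Z) : g (t + IZR k * T) = g t.
Proof.
  revert t; induction k as [| k IH | k IH] using Z.peano_ind; intros t.
  - f_equal; ring.
  - rewrite succ_IZR; replace (t + _) with (t + IZR k * T + T) by ring.
    now rewrite hper, IH.
  - rewrite <- (hper (t + _)); unfold Z.pred; rewrite plus_IZR.
    replace (t + _ + T) with (t + IZR k * T) by (simpl; ring); apply IH.
Qed.

Lemma reduce_mod_period t : exists k : Z, 0 <= t - IZR k * T <= T.
Proof.
  exists (Int_part (t / T)); destruct (base_Int_part (t / T)) as [h1 h2].
  replace (t - IZR (Int_part (t / T)) * T) with ((t / T - IZR (Int_part (t / T))) * T)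
    by (field; lra).
  set (u := t / T - _); assert (hu : 0 <= u <= 1) by (unfold u; lra); nra.
Qed.

End Periodic.

Section Equidistribution.

Context (g : R -> R) (T B : R) (hT : 0 < T).
Context (hc : forall t, continuous g t) (hper : forall t, g (t + T) = g t).
Context (hB : forall t, Rabs (g t) <= B) (h0 : RInt g 0 T = 0).

Let ex_g a b : ex_RInt g a b.
Proof. apply (@ex_RInt_continuous R_CompleteNormedModule); auto. Qed.

(** As g has mean zero, its primitive is periodic and hence bounded by T B. The bound is therefore
    independent of the length of [a, b]. *)
Lemma RInt_zero_mean_bound a b : Rabs (RInt g a b) <= 2 * (T * B).
Proof.
  set (G := fun x => RInt g 0 x).
  assert (hG : forall x, G (x + T) = G x).
  { intros x; unfold G.
    rewrite <- (RInt_Chasles g 0 T (x + T)) by apply ex_g; rewrite h0.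
    change (0 + RInt g T (x + T) = RInt g 0 x); rewrite Rplus_0_l.
    replace (RInt g T (x + T)) with (RInt g (1 * 0 + T) (1 * x + T)) by (f_equal; ring).
    rewrite <- RInt_comp_lin by apply ex_g.
    apply RInt_ext; intros t _; rewrite hper; change (1 * g (1 * t) = g t).
    now rewrite !Rmult_1_l. }
  assert (hb : forall x, Rabs (G x) <= T * B).
  { intros x; destruct (reduce_mod_period T hT x) as [k hk].
    replace x with (x - IZR k * T + IZR k * T) by ring; rewrite (periodic_Z G T hG).
    set (y := x - IZR k * T) in *.
    eapply Rle_trans; [apply abs_RInt_le_const; [apply hk | apply ex_g | intros; apply hB] |].
    apply Rmult_le_compat_r; [| lra].
    eapply Rle_trans; [apply Rabs_pos | apply (hB 0)]. }
  replace (RInt g a b) with (G b - G a).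
  - assert (h1 := hb a); assert (h2 := hb b).
    apply Rabs_le_between in h1; apply Rabs_le_between in h2; apply Rabs_le; lra.
  - unfold G; rewrite <- (RInt_Chasles g 0 a b) by apply ex_g.
    unfold plus; simpl; ring.
Qed.

(** Multiplied by eta, the sum is a Riemann sum for the integral of g over an interval of length J
    |eta|, which may cover many periods. Each step errs by at most |eta| eps, and the integral
    itself stays bounded; the sign of eta is arbitrary. *)
Lemma riemann_sum_zero_mean (eta eps : R) :
  eta <> 0 -> (forall t t', Rabs (t - t') <= Rabs eta -> Rabs (g t - g t') <= eps) ->
  forall theta J,
  Rabs (sum_n_m (fun j => g (theta + INR (pred j) * eta)) 1 J)
    <= INR J * eps + 2 * (T * B) / Rabs eta.
Proof.
  intros hne hm theta J.
  assert (hpos : 0 < Rabs eta) by now apply Rabs_pos_lt.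
  assert (key : Rabs (eta * sum_n_m (fun j => g (theta + INR (pred j) * eta)) 1 J
                      - RInt g theta (theta + INR J * eta)) <= INR J * (Rabs eta * eps)).
  { induction J as [| J IH].
    - rewrite sum_from_1_0; simpl; rewrite Rmult_0_l, Rplus_0_r, (RInt_point theta g).
      change zero with 0; rewrite Rmult_0_r, Rminus_0_r, Rabs_R0; lra.
    - rewrite sum_from_1_S, S_INR; simpl pred.
      set (s := sum_n_m _ _ _) in *; set (t := theta + INR J * eta) in *.
      replace (theta + (INR J + 1) * eta) with (t + eta) by (unfold t; ring).
      rewrite <- (RInt_Chasles g theta t (t + eta)) by apply ex_g.
      assert (h1 : Rabs (eta * g t - RInt g t (t + eta)) <= Rabs eta * eps).
      { rewrite Rabs_minus_sym.
        assert (hcst : ex_RInt (fun _ : R => g t) t (t + eta))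
          by apply (@ex_RInt_const R_NormedModule).
        replace (RInt g t (t + eta) - eta * g t) with
          (minus (RInt g t (t + eta)) (RInt (fun _ => g t) t (t + eta))).
        2: { rewrite RInt_const; unfold minus, plus, opp, scal; simpl;
             unfold mult; simpl; ring. }
        replace (Rabs eta) with (Rabs (t + eta - t)) by (f_equal; ring).
        apply (norm_RInt_le_const_abs (V := R_NormedModule) (fun x => minus (g x) (g t))
                 t (t + eta)).
        - intros x hx; apply hm.
          revert hx; unfold Rmin, Rmax, Rabs;
            repeat (destruct (Rle_dec _ _) || destruct (Rcase_abs _)); lra.
        - apply (@is_RInt_minus R_NormedModule);
            now apply (@RInt_correct R_CompleteNormedModule). }
      change (Rabs (eta * (s + g t) - (RInt g theta t + RInt g t (t + eta)))
                <= (INR J + 1) * (Rabs eta * eps)).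
      apply Rabs_le_between in h1; apply Rabs_le_between in IH; apply Rabs_le; lra. }
  assert (hi := RInt_zero_mean_bound theta (theta + INR J * eta)).
  set (s := sum_n_m _ _ _) in *.
  apply Rmult_le_reg_l with (Rabs eta); [exact hpos |].
  rewrite <- Rabs_mult, Rmult_plus_distr_l.
  replace (Rabs eta * (2 * (T * B) / Rabs eta)) with (2 * (T * B)) by (field; lra).
  apply Rabs_le_between in key; apply Rabs_le_between in hi; apply Rabs_le; lra.
Qed.

(** Write n = J q + r. Each residue class modulo q is a progression of step eta modulo T, and the r
    < q remaining terms are bounded trivially. The second summand of the bound involves neither
    theta nor n, and g enters only through B and its modulus of continuity; this is what makes the
    later convergence uniform on a disc. *)
Lemma weyl_sum_bound (tau eps : R) (q : nat) (p : Z) :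
  let eta := INR q * tau - IZR p * T in
  (1 <= q)%nat -> eta <> 0 ->
  (forall t t', Rabs (t - t') <= Rabs eta -> Rabs (g t - g t') <= eps) ->
  forall theta n,
  Rabs (sum_n_m (fun m => g (theta + INR m * tau)) 1 n)
    <= INR n * eps + (INR q * (2 * (T * B) / Rabs eta) + INR q * B).
Proof.
  intros eta hq hne hm theta n.
  assert (he : 0 <= eps).
  { eapply Rle_trans; [apply Rabs_pos | apply (hm 0 0)].
    rewrite Rminus_eq_0, Rabs_R0; apply Rabs_pos. }
  assert (hB0 : 0 <= B) by (eapply Rle_trans; [apply Rabs_pos | apply (hB 0)]).
  set (J := (n / q)%nat); set (r := (n mod q)%nat).
  assert (en : n = (J * q + r)%nat).
  { unfold J, r; rewrite Nat.mul_comm; apply Nat.div_mod; lia. }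
  assert (hr : (r < q)%nat) by (apply Nat.mod_upper_bound; lia).
  rewrite en, sum_from_1_add, sum_from_1_blocks.
  set (s1 := sum_n_m _ 1 q); set (s2 := sum_n_m _ 1 r).
  assert (k1 : Rabs s1 <= INR q * (INR J * eps + 2 * (T * B) / Rabs eta)).
  { apply (norm_sum_from_1_le (V := R_NormedModule)); intros a _.
    eapply Rle_trans; [right | apply (riemann_sum_zero_mean eta eps hne hm (theta + INR a * tau))].
    change norm with Rabs; f_equal; apply sum_n_m_ext; intros j.
    (* Subtracting [pred j * p] periods turns the step q tau into eta. *)
    rewrite plus_INR, mult_INR, <- (periodic_Z g T hper _ (- (Z.of_nat (pred j) * p))%Z).
    f_equal; unfold eta; rewrite opp_IZR, mult_IZR, <- INR_IZR_INZ; ring. }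
  assert (k2 : Rabs s2 <= INR r * B).
  { apply (norm_sum_from_1_le (V := R_NormedModule)); intros a _; apply hB. }
  change (Rabs (s1 + s2) <= INR (J * q + r) * eps
            + (INR q * (2 * (T * B) / Rabs eta) + INR q * B)).
  rewrite plus_INR, mult_INR.
  assert (hr' : INR r <= INR q) by (apply le_INR; lia).
  assert (hr0 := pos_INR r).
  assert (k3 := Rabs_triang s1 s2).
  assert (k4 : INR r * B <= INR q * B) by (apply Rmult_le_compat_r; lra).
  assert (k5 : 0 <= INR r * eps) by (apply Rmult_le_pos; lra).
  lra.
Qed.

End Equidistribution.

(** * Convergence of the rotation averages on smaller discs *)

Lemma cis_exists (z : C) : Cmod z = 1 -> exists t, z = cis t.
Proof.
  destruct z as [x y]; intros h.
  assert (e : x * x + y * y = 1).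
  { assert (h1 := Cmod2_alt (x, y)); rewrite h in h1; unfold Re, Im in h1; simpl in h1; lra. }
  assert (hx : -1 <= x <= 1) by nra.
  assert (hs : sqrt (1 - Rsqr x) = Rabs y).
  { rewrite <- sqrt_Rsqr_abs; f_equal; unfold Rsqr; lra. }
  destruct (Rle_dec 0 y) as [hy | hy].
  - exists (acos x); unfold cis; rewrite cos_acos, sin_acos, hs by exact hx.
    now rewrite Rabs_pos_eq.
  - exists (- acos x); unfold cis; rewrite cos_neg, sin_neg, cos_acos, sin_acos, hs by exact hx.
    rewrite Rabs_left by lra; f_equal; ring.
Qed.

Lemma RtoC_neq_0 (x : R) : x <> 0 -> RtoC x <> RtoC 0.
Proof. intros h e; apply h; exact (f_equal fst e). Qed.

Lemma polar_form (z : C) : exists t, z = (Cmod z * cis t)%C.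
Proof.
  destruct (Req_dec (Cmod z) 0) as [h | h].
  - exists 0; rewrite h, (Cmod_eq_0 z h); ring.
  - assert (hz : RtoC (Cmod z) <> 0%C) by now apply RtoC_neq_0.
    destruct (cis_exists (z / Cmod z)%C) as [t ht].
    + rewrite Cmod_div, Cmod_R, Rabs_pos_eq by (auto; apply Cmod_ge_0); now field.
    + exists t; rewrite <- ht; now field.
Qed.

Lemma cis_add (s t : R) : cis (s + t) = (cis s * cis t)%C.
Proof.
  unfold cis, Cmult; simpl; rewrite cos_plus, sin_plus; f_equal; ring.
Qed.

Lemma cis_pow (t : R) n : (cis t ^ n)%C = cis (INR n * t).
Proof.
  induction n as [| n IH].
  - unfold cis; simpl; now rewrite Rmult_0_l, cos_0, sin_0.
  - rewrite S_INR, Rmult_plus_distr_r, Rmult_1_l, cis_add, <- IH, Cpow_S; apply Cmult_comm.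
Qed.

Lemma Cmod_real_cis rho t : 0 <= rho -> Cmod (rho * cis t) = rho.
Proof.
  intros h; replace (rho * cis t)%C with ((rho * cos t, rho * sin t) : C).
  - now apply Cmod_polar.
  - unfold cis, Cmult; simpl; f_equal; ring.
Qed.

Section RotationAverages.

Context (lambda : C) (hl : Cmod lambda = 1).
Context (hroot : forall k : nat, (1 <= k)%nat -> (lambda ^ k)%C <> RtoC 1).
Context (r B : R) (hr : r < 1).

(** One delta must serve all circles of radius at most r, because q and p are chosen from it before
    z is given. *)
Lemma circle_uniform_continuity (f : C -> C) :
  (forall z, disc z -> ex_derive (V := C_NormedModule) f z) ->
  forall eps : posreal, exists delta : posreal, forall rho t t', 0 <= rho <= r ->
  Rabs (t - t') <= delta -> Rabs (Re (f (rho * cis t)%C) - Re (f (rho * cis t')%C)) <= eps.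
Proof.
  intros hf eps.
  set (F := fun rho t => Re (f (rho * cis t)%C)).
  assert (hF : forall x y, 0 <= x <= r -> continuity_2d_pt F x y).
  { intros x y hx e.
    assert (hd : disc (x * cis y)) by (unfold disc; rewrite Cmod_real_cis; lra).
    destruct (holo_continuous_eps f hf _ hd e) as [de hde].
    assert (h1 := differentiable_pt_lim_mult (fun u => u) cos x y _ _
                    (is_derive_id x) (is_derive_cos y)).
    assert (h2 := differentiable_pt_lim_mult (fun u => u) sin x y _ _
                    (is_derive_id x) (is_derive_sin y)).
    assert (c1 : continuity_2d_pt (fun u v => u * cos v) x y)
      by (apply differentiable_continuity_pt; eexists _, _; exact h1).
    assert (c2 : continuity_2d_pt (fun u v => u * sin v) x y)
      by (apply differentiable_continuity_pt; eexists _, _; exact h2).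
    destruct (c1 (pos_div_2 de)) as [d1 k1]; destruct (c2 (pos_div_2 de)) as [d2 k2].
    assert (hm : 0 < Rmin d1 d2) by (apply Rmin_pos; apply cond_pos).
    exists (mkposreal _ hm); simpl; intros u v hu hv.
    specialize (k1 u v (Rlt_le_trans _ _ _ hu (Rmin_l _ _)) (Rlt_le_trans _ _ _ hv (Rmin_l _ _))).
    specialize (k2 u v (Rlt_le_trans _ _ _ hu (Rmin_r _ _)) (Rlt_le_trans _ _ _ hv (Rmin_r _ _))).
    change (Rabs (Re (f (u * cis v) - f (x * cis y))%C) < e).
    eapply Rle_lt_trans; [apply re_le_Cmod |]; apply hde.
    eapply Rle_lt_trans; [apply Cmod_2Rmax |].
    apply Rle_lt_trans with (2 * Rmax (Rabs (u * cos v - x * cos y)) (Rabs (u * sin v - x * sin y))).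
    - apply Rmult_le_compat.
      + apply sqrt_pos.
      + eapply Rle_trans; [apply Rabs_pos | apply Rmax_l].
      + rewrite <- (sqrt_square 2) at 2 by lra; apply sqrt_le_1_alt; lra.
      + right; f_equal; f_equal; unfold cis; simpl; ring.
    - simpl in k1, k2.
      assert (k3 := Rmax_lub_lt _ _ _ k1 k2); lra. }
  assert (hpi := PI_RGT_0).
  (* The margin 1 around [0, 2 PI] leaves room for t once t' has been reduced modulo 2 PI and t
     shifted by the same amount. *)
  destruct (uniform_continuity_2d F 0 r (-1) (2 * PI + 1)
              (fun x y hx _ => hF x y hx) eps) as [de hde].
  assert (hm : 0 < Rmin (de / 2) 1)
    by (apply Rmin_pos; [assert (k := cond_pos de); lra | lra]).
  exists (mkposreal _ hm); simpl; intros rho t t' hrho ht.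
  assert (ht1 := Rle_trans _ _ _ ht (Rmin_l _ _)).
  assert (ht2 := Rle_trans _ _ _ ht (Rmin_r _ _)).
  assert (hper : forall s, F rho (s + 2 * PI) = F rho s).
  { intros s; unfold F, cis; rewrite cos_plus, sin_plus, cos_2PI, sin_2PI.
    do 3 f_equal; f_equal; ring. }
  destruct (reduce_mod_period (2 * PI) ltac:(lra) t') as [k hk].
  change (Rabs (F rho t - F rho t') <= eps); left.
  rewrite <- (periodic_Z _ _ hper t (- k)), <- (periodic_Z _ _ hper t' (- k)), opp_IZR.
  apply Rabs_le_between in ht2; assert (hde0 := cond_pos de).
  apply hde; try lra.
  - rewrite Rminus_eq_0, Rabs_R0; lra.
  - replace (_ - _) with (t - t') by ring; lra.
Qed.

(** [weyl_sum_bound] applied to the real part of f - f 0 on the circle through z, which has mean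
    zero by the mean value property. Neither q, p nor the constant [K] depends on z. *)
Lemma rotation_averages_Re (f : C -> C) :
  (forall z, disc z -> ex_derive (V := C_NormedModule) f z) ->
  (forall z, Cmod z <= r -> Cmod (f z) <= B) ->
  forall eps, 0 < eps -> exists N, forall n, (N <= n)%nat -> forall z, Cmod z <= r ->
  Rabs (sum_n_m (fun m => Re (f (lambda ^ m * z)%C) - Re (f (RtoC 0))) 1 n) <= INR n * eps.
Proof.
  intros hf hB eps heps; assert (hpi := PI_RGT_0).
  assert (he : 0 < eps / 2) by lra.
  destruct (circle_uniform_continuity f hf (mkposreal _ he)) as [de hde]; simpl in hde.
  destruct (cis_exists lambda hl) as [tau htau].
  destruct (dirichlet_approximation tau (2 * PI) de ltac:(lra) (cond_pos de))
    as (q & p & hq & hqp).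
  set (eta := INR q * tau - IZR p * (2 * PI)) in hqp.
  (* Otherwise q tau is a multiple of 2 PI and lambda^q = 1. *)
  assert (hne : eta <> 0).
  { intros e; apply (hroot q hq); rewrite htau, cis_pow.
    replace (INR q * tau) with (0 + IZR p * (2 * PI)) by (unfold eta in e; lra).
    rewrite (periodic_Z cis (2 * PI)).
    - unfold cis; now rewrite cos_0, sin_0.
    - intros t; unfold cis; rewrite cos_plus, sin_plus, cos_2PI, sin_2PI; f_equal; ring. }
  (* The part of the bound that does not grow with n; it is absorbed by n eps / 2 for n large. *)
  set (K := INR q * (2 * (2 * PI * (2 * B)) / Rabs eta) + INR q * (2 * B)).
  destruct (INR_unbounded (K / (eps / 2))) as [N hN].
  exists N; intros n hn z hz.
  destruct (polar_form z) as [theta htheta]; set (rho := Cmod z) in *.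
  assert (hrho : 0 <= rho <= r) by (split; [apply Cmod_ge_0 | exact hz]).
  set (g := fun t => Re (f (rho * cis t)%C) - Re (f (RtoC 0))).
  assert (hgc : forall t, continuous g t).
  { intros t; apply continuity_pt_filterlim; intros e ehe.
    destruct (circle_uniform_continuity f hf (mkposreal (e / 2) ltac:(lra))) as [d hd].
    exists d; split; [apply cond_pos |]; intros s [_ hs]; unfold dist in *; simpl in *.
    unfold Rdist in *.
    unfold g; replace (_ - _) with (Re (f (rho * cis s)%C) - Re (f (rho * cis t)%C)) by ring.
    eapply Rle_lt_trans; [apply hd; [exact hrho | lra] | lra]. }
  assert (hgper : forall t, g (t + 2 * PI) = g t).
  { intros t; unfold g, cis; rewrite cos_plus, sin_plus, cos_2PI, sin_2PI.
    do 4 f_equal; f_equal; ring. }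
  assert (hgB : forall t, Rabs (g t) <= 2 * B).
  { intros t; change (Rabs (Re (f (rho * cis t) - f (RtoC 0))%C) <= 2 * B).
    eapply Rle_trans; [apply re_le_Cmod |]; unfold Cminus.
    eapply Rle_trans; [apply Cmod_triangle |]; rewrite Cmod_opp.
    assert (k1 : Cmod (f (rho * cis t)%C) <= B)
      by (apply hB; rewrite Cmod_real_cis; apply hrho).
    assert (k2 : Cmod (f (RtoC 0)) <= B) by (apply hB; rewrite Cmod_0; lra).
    lra. }
  assert (hg0 : RInt g 0 (2 * PI) = 0).
  { apply is_RInt_unique.
    assert (h1 := circle_mean_Re f hf rho ltac:(lra)).
    assert (h2 := @is_RInt_const R_NormedModule 0 (2 * PI) (Re (f (RtoC 0)))).
    assert (h3 := @is_RInt_minus R_NormedModule _ _ _ _ _ _ h1 h2).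
    match type of h3 with is_RInt _ _ _ ?e => replace e with 0 in h3 end; [exact h3 |].
    unfold minus, plus, opp, scal; simpl; unfold mult; simpl; ring. }
  assert (key := weyl_sum_bound g (2 * PI) (2 * B) ltac:(lra) hgc hgper hgB hg0 tau (eps / 2)
                   q p hq hne).
  fold eta in key; fold K in key.
  specialize (key ltac:(intros t t' ht; unfold g;
    replace (_ - _) with (Re (f (rho * cis t)%C) - Re (f (rho * cis t')%C)) by ring;
    apply hde; [exact hrho | lra]) theta n).
  rewrite (sum_n_m_ext _ (fun m => g (theta + INR m * tau))).
  - eapply Rle_trans; [exact key |].
    apply le_INR in hn.
    assert (h1 : K <= INR n * (eps / 2)).
    { apply Rmult_le_reg_r with (/ (eps / 2)); [now apply Rinv_0_lt_compat |].
      rewrite Rmult_assoc, Rinv_r by lra; unfold Rdiv at 1 in hN; lra. }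
    lra.
  - intros m; unfold g; do 3 f_equal.
    rewrite htau, cis_pow, htheta, cis_add; ring.
Qed.

Lemma rotation_averages (f : C -> C) :
  (forall z, disc z -> ex_derive (V := C_NormedModule) f z) ->
  (forall z, Cmod z <= r -> Cmod (f z) <= B) ->
  forall eps, 0 < eps -> exists N, forall n, (N <= n)%nat -> forall z, Cmod z <= r ->
  Cmod (sum_n_m (G := C_AbelianMonoid)
          (fun m => f (lambda ^ m * z) - f (RtoC 0))%C 1 n) <= INR n * eps.
Proof.
  intros hf hB eps heps.
  destruct (rotation_averages_Re f hf hB (eps / 2) ltac:(lra)) as [N1 h1].
  (* Re (-i f) = Im f. *)
  destruct (rotation_averages_Re (fun z => (- Ci) * f z)%C) with (eps := eps / 2)
    as [N2 h2]; [| | lra |].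
  - intros z hz; destruct (hf z hz) as [l hd]; exists (- Ci * l)%C.
    rewrite is_derive_C_iff in hd |- *; intros e; destruct (hd e) as [de hde].
    exists de; intros w hw.
    replace (_ - _)%C with (- Ci * (f w - f z - (w - z) * l))%C by ring.
    rewrite Cmod_mult, Cmod_opp, Cmod_Ci, Rmult_1_l; now apply hde.
  - intros z hz; rewrite Cmod_mult, Cmod_opp, Cmod_Ci, Rmult_1_l; now apply hB.
  - exists (Nat.max N1 N2); intros n hn z hz.
    specialize (h1 n ltac:(lia) z hz); specialize (h2 n ltac:(lia) z hz).
    set (S := sum_n_m _ 1 n).
    assert (e : S = (sum_n_m (fun m => Re (f (lambda ^ m * z)%C) - Re (f (RtoC 0))) 1 n,
                     sum_n_m (fun m => Re (- Ci * f (lambda ^ m * z))%C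
                                       - Re (- Ci * f (RtoC 0))%C) 1 n)).
    { unfold S; clear; induction n as [| n IH].
      - now rewrite !sum_from_1_0.
      - rewrite !sum_from_1_S, IH; unfold Re; simpl.
        apply injective_projections; simpl; unfold plus; simpl; ring. }
    assert (h3 : Cmod S <= Rabs (fst S) + Rabs (snd S)).
    { destruct S as [x y]; simpl.
      replace ((x, y) : C) with (x + Ci * y)%C
        by (apply injective_projections; simpl; ring).
      eapply Rle_trans; [apply Cmod_triangle |].
      rewrite Cmod_mult, Cmod_Ci, !Cmod_R; lra. }
    rewrite e in h3 at 2 3; cbn [fst snd] in h3; lra.
Qed.

End RotationAverages.

(** * Cesaro means of the composition operator *)

Section Cesaro.

Context {V : NormedModule C_AbsRing}.

Lemma opnorm_le (T : V -> V) (M : R) :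
  (forall x, norm x <= 1 -> norm (T x) <= M) -> Rbar_le (opnorm T) M.
Proof.
  intros h; apply (proj2 (Lub_Rbar_correct _)); intros r (x & hx & ->); now apply h.
Qed.

Lemma opnorm_lt_elim (T : V -> V) (M : R) (x : V) :
  Rbar_lt (opnorm T) M -> norm x <= 1 -> norm (T x) < M.
Proof.
  intros h hx; apply (Rbar_le_lt_trans (norm (T x)) (opnorm T) M); [| exact h].
  apply (proj1 (Lub_Rbar_correct _)); now exists x.
Qed.

(** [opnorm] only sees the unit ball, so x is rescaled to norm 1. Homogeneity is all that is asked
    of T, which will be a difference of two operators. *)
Lemma opnorm_lt_homogeneous (T : V -> V) (M : R) (x : V) :
  (forall k y, T (scal k y) = scal k (T y)) -> 0 < norm x ->
  Rbar_lt (opnorm T) M -> norm (T x) <= M * norm x.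
Proof.
  intros hT hx hM; set (L := norm x) in *; set (c := RtoC (/ L) : C_AbsRing).
  assert (hc : abs c = / L).
  { change (Cmod (RtoC (/ L)) = / L); rewrite Cmod_R, Rabs_pos_eq; [reflexivity |].
    left; now apply Rinv_0_lt_compat. }
  assert (h1 : norm (scal c x) <= 1).
  { eapply Rle_trans; [apply norm_scal |]; rewrite hc; fold L; right; field; lra. }
  assert (h2 := opnorm_lt_elim T M _ hM h1); rewrite hT in h2.
  assert (e : T x = scal (RtoC L : C_AbsRing) (scal c (T x))).
  { rewrite scal_assoc.
    replace (mult (RtoC L : C_AbsRing) c) with (one : C_AbsRing); [now rewrite scal_one |].
    change (RtoC 1 = RtoC L * RtoC (/ L))%C; rewrite <- RtoC_mult; f_equal; field; lra. }
  rewrite e; eapply Rle_trans; [apply norm_scal |].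
  change (abs (RtoC L : C_AbsRing)) with (Cmod (RtoC L)).
  rewrite Cmod_R, Rabs_pos_eq by lra; rewrite Rmult_comm.
  apply Rmult_le_compat_r; lra.
Qed.

Lemma opnorm_lim_sot (T : nat -> V -> V) (P : V -> V) :
  (forall n, is_linear (T n)) -> is_linear P -> opnorm_lim T P ->
  forall x, 0 < norm x -> forall eps, 0 < eps -> exists N, forall n, (N <= n)%nat ->
  norm (minus (T n x) (P x)) <= eps * norm x.
Proof.
  intros hT hP h x hx eps heps; destruct (h (mkposreal _ heps)) as [N hN].
  exists N; intros n hn.
  apply (opnorm_lt_homogeneous (fun y => minus (T n y) (P y))); [| exact hx | now apply hN].
  intros k y; rewrite (linear_scal _ (hT n)), (linear_scal _ hP).
  symmetry; apply (scal_minus_distr_l k (T n y) (P y)).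
Qed.

Lemma norm_le_norm_minus_add (x y : V) : norm x <= norm (minus x y) + norm y.
Proof.
  assert (e : x = plus (minus x y) y)
    by (unfold minus; now rewrite <- plus_assoc, plus_opp_l, plus_zero_r).
  rewrite e at 1; apply norm_triangle.
Qed.

Lemma is_linear_iter (T : V -> V) n : is_linear T -> is_linear (Nat.iter n T).
Proof.
  intros h; induction n as [| n IH].
  - apply is_linear_id.
  - exact (is_linear_comp _ _ IH h).
Qed.

(** Makes a Cesaro mean a [bounded_op], as the limit is in the periodic case, and provides the
    homogeneity that comparisons in operator norm require. *)
Lemma is_linear_cesaro (T : V -> V) n : is_linear T -> is_linear (cesaro T n).
Proof.
  intros h; apply (is_linear_comp (fun x => sum_n_m (fun m => Nat.iter m T x) 1 n)
                     (fun y => scal (RtoC (/ INR n) : C_AbsRing) y)).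
  - induction n as [| n IH].
    + destruct (@is_linear_zero C_AbsRing V V) as [h1 h2 h3]; split.
      * intros x y; rewrite !sum_from_1_0; apply (h1 x y).
      * intros k x; rewrite !sum_from_1_0; apply (h2 k x).
      * destruct h3 as [M [hM h3]]; exists M; split; [exact hM |].
        intros x; rewrite sum_from_1_0; apply h3.
    + assert (h1 := is_linear_comp _ _
        (is_linear_prod _ _ IH (is_linear_iter T (S n) h)) is_linear_plus).
      assert (e : forall x, sum_n_m (fun m => Nat.iter m T x) 1 (S n) =
        plus (sum_n_m (fun m => Nat.iter m T x) 1 n) (Nat.iter (S n) T x))
        by (intros x; apply sum_from_1_S).
      destruct h1 as [k1 k2 [M [hM k3]]]; simpl in *; split.
      * intros x y; rewrite !e; apply k1.
      * intros k x; rewrite !e; apply k2.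
      * exists M; split; [exact hM |]; intros x; rewrite e; apply k3.
  - apply (is_linear_scal_r (K := C_AbsRing)); apply Cmult_comm.
Qed.

Lemma filterlim_norm_iff (u : nat -> V) (l : V) :
  filterlim u eventually (locally l) <->
  forall eps : posreal, exists N, forall n, (N <= n)%nat -> norm (minus (u n) l) < eps.
Proof. exact (filterlim_locally_ball_norm u l). Qed.

End Cesaro.

(** * Pointwise formulas for the iterates and means of the composition operator *)

Section Evaluation.

Context (lambda : C) (hl : Cmod lambda = 1) (v : weight) (hv : typical v).

Local Notation T := (comp_rotation lambda hl v hv).
Local Notation T0 := (comp_rotation0 lambda hl v hv).

Lemma hfun_iter_rotation m (f : Hinf v) z :
  hfun (Nat.iter m T f) z = hfun f (lambda ^ m * z)%C.
Proof.
  revert z; induction m as [| m IH]; intros z.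
  - simpl; now rewrite Cmult_1_l.
  - change (hfun (Nat.iter m T f) (rotation lambda z) = f (lambda ^ S m * z)%C).
    rewrite IH; unfold rotation; f_equal; rewrite Cpow_S; ring.
Qed.

Lemma hfun_minus (f g : Hinf v) z : hfun (minus g f) z = (hfun g z - hfun f z)%C.
Proof. change (hfun g z + (- RtoC 1) * hfun f z = hfun g z - hfun f z)%C; ring. Qed.

Lemma hfun_sum (u : nat -> Hinf v) n z :
  hfun (sum_n_m u 1 n) z = sum_n_m (G := C_AbelianMonoid) (fun m => hfun (u m) z) 1 n.
Proof.
  induction n as [| n IH].
  - now rewrite !sum_from_1_0.
  - rewrite !sum_from_1_S, <- IH; reflexivity.
Qed.

Lemma hfun_cesaro n (f : Hinf v) z :
  hfun (cesaro T n f) z =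
  (RtoC (/ INR n) *
     sum_n_m (G := C_AbelianMonoid) (fun m => hfun f (lambda ^ m * z)) 1 n)%C.
Proof.
  change (hfun (cesaro T n f) z) with
    (RtoC (/ INR n) * hfun (sum_n_m (fun m => Nat.iter m T f) 1 n) z)%C.
  rewrite hfun_sum; f_equal; apply sum_n_m_ext; intros m; apply hfun_iter_rotation.
Qed.

Lemma sub_val_cesaro n (f : H0 v) :
  sub_val (cesaro T0 n f : H0 v) = cesaro T n (sub_val f).
Proof.
  assert (hi : forall m, sub_val (Nat.iter m T0 f : H0 v) = Nat.iter m T (sub_val f)).
  { induction m as [| m IH]; [reflexivity |].
    change (T (sub_val (Nat.iter m T0 f : H0 v)) = T (Nat.iter m T (sub_val f))).
    now rewrite IH. }
  assert (hs : forall k, sub_val (sum_n_m (fun m => Nat.iter m T0 f : H0 v) 1 k : H0 v) =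
                         sum_n_m (fun m => Nat.iter m T (sub_val f)) 1 k).
  { induction k as [| k IH].
    - now rewrite !sum_from_1_0.
    - rewrite !sum_from_1_S, <- IH, <- hi; reflexivity. }
  unfold cesaro at 2; rewrite <- hs; reflexivity.
Qed.

Lemma Cmod_pow_lambda m z : Cmod (lambda ^ m * z) = Cmod z.
Proof. now rewrite Cmod_mult, Cmod_pow, hl, pow1, Rmult_1_l. Qed.

Lemma disc_pow_lambda m z : disc z -> disc (lambda ^ m * z).
Proof. unfold disc; now rewrite Cmod_pow_lambda. Qed.

Lemma weight_pow_lambda m z : disc z -> v (lambda ^ m * z)%C = v z.
Proof.
  intros hz; rewrite (typical_radial v hv z hz).
  rewrite (typical_radial v hv) by now apply disc_pow_lambda.
  now rewrite Cmod_pow_lambda.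
Qed.

Lemma norm_iter_rotation n (f : Hinf v) : norm (Nat.iter n T f) <= norm f.
Proof.
  apply vnorm_le; intros z hz; rewrite hfun_iter_rotation, <- (weight_pow_lambda n) by exact hz.
  now apply vnorm_ub, disc_pow_lambda.
Qed.

Lemma comp_rotation_power_bounded : power_bounded T.
Proof.
  exists 1; intros n; apply opnorm_le; intros x hx.
  eapply Rle_trans; [apply norm_iter_rotation | exact hx].
Qed.

Lemma weight_le_of_Cmod_le r z : 0 <= r < 1 -> Cmod z <= r -> v (RtoC r) <= v z.
Proof.
  intros hr hz; apply (typical_noninc v hv).
  - rewrite Cmod_R, Rabs_pos_eq; lra.
  - unfold disc; rewrite Cmod_R, Rabs_pos_eq; lra.
Qed.

(** * Rotations of finite order *)

Section RootOfUnity.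

Context (k : nat) (hk : (1 <= k)%nat) (hroot : (lambda ^ k)%C = RtoC 1).

Let s (f : Hinf v) (z : C) (m : nat) : C := hfun f (lambda ^ m * z)%C.
Let S1 (f : Hinf v) (z : C) (n : nat) : C := sum_n_m (G := C_AbelianMonoid) (s f z) 1 n.

Let s_periodic f z m : s f z (k + m) = s f z m.
Proof. unfold s; now rewrite Cpow_add_r, hroot, Cmult_1_l. Qed.

Lemma periodic_sum f z J r :
  S1 f z (J * k + r) = (INR J * S1 f z k + S1 f z r)%C.
Proof.
  induction J as [| J IH].
  - simpl; ring.
  - rewrite S_INR, RtoC_plus.
    replace (S J * k + r)%nat with (k + (J * k + r))%nat by lia.
    unfold S1 at 1; rewrite sum_from_1_add.
    rewrite (sum_n_m_ext (fun j => s f z (k + j)%nat) (s f z)) by apply s_periodic.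
    fold (S1 f z k) (S1 f z (J * k + r)); rewrite IH.
    change plus with Cplus; ring.
Qed.

(** With n = J k + r and S_j the sum of the first j terms, the J full periods cancel and the
    difference is (S_r - (r / k) S_k) / n. Since |S_j| <= j M, this is at most 2 r M / n. *)
Lemma cesaro_period_le (f : Hinf v) n : (1 <= n)%nat ->
  norm (minus (cesaro T n f) (cesaro T k f)) <= 2 * INR k / INR n * norm f.
Proof.
  intros hn; apply vnorm_le; intros z hz.
  rewrite hfun_minus, !hfun_cesaro.
  change (v z * Cmod (RtoC (/ INR n) * S1 f z n - RtoC (/ INR k) * S1 f z k)
          <= 2 * INR k / INR n * norm f).
  assert (hkp : 0 < INR k) by (apply lt_0_INR; lia).
  assert (hnp : 0 < INR n) by (apply lt_0_INR; lia).
  assert (hvz := weight_pos v z hz).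
  (* Bounds |f| on the whole orbit of z, along which the weight is constant. *)
  set (M := norm f / v z).
  assert (hM0 : 0 <= M).
  { apply Rmult_le_pos; [apply norm_ge_0 | left; now apply Rinv_0_lt_compat]. }
  assert (hS : forall j, Cmod (S1 f z j) <= INR j * M).
  { intros j; apply (norm_sum_from_1_le (V := C_NormedModule)); intros m _.
    apply Rmult_le_reg_l with (v z); [exact hvz |].
    replace (v z * M) with (norm f) by (unfold M; field; lra).
    rewrite <- (weight_pow_lambda m) by exact hz.
    now apply vnorm_ub, disc_pow_lambda. }
  assert (en := Nat.div_mod n k ltac:(lia)).
  assert (hr := Nat.mod_upper_bound n k ltac:(lia)).
  set (J := (n / k)%nat) in *; set (r := (n mod k)%nat) in *.
  rewrite Nat.mul_comm in en.
  assert (hkC : RtoC (INR k) <> 0%C) by (apply RtoC_neq_0; lra).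
  assert (hnC : RtoC (INR n) <> 0%C) by (apply RtoC_neq_0; lra).
  assert (e : (RtoC (/ INR n) * S1 f z n - RtoC (/ INR k) * S1 f z k =
               RtoC (/ INR n) * (S1 f z r - RtoC (INR r / INR k) * S1 f z k))%C).
  { rewrite en at 2; rewrite periodic_sum.
    unfold Rdiv; rewrite RtoC_mult, !RtoC_inv by lra.
    assert (en' : RtoC (INR n) = (INR J * INR k + INR r)%C)
      by (rewrite en, plus_INR, mult_INR, RtoC_plus, RtoC_mult; reflexivity).
    replace (/ INR k * S1 f z k)%C with (/ INR n * (INR n * (/ INR k * S1 f z k)))%C
      by (field; auto).
    rewrite en' at 3; field; auto. }
  rewrite e, Cmod_mult, Cmod_R, Rabs_pos_eq by (left; now apply Rinv_0_lt_compat).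
  assert (hrk : INR r <= INR k) by (apply le_INR; lia).
  assert (hr0 := pos_INR r).
  assert (h1 : Cmod (S1 f z r - RtoC (INR r / INR k) * S1 f z k) <= 2 * INR k * M).
  { unfold Cminus; eapply Rle_trans; [apply Cmod_triangle |].
    rewrite Cmod_opp, Cmod_mult, Cmod_R.
    assert (hq : 0 <= INR r / INR k)
      by (apply Rmult_le_pos; [lra | left; now apply Rinv_0_lt_compat]).
    rewrite (Rabs_pos_eq _ hq).
    assert (k1 := hS r).
    assert (k2 := Rmult_le_compat_l _ _ _ hq (hS k)).
    replace (INR r / INR k * (INR k * M)) with (INR r * M) in k2 by (field; lra).
    assert (INR r * M <= INR k * M) by (apply Rmult_le_compat_r; lra).
    lra. }
  replace (2 * INR k / INR n * norm f) with (v z * (/ INR n * (2 * INR k * M)))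
    by (unfold M; field; lra).
  apply Rmult_le_compat_l; [lra |]; apply Rmult_le_compat_l; [| exact h1].
  left; now apply Rinv_0_lt_compat.
Qed.

Lemma two_k_over_n_small (eps : R) : 0 < eps ->
  exists N, forall n, (N <= n)%nat -> (1 <= n)%nat /\ 2 * INR k / INR n < eps.
Proof.
  intros he; destruct (INR_unbounded (2 * INR k / eps)) as [N hN].
  exists (S N); intros n hn; split; [lia |].
  assert (h1 : INR (S N) <= INR n) by now apply le_INR.
  rewrite S_INR in h1; assert (h2 := pos_INR N).
  apply Rmult_lt_reg_r with (INR n); [lra |]; unfold Rdiv at 1.
  rewrite Rmult_assoc, Rinv_l, Rmult_1_r by lra.
  apply Rmult_lt_reg_r with (/ eps); [now apply Rinv_0_lt_compat |].
  replace (eps * INR n * / eps) with (INR n) by (field; lra); unfold Rdiv in hN; lra.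
Qed.

(** The limit is the mean over one period, and the estimate of [cesaro_period_le] is uniform on the
    unit ball. *)
Lemma comp_rotation_ume : uniformly_mean_ergodic T.
Proof.
  exists (BoundedOp (cesaro T k) (is_linear_cesaro T k (op_lin T))).
  intros eps; destruct (two_k_over_n_small (eps / 2)) as [N hN].
  { assert (h := cond_pos eps); lra. }
  exists N; intros n hn; destruct (hN n hn) as [h1 h2].
  eapply Rbar_le_lt_trans; [apply (opnorm_le _ (eps / 2)) |].
  - intros x hx; eapply Rle_trans; [now apply cesaro_period_le |].
    assert (h3 := norm_ge_0 x).
    assert (h4 : 0 <= 2 * INR k / INR n).
    { apply Rmult_le_pos; [assert (h5 := pos_INR k); lra |].
      left; apply Rinv_0_lt_compat, lt_0_INR; lia. }
    nra.
  - simpl; assert (h := cond_pos eps); lra.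
Qed.

Lemma cesaro_periodic_lim (f : Hinf v) : exists g : Hinf v,
  (forall z, disc z -> hfun g z =
     (RtoC (/ INR k) *
        sum_n_m (G := C_AbelianMonoid) (fun m => hfun f (lambda ^ m * z)) 0 (k - 1))%C) /\
  filterlim (fun n => cesaro T n f) eventually (locally g).
Proof.
  exists (cesaro T k f); split.
  - intros z _; rewrite hfun_cesaro; f_equal.
    destruct k as [| k']; [lia |]; rewrite Nat.sub_succ, Nat.sub_0_r.
    (* [cesaro] sums over 1, ..., k and the stated limit over 0, ..., k - 1. The sum over 0, ..., k
       is split at either end and the common term f z is cancelled, using lambda^k = 1. *)
    assert (e := sum_Sn_m (G := C_AbelianMonoid) (s f z) 0 (S k') ltac:(lia)).
    rewrite sum_n_Sm in e by lia; unfold s in e.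
    rewrite hroot in e.
    change (lambda ^ 0)%C with (RtoC 1) in e.
    rewrite (@plus_comm C_AbelianGroup) in e.
    now apply (@plus_reg_l C_AbelianGroup) in e.
  - apply filterlim_norm_iff; intros eps.
    assert (hf := norm_ge_0 f); assert (he := cond_pos eps).
    destruct (two_k_over_n_small (eps / (norm f + 1))) as [N hN].
    { apply Rdiv_lt_0_compat; lra. }
    exists N; intros n hn; destruct (hN n hn) as [h1 h2].
    eapply Rle_lt_trans; [now apply cesaro_period_le |].
    assert (h3 := Rmult_lt_compat_r (norm f + 1) _ _ ltac:(lra) h2).
    replace (eps / (norm f + 1) * (norm f + 1)) with (pos eps) in h3 by (field; lra).
    assert (h4 : 0 <= 2 * INR k / INR n).
    { apply Rmult_le_pos; [assert (h5 := pos_INR k); lra |].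
      left; apply Rinv_0_lt_compat, lt_0_INR; lia. }
    lra.
Qed.

End RootOfUnity.

(** * Rotations of infinite order *)

Section NotRootOfUnity.

Context (hroot : forall k : nat, (1 <= k)%nat -> (lambda ^ k)%C <> RtoC 1).

(** On |z| <= r' the function f is bounded by norm f / v(r'), because v decreases with the modulus;
    this is the bound that [rotation_averages] requires. *)
Lemma cesaro_compact_convergence (f : Hinf v) r eps : r < 1 -> 0 < eps ->
  exists N, forall n, (N <= n)%nat -> forall z, Cmod z <= r ->
  Cmod (hfun (cesaro T n f) z - hfun f (RtoC 0)) <= eps.
Proof.
  intros hr he.
  (* The radii supplied by [vanishes_at_boundary] may be negative. *)
  set (r' := Rmax r 0).
  assert (hr' : 0 <= r' < 1) by (split; [apply Rmax_r | now apply Rmax_lub_lt; [| lra]]).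
  destruct (rotation_averages lambda hl hroot r' (norm f / v (RtoC r')) (proj2 hr') f)
    with (eps := eps) as [N hN]; auto.
  - apply hfun_holo.
  - intros z hz; assert (hzd : disc z) by (unfold disc; lra).
    assert (h1 := weight_le_of_Cmod_le r' z hr' hz).
    assert (h2 : 0 < v (RtoC r'))
      by (apply weight_pos; unfold disc; rewrite Cmod_R, Rabs_pos_eq; lra).
    assert (h3 := vnorm_ub v f z hzd).
    apply Rmult_le_reg_l with (v (RtoC r')); [exact h2 |].
    replace (v (RtoC r') * (norm f / v (RtoC r'))) with (norm f) by (field; lra).
    eapply Rle_trans; [| exact h3].
    apply Rmult_le_compat_r; [apply Cmod_ge_0 | exact h1].
  - exists (S N); intros n hn z hz.
    assert (hnp : 0 < INR n) by (apply lt_0_INR; lia).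
    specialize (hN n ltac:(lia) z (Rle_trans _ _ _ hz (Rmax_l r 0))).
    rewrite hfun_cesaro; set (c := hfun f (RtoC 0)) in *.
    assert (e : (RtoC (/ INR n) *
       sum_n_m (G := C_AbelianMonoid) (fun m => hfun f (lambda ^ m * z)) 1 n - c =
       RtoC (/ INR n) *
       sum_n_m (G := C_AbelianMonoid) (fun m => hfun f (lambda ^ m * z) - c) 1 n)%C).
    { assert (e : (sum_n_m (G := C_AbelianMonoid) (fun m => hfun f (lambda ^ m * z) - c) 1 n =
        sum_n_m (G := C_AbelianMonoid) (fun m => hfun f (lambda ^ m * z)) 1 n - INR n * c)%C).
      { clear; induction n as [| n IH].
        - rewrite !sum_from_1_0; change zero with (RtoC 0); simpl; ring.
        - rewrite !sum_from_1_S, S_INR, RtoC_plus.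
          rewrite IH; change plus with Cplus.
          match goal with |- @eq _ ?a ?b => change (@eq C a b) end; ring. }
      rewrite e, RtoC_inv by lra; field; apply RtoC_neq_0; lra. }
    rewrite e, Cmod_mult, Cmod_R, Rabs_pos_eq by (left; now apply Rinv_0_lt_compat).
    apply Rmult_le_reg_l with (INR n); [exact hnp |].
    rewrite <- Rmult_assoc, Rinv_r, Rmult_1_l by lra; exact hN.
Qed.

Lemma weighted_cesaro_le (f : Hinf v) n z e : disc z -> (1 <= n)%nat ->
  (forall m, v z * Cmod (hfun f (lambda ^ m * z)%C) <= e) ->
  v z * Cmod (hfun (cesaro T n f) z) <= e.
Proof.
  intros hz hn h; assert (hvz := weight_pos v z hz).
  assert (hnp : 0 < INR n) by (apply lt_0_INR; lia).
  rewrite hfun_cesaro, Cmod_mult, Cmod_R, Rabs_pos_eq by (left; now apply Rinv_0_lt_compat).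
  apply Rle_trans with (v z * (/ INR n * (INR n * (e / v z)))).
  - apply Rmult_le_compat_l; [lra |]; apply Rmult_le_compat_l.
    + left; now apply Rinv_0_lt_compat.
    + apply (norm_sum_from_1_le (V := C_NormedModule)); intros m _.
      apply Rmult_le_reg_l with (v z); [exact hvz |].
      replace (v z * (e / v z)) with e by (field; lra); apply h.
  - right; field; lra.
Qed.

Lemma comp_rotation0_sot : sot_lim (cesaro T0) (eval_zero0 v hv).
Proof.
  intros x; apply filterlim_norm_iff; intros eps.
  assert (he := cond_pos eps).
  set (f := sub_val x : Hinf v); assert (hf := sub_valP x : H0_subspace v f).
  destruct (weight_bounded v) as [M hM].
  assert (hM0 : 0 < M).
  { eapply Rlt_le_trans; [apply (weight_pos v _ disc0) | apply hM, disc0]. }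
  assert (he4 : 0 < eps / 4) by lra.
  destruct (hf (mkposreal _ he4)) as [r1 [hr1 h1]].
  destruct (eval_zero_H0 v hv f hf (mkposreal _ he4)) as [r2 [hr2 h2]]; simpl pos in *.
  set (r := Rmax r1 r2); assert (hr : r < 1) by now apply Rmax_lub_lt.
  assert (he2 : 0 < eps / 2 / M) by (apply Rdiv_lt_0_compat; lra).
  destruct (cesaro_compact_convergence f r _ hr he2) as [N hN].
  (* [S N] ensures n >= 1. The target is eps / 2 because a supremum of pointwise bounds is
     controlled only by a non-strict inequality. *)
  exists (S N); intros n hn; apply Rle_lt_trans with (eps / 2); [| lra].
  apply vnorm_le; intros z hz.
  change (v z * Cmod (hfun (minus (sub_val (cesaro T0 n x : H0 v)) (eval_zero v f)) z)
          <= eps / 2).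
  rewrite hfun_minus, sub_val_cesaro; fold f.
  assert (hvz := weight_pos v z hz).
  destruct (Rle_dec (Cmod z) r) as [hzr | hzr].
  - change (eval_zero v f) with (Hinf_const v (hfun f (RtoC 0))); rewrite Hinf_constE by exact hz.
    specialize (hN n ltac:(lia) z hzr).
    apply Rle_trans with (M * (eps / 2 / M)); [| right; field; lra].
    apply Rmult_le_compat; [lra | apply Cmod_ge_0 | now apply hM | exact hN].
  - assert (hz1 : r1 < Cmod z) by (assert (k := Rmax_l r1 r2); fold r in k; lra).
    assert (hz2 : r2 < Cmod z) by (assert (k := Rmax_r r1 r2); fold r in k; lra).
    assert (k1 : v z * Cmod (hfun (cesaro T n f) z) <= eps / 4).
    { apply weighted_cesaro_le; [exact hz | lia |]; intros m.
      rewrite <- (weight_pow_lambda m) by exact hz; left.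
      eapply Rle_lt_trans; [apply Rle_abs | apply h1].
      rewrite Cmod_pow_lambda; split; assumption. }
    assert (k2 := h2 z (conj hz2 hz)).
    apply (Rle_lt_trans _ _ _ (Rle_abs _)) in k2.
    unfold Cminus; assert (k3 := Cmod_triangle (hfun (cesaro T n f) z) (- hfun (eval_zero v f) z)).
    rewrite Cmod_opp in k3; apply (Rmult_le_compat_l (v z)) in k3; [| lra].
    lra.
Qed.

(** Norm convergence forces pointwise convergence, so the limit must be the constant c = f 0. Fix
    one n for which the n-th mean is within eps / 4 of c. Then v |f| <= eps / 4 + v (n d + |c|), and
    the last term tends to 0 at the boundary because v does. *)
Lemma not_mean_ergodic_of_almost_invariant (f : Hinf v) (d : R) :
  (forall z, disc z -> Cmod (hfun f (lambda * z)%C - hfun f z) <= d) ->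
  ~ H0_subspace v f -> ~ mean_ergodic T.
Proof.
  intros hd hf [P hP]; apply hf; intros eps; assert (he := cond_pos eps).
  specialize (hP f).
  set (c := hfun f (RtoC 0)).
  assert (hlim : forall z, disc z -> hfun (P f) z = c).
  { intros z hz; assert (hvz := weight_pos v z hz).
    destruct (Req_dec (Cmod (hfun (P f) z - c)) 0) as [h | h].
    { apply Cmod_eq_0 in h.
      replace (hfun (P f) z) with ((hfun (P f) z - c) + c)%C by ring; rewrite h; ring. }
    exfalso; assert (hA := Cmod_ge_0 (hfun (P f) z - c)).
    set (A := Cmod (hfun (P f) z - c)) in *; assert (hA' : 0 < A) by lra.
    (* The mean at z is within A / 3 of both c and the limit, which are at distance A. *)
    destruct (cesaro_compact_convergence f (Cmod z) (A / 3) hz ltac:(lra)) as [N1 h1].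
    assert (he' : 0 < v z * (A / 3)) by (apply Rmult_lt_0_compat; lra).
    destruct (proj1 (filterlim_norm_iff _ _) hP (mkposreal _ he')) as [N2 h2].
    specialize (h1 (Nat.max N1 N2) ltac:(lia) z (Rle_refl _)).
    specialize (h2 (Nat.max N1 N2) ltac:(lia)); simpl pos in h2.
    set (u := cesaro T (Nat.max N1 N2) f) in *.
    assert (h3 := vnorm_ub v (minus u (P f)) z hz).
    rewrite hfun_minus in h3.
    assert (h4 : Cmod (hfun u z - hfun (P f) z) < A / 3).
    { apply Rmult_lt_reg_l with (v z); [exact hvz |].
      eapply Rle_lt_trans; [exact h3 | exact h2]. }
    assert (h5 := Cmod_triangle (- (hfun u z - hfun (P f) z)) (hfun u z - c)).
    rewrite Cmod_opp in h5.
    replace (- (hfun u z - hfun (P f) z) + (hfun u z - c))%C with (hfun (P f) z - c)%C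
      in h5 by ring.
    fold A in h5; fold c in h1; lra. }
  assert (he4 : 0 < eps / 4) by lra.
  destruct (proj1 (filterlim_norm_iff _ _) hP (mkposreal _ he4)) as [N hN].
  specialize (hN (S N) ltac:(lia)); simpl pos in hN; set (n := S N) in *.
  assert (hnp : 0 < INR n) by (apply lt_0_INR; unfold n; lia).
  assert (hd0 : 0 <= d) by (eapply Rle_trans; [apply Cmod_ge_0 | apply (hd _ disc0)]).
  assert (hc0 := Cmod_ge_0 c).
  (* Telescoping along the orbit: each application of the rotation costs at most d. *)
  assert (hdm : forall m z, disc z -> Cmod (hfun f (lambda ^ m * z)%C - hfun f z) <= INR m * d).
  { induction m as [| m IH]; intros z hz.
    - simpl; rewrite Cmult_1_l, Rmult_0_l; right.
      replace (_ - _)%C with (RtoC 0) by ring; apply Cmod_0.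
    - assert (k := Cmod_triangle (hfun f (lambda * (lambda ^ m * z))%C - hfun f (lambda ^ m * z)%C)
                     (hfun f (lambda ^ m * z)%C - hfun f z)).
      replace (lambda ^ S m * z)%C with (lambda * (lambda ^ m * z))%C by (rewrite Cpow_S; ring).
      match type of k with Cmod ?a <= _ =>
        replace a with (hfun f (lambda * (lambda ^ m * z))%C - hfun f z)%C in k by ring end.
      assert (k1 := hd _ (disc_pow_lambda m z hz)); specialize (IH z hz).
      rewrite S_INR; lra. }
  assert (hce : forall z, disc z -> Cmod (hfun (cesaro T n f) z - hfun f z) <= INR n * d).
  { intros z hz; rewrite hfun_cesaro.
    replace (hfun f z) with (RtoC (/ INR n) * (INR n * hfun f z))%C.
    2: { rewrite RtoC_inv by lra; field; apply RtoC_neq_0; lra. }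
    assert (e : forall j, (sum_n_m (G := C_AbelianMonoid) (fun m => hfun f (lambda ^ m * z)) 1 j
                  - INR j * hfun f z)%C =
                sum_n_m (G := C_AbelianMonoid) (fun m => hfun f (lambda ^ m * z) - hfun f z)%C 1 j).
    { clear; induction j as [| j IH].
      - rewrite !sum_from_1_0; change zero with (RtoC 0); simpl; ring.
      - rewrite !sum_from_1_S, <- IH, S_INR, RtoC_plus; change plus with Cplus; ring. }
    replace (_ - _)%C with (RtoC (/ INR n) *
      (sum_n_m (G := C_AbelianMonoid) (fun m => hfun f (lambda ^ m * z)) 1 n
       - INR n * hfun f z))%C by ring.
    rewrite e, Cmod_mult, Cmod_R, Rabs_pos_eq by (left; now apply Rinv_0_lt_compat).
    apply Rmult_le_reg_l with (INR n); [exact hnp |].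
    rewrite <- Rmult_assoc, Rinv_r, Rmult_1_l by lra.
    apply (norm_sum_from_1_le (V := C_NormedModule)); intros m hm.
    eapply Rle_trans; [apply (hdm m z hz) |].
    apply Rmult_le_compat_r; [exact hd0 | apply le_INR; lia]. }
  set (K := INR n * d + Cmod c + 1).
  assert (hK : 0 < K) by (unfold K; assert (0 <= INR n * d) by (apply Rmult_le_pos; lra); lra).
  destruct (typical_lim v hv (mkposreal _ (Rdiv_lt_0_compat _ _ he4 hK))) as [r [hr h]].
  exists r; split; [exact hr |]; intros z hz; specialize (h z hz); simpl pos in h.
  destruct hz as [_ hz]; assert (hvz := weight_pos v z hz).
  rewrite Rabs_pos_eq in h by lra.
  rewrite Rabs_pos_eq by now apply (vmod_ge0 v).
  assert (h1 := vnorm_ub v (minus (cesaro T n f) (P f)) z hz).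
  rewrite hfun_minus, hlim in h1 by exact hz.
  change (norm (minus (cesaro T n f) (P f))) with (vnorm v (minus (cesaro T n f) (P f))) in hN.
  assert (h2 := hce z hz).
  assert (h3 : Cmod (hfun f z) <= Cmod (hfun (cesaro T n f) z - c) + K).
  { assert (k1 := Cmod_triangle (- (hfun (cesaro T n f) z - hfun f z))
                    ((hfun (cesaro T n f) z - c) + c)).
    assert (k2 := Cmod_triangle (hfun (cesaro T n f) z - c) c).
    rewrite Cmod_opp in k1.
    match type of k1 with Cmod ?a <= _ => replace a with (hfun f z) in k1 by ring end.
    unfold K; lra. }
  apply (Rmult_le_compat_l (v z)) in h3; [| lra].
  apply (Rmult_lt_compat_r K) in h; [| exact hK].
  replace (eps / 4 / K * K) with (eps / 4) in h by (field; lra).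
  lra.
Qed.

End NotRootOfUnity.

End Evaluation.

(** * Lacunary power series *)

(** Induction on n through E_(n+1) = (z + h) E_n + n z^(n-1) h^2. The factor rho^2 on the left
    stands for a bound by rho^(n-2), and so covers n < 2 and rho = 0; the constant n^2 is
    generous. *)
Lemma pow_remainder (z h : C) (rho : R) n :
  0 <= rho -> Cmod z <= rho -> Cmod (z + h) <= rho ->
  rho ^ 2 * Cmod ((z + h) ^ n - z ^ n - INR n * z ^ pred n * h) <=
    INR n ^ 2 * rho ^ n * Cmod h ^ 2.
Proof.
  intros h0 hz hzh.
  assert (hpow : forall m, rho * Cmod (INR m * z ^ pred m) <= INR m * rho ^ m).
  { intros [| m].
    - simpl; rewrite Cmult_0_l, Cmod_0; lra.
    - rewrite Cmod_mult, Cmod_R, Rabs_pos_eq, Cmod_pow by apply pos_INR; simpl pred.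
      replace (INR (S m) * rho ^ S m) with (rho * (INR (S m) * rho ^ m)) by (simpl; ring).
      apply Rmult_le_compat_l; [exact h0 |]; apply Rmult_le_compat_l; [apply pos_INR |].
      apply pow_incr; split; [apply Cmod_ge_0 | exact hz]. }
  induction n as [| n IH].
  - replace (_ - _)%C with (RtoC 0) by (simpl; ring); rewrite Cmod_0; simpl; lra.
  - set (E := ((z + h) ^ n - z ^ n - INR n * z ^ pred n * h)%C) in IH.
    assert (e : ((z + h) ^ S n - z ^ S n - INR (S n) * z ^ pred (S n) * h =
                 (z + h) * E + INR n * z ^ pred n * (h * h))%C).
    { unfold E; rewrite S_INR, RtoC_plus; simpl pred; rewrite !Cpow_S.
      assert (k : (INR n * z ^ n = INR n * z ^ pred n * z)%C)
        by (destruct n; [simpl; ring | simpl pred; rewrite Cpow_S; ring]).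
      replace ((INR n + 1) * z ^ n * h)%C with ((INR n * z ^ n) * h + z ^ n * h)%C by ring.
      rewrite k; ring. }
    rewrite e; specialize (hpow n).
    assert (k1 := Cmod_triangle ((z + h) * E) (INR n * z ^ pred n * (h * h))).
    rewrite Cmod_mult, (Cmod_mult (_ * _)), (Cmod_mult h h) in k1.
    set (X := Cmod (INR n * z ^ pred n)) in *; set (H := Cmod h) in *.
    assert (hH : 0 <= H) by apply Cmod_ge_0.
    assert (hE := Cmod_ge_0 E).
    assert (hn := pos_INR n).
    assert (hrn : 0 <= rho ^ n) by now apply pow_le.
    apply Rle_trans with (rho ^ 2 * (rho * Cmod E + X * (H * H))).
    + apply Rmult_le_compat_l; [apply pow2_ge_0 |]; eapply Rle_trans; [exact k1 |].
      apply Rplus_le_compat_r, Rmult_le_compat_r; [exact hE | exact hzh].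
    + rewrite S_INR.
      replace (rho ^ 2 * (rho * Cmod E + X * (H * H))) with
        (rho * (rho ^ 2 * Cmod E) + rho * (rho * X) * (H * H)) by ring.
      apply (Rmult_le_compat_l rho) in IH; [| exact h0].
      apply (Rmult_le_compat_l rho) in hpow; [| exact h0].
      apply (Rmult_le_compat_r (H * H)) in hpow; [| nra].
      simpl pow in *.
      assert (0 <= (INR n + 1) * (rho * rho ^ n * (H * H)))
        by (apply Rmult_le_pos; [lra |]; apply Rmult_le_pos; nra).
      nra.
Qed.

Lemma is_derive_of_quadratic (f : C -> C) (z l : C) (K d : R) : 0 < d ->
  (forall w, Cmod (w - z) < d -> Cmod (f w - f z - (w - z) * l) <= K * Cmod (w - z) ^ 2) ->
  is_derive (V := C_NormedModule) f z l.
Proof.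
  intros hd h; rewrite is_derive_C_iff; intros eps; assert (he := cond_pos eps).
  assert (hK : 0 <= Rabs K) by apply Rabs_pos.
  assert (hm : 0 < Rmin d (eps / (Rabs K + 1)))
    by (apply Rmin_pos; [exact hd | apply Rdiv_lt_0_compat; lra]).
  exists (mkposreal _ hm); simpl; intros w hw.
  assert (hw1 := Rlt_le_trans _ _ _ hw (Rmin_l _ _)).
  assert (hw2 := Rlt_le_trans _ _ _ hw (Rmin_r _ _)).
  eapply Rle_trans; [now apply h |].
  assert (h0 := Cmod_ge_0 (w - z)); assert (hK' := Rle_abs K).
  apply (Rmult_lt_compat_l (Rabs K + 1)) in hw2; [| lra].
  replace ((Rabs K + 1) * (eps / (Rabs K + 1))) with (pos eps) in hw2 by (field; lra).
  simpl; rewrite Rmult_1_r, <- Rmult_assoc; apply Rmult_le_compat_r; [exact h0 | nra].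
Qed.

Lemma ex_derive_pow (j : nat) (z : C) :
  ex_derive (V := C_NormedModule) (fun w : C => (w ^ j)%C) z.
Proof.
  exists (INR j * z ^ pred j)%C.
  apply (is_derive_of_quadratic _ _ _
           (INR j ^ 2 * (Cmod z + 1) ^ j / (Cmod z + 1) ^ 2) 1 Rlt_0_1).
  intros w hw; assert (hz := Cmod_ge_0 z).
  assert (k := pow_remainder z (w - z) (Cmod z + 1) j ltac:(lra) ltac:(lra)).
  replace (z + (w - z))%C with w in k by ring.
  assert (hwz := Cmod_triangle (w - z) z); replace (w - z + z)%C with w in hwz by ring.
  specialize (k ltac:(lra)).
  replace ((w - z) * (INR j * z ^ pred j))%C with (INR j * z ^ pred j * (w - z))%C by ring.
  apply Rmult_le_reg_l with ((Cmod z + 1) ^ 2); [apply pow_lt; lra |].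
  eapply Rle_trans; [exact k | right; field; lra].
Qed.

(** Bernoulli's inequality n h <= (1 + h)^n, squared, absorbs n^2 into a geometric factor; h = (1 -
    rho) / 4 is small enough for (1 + h)^2 rho < 1. *)
Lemma square_times_pow_le (rho : R) : 0 <= rho < 1 ->
  exists K x, 0 <= x < 1 /\ forall n, INR n ^ 2 * rho ^ n <= K * x ^ n.
Proof.
  intros hr; set (h := (1 - rho) / 4); assert (hh : 0 < h) by (unfold h; lra).
  exists (/ h ^ 2), ((1 + h) ^ 2 * rho).
  split; [split; [apply Rmult_le_pos; [apply pow2_ge_0 | lra] |] |].
  - replace rho with (1 - 4 * h) by (unfold h; field).
    assert (h <= 1 / 4) by (unfold h; lra); simpl; nra.
  - intros n; rewrite Rpow_mult_distr, <- Rmult_assoc.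
    apply Rmult_le_compat_r; [apply pow_le; lra |].
    apply Rmult_le_reg_l with (h ^ 2); [apply pow_lt; lra |].
    rewrite <- Rmult_assoc, Rinv_r, Rmult_1_l by (apply Rgt_not_eq, pow_lt; lra).
    rewrite <- pow_mult, Nat.mul_comm, pow_mult, <- Rpow_mult_distr.
    apply pow_incr; assert (hn := pos_INR n); split; [nra |].
    assert (k : forall m, 1 + INR m * h <= (1 + h) ^ m).
    { induction m as [| m IH]; [simpl; lra |].
      rewrite S_INR; simpl; assert (hm := pos_INR m); nra. }
    specialize (k n); lra.
Qed.

(** * Absolutely convergent complex series *)

Lemma ex_series_Rmult_l (c : R) (u : nat -> R) :
  ex_series u -> ex_series (fun k => c * u k).
Proof. apply (ex_series_scal_l (K := R_AbsRing) (V := R_NormedModule)). Qed.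

(** Summed by components so that the comparison theory of real [Series] applies. The price is the
    harmless factor 2 in [Cmod_Cseries_le]. *)
Definition Cseries (u : nat -> C) : C :=
  (Series (fun k => Re (u k)), Series (fun k => Im (u k))).

Section CSeries.

Context (u : nat -> C) (hu : ex_series (fun k => Cmod (u k))).

Lemma im_le_Cmod (z : C) : Rabs (Im z) <= Cmod z.
Proof. eapply Rle_trans; [apply Rmax_r | apply Rmax_Cmod]. Qed.

Lemma ex_series_Rabs_Re : ex_series (fun k => Rabs (Re (u k))).
Proof.
  apply (ex_series_le (V := R_CompleteNormedModule)) with (2 := hu).
  intros k; change (Rabs (Rabs (Re (u k))) <= Cmod (u k)); rewrite Rabs_Rabsolu.
  apply re_le_Cmod.
Qed.

Lemma ex_series_Rabs_Im : ex_series (fun k => Rabs (Im (u k))).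
Proof.
  apply (ex_series_le (V := R_CompleteNormedModule)) with (2 := hu).
  intros k; change (Rabs (Rabs (Im (u k))) <= Cmod (u k)); rewrite Rabs_Rabsolu.
  apply im_le_Cmod.
Qed.

Lemma ex_series_Re : ex_series (fun k => Re (u k)).
Proof. apply ex_series_Rabs, ex_series_Rabs_Re. Qed.

Lemma ex_series_Im : ex_series (fun k => Im (u k)).
Proof. apply ex_series_Rabs, ex_series_Rabs_Im. Qed.

Lemma Cmod_Cseries_le : Cmod (Cseries u) <= 2 * Series (fun k => Cmod (u k)).
Proof.
  assert (h1 : Rabs (Series (fun k => Re (u k))) <= Series (fun k => Cmod (u k))).
  { eapply Rle_trans; [apply Series_Rabs, ex_series_Rabs_Re |].
    apply Series_le; [| exact hu]; intros k; split; [apply Rabs_pos | apply re_le_Cmod]. }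
  assert (h2 : Rabs (Series (fun k => Im (u k))) <= Series (fun k => Cmod (u k))).
  { eapply Rle_trans; [apply Series_Rabs, ex_series_Rabs_Im |].
    apply Series_le; [| exact hu]; intros k; split; [apply Rabs_pos | apply im_le_Cmod]. }
  replace (Cseries u) with
    (Series (fun k => Re (u k)) + Ci * Series (fun k => Im (u k)))%C
    by (apply injective_projections; simpl; ring).
  eapply Rle_trans; [apply Cmod_triangle |].
  rewrite Cmod_mult, Cmod_Ci, !Cmod_R; lra.
Qed.

End CSeries.

Lemma Cseries_minus (u w : nat -> C) :
  ex_series (fun k => Cmod (u k)) -> ex_series (fun k => Cmod (w k)) ->
  Cseries (fun k => u k - w k)%C = (Cseries u - Cseries w)%C.
Proof.
  intros hu hw; apply injective_projections; simpl.
  - etransitivity; [| apply Series_minus]; [reflexivity | |]; now apply ex_series_Re.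
  - etransitivity; [| apply Series_minus]; [reflexivity | |]; now apply ex_series_Im.
Qed.

Lemma Cseries_scal (c : C) (u : nat -> C) :
  ex_series (fun k => Cmod (u k)) -> Cseries (fun k => c * u k)%C = (c * Cseries u)%C.
Proof.
  intros hu; assert (hR := ex_series_Re u hu); assert (hI := ex_series_Im u hu).
  apply injective_projections; simpl.
  - rewrite <- !Series_scal_l, <- Series_minus; [reflexivity | |];
      now apply ex_series_Rmult_l.
  - rewrite <- !Series_scal_l, <- Series_plus; [reflexivity | |];
      now apply ex_series_Rmult_l.
Qed.

Section LacunarySeries.

Context (N : nat -> nat) (hN : forall k, (k <= N k)%nat) (a : nat -> R) (A : R).
Context (ha : forall k, 0 <= a k <= A).

Lemma ex_series_lacunary (x : R) : 0 <= x < 1 -> ex_series (fun k => x ^ N k).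
Proof.
  intros hx; apply (ex_series_le (V := R_CompleteNormedModule)) with (fun k => x ^ k).
  - intros k; change (Rabs (x ^ N k) <= x ^ k).
    rewrite Rabs_pos_eq by (apply pow_le; lra).
    replace (N k) with (k + (N k - k))%nat by (generalize (hN k); lia).
    rewrite pow_add; apply Rle_trans with (x ^ k * 1); [| right; apply Rmult_1_r].
    apply Rmult_le_compat_l; [apply pow_le; lra |].
    rewrite <- (pow1 (N k - k)); apply pow_incr; lra.
  - apply ex_series_geom; rewrite Rabs_pos_eq; lra.
Qed.

Lemma ex_series_coef_lacunary (x : R) : 0 <= x < 1 -> ex_series (fun k => a k * x ^ N k).
Proof.
  intros hx; apply (ex_series_le (V := R_CompleteNormedModule)) with (fun k => A * x ^ N k).
  - intros k; change (Rabs (a k * x ^ N k) <= A * x ^ N k).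
    assert (h0 : 0 <= x ^ N k) by (apply pow_le; lra); assert (h1 := ha k).
    rewrite Rabs_pos_eq by (apply Rmult_le_pos; lra); apply Rmult_le_compat_r; lra.
  - apply ex_series_Rmult_l, ex_series_lacunary, hx.
Qed.

Definition lacunary_fun (z : C) : C := Cseries (fun k => a k * z ^ N k)%C.

Lemma Cmod_lacunary_term k z : Cmod (a k * z ^ N k) = a k * Cmod z ^ N k.
Proof. rewrite Cmod_mult, Cmod_R, Rabs_pos_eq, Cmod_pow; [reflexivity | apply ha]. Qed.

Lemma ex_series_Cmod_lacunary z : disc z -> ex_series (fun k => Cmod (a k * z ^ N k)).
Proof.
  intros hz; apply (ex_series_ext (fun k => a k * Cmod z ^ N k)).
  - intros k; symmetry; apply Cmod_lacunary_term.
  - apply ex_series_coef_lacunary; split; [apply Cmod_ge_0 | exact hz].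
Qed.

Lemma Cmod_lacunary_fun_le z : disc z ->
  Cmod (lacunary_fun z) <= 2 * Series (fun k => a k * Cmod z ^ N k).
Proof.
  intros hz; eapply Rle_trans; [apply Cmod_Cseries_le, ex_series_Cmod_lacunary, hz |].
  right; f_equal; apply Series_ext; intros k; apply Cmod_lacunary_term.
Qed.

(** Termwise differentiation: the remainders of the powers are quadratic in w - z, with constants
    summable on the disc of radius rho, so the whole remainder is quadratic too. *)
Lemma ex_derive_lacunary_fun z : disc z -> ex_derive (V := C_NormedModule) lacunary_fun z.
Proof.
  intros hz; assert (hz0 := Cmod_ge_0 z); unfold disc in hz.
  (* Halfway between |z| and 1, so that a neighbourhood of z stays within radius rho < 1. *)
  set (rho := (1 + Cmod z) / 2); assert (hrho : 0 < rho < 1) by (unfold rho; lra).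
  destruct (square_times_pow_le rho ltac:(lra)) as (K & x & hx & hK).
  assert (hA : 0 <= A) by (generalize (ha 0%nat); lra).
  (* A summable majorant of a_k N_k^2 rho^(N_k), which serves both the series of derivatives and
     that of the remainders. *)
  set (dom := fun k => A * K * x ^ N k).
  assert (hdom : ex_series dom)
    by (apply ex_series_Rmult_l, ex_series_lacunary, hx).
  assert (hle : forall k, a k * (INR (N k) ^ 2 * rho ^ N k) <= dom k).
  { intros k; unfold dom; rewrite Rmult_assoc; apply Rmult_le_compat; try apply ha.
    - apply Rmult_le_pos; [apply pow2_ge_0 | apply pow_le; lra].
    - apply hK. }
  set (D := fun k => (a k * (INR (N k) * z ^ pred (N k)))%C).
  assert (hD : ex_series (fun k => Cmod (D k))).
  { apply (ex_series_le (V := R_CompleteNormedModule)) with (fun k => / rho * dom k).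
    - intros k; change (Rabs (Cmod (D k)) <= / rho * dom k).
      rewrite Rabs_pos_eq by apply Cmod_ge_0; unfold D.
      rewrite Cmod_mult, Cmod_R, Rabs_pos_eq by apply ha.
      apply Rle_trans with (/ rho * (a k * (INR (N k) ^ 2 * rho ^ N k)));
        [| apply Rmult_le_compat_l; [left; apply Rinv_0_lt_compat; lra | apply hle]].
      rewrite (Rmult_comm (/ rho)), Rmult_assoc; apply Rmult_le_compat_l; [apply ha |].
      rewrite Cmod_mult, Cmod_R, Rabs_pos_eq, Cmod_pow by apply pos_INR.
      destruct (N k) as [| m]; [simpl; lra |].
      simpl pred; replace (INR (S m) ^ 2 * rho ^ S m * / rho) with
        (INR (S m) * (INR (S m) * rho ^ m)) by (change (rho ^ S m) with (rho * rho ^ m); field; lra).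
      apply Rmult_le_compat_l; [apply pos_INR |].
      rewrite <- (Rmult_1_l (Cmod z ^ m)); apply Rmult_le_compat.
      + lra.
      + now apply pow_le.
      + rewrite S_INR; assert (k' := pos_INR m); lra.
      + apply pow_incr; unfold rho; lra.
    - now apply ex_series_Rmult_l. }
  exists (Cseries D).
  apply (is_derive_of_quadratic _ _ _ (2 * (Series dom / rho ^ 2)) (rho - Cmod z));
    [unfold rho; lra |].
  intros w hw; assert (hwz := Cmod_triangle (w - z) z).
  replace (w - z + z)%C with w in hwz by ring.
  assert (hwr : Cmod w <= rho) by lra.
  assert (hdw : disc w) by (unfold disc; lra).
  assert (eD : ((w - z) * Cseries D)%C = Cseries (fun k => (w - z) * D k)%C)
    by (symmetry; now apply Cseries_scal).
  assert (hD' : ex_series (fun k => Cmod ((w - z) * D k))).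
  { apply (ex_series_ext (fun k => Cmod (w - z) * Cmod (D k))).
    - intros k; symmetry; apply Cmod_mult.
    - now apply ex_series_Rmult_l. }
  assert (hfw := ex_series_Cmod_lacunary w hdw); assert (hfz := ex_series_Cmod_lacunary z hz).
  set (T := fun k => (a k * w ^ N k - a k * z ^ N k - (w - z) * D k)%C).
  assert (hT : forall k, Cmod (T k) <= Cmod (w - z) ^ 2 / rho ^ 2 * dom k).
  { intros k; unfold T, D.
    replace (_ - _)%C with
      (a k * ((z + (w - z)) ^ N k - z ^ N k - INR (N k) * z ^ pred (N k) * (w - z)))%C.
    2: { replace (z + (w - z))%C with w by ring; ring. }
    rewrite Cmod_mult, Cmod_R, Rabs_pos_eq by apply ha.
    assert (k1 := pow_remainder z (w - z) rho (N k) ltac:(lra) ltac:(unfold rho; lra)).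
    replace (z + (w - z))%C with w in * by ring; specialize (k1 hwr).
    apply Rle_trans with (Cmod (w - z) ^ 2 / rho ^ 2 * (a k * (INR (N k) ^ 2 * rho ^ N k))).
    - replace (Cmod (w - z) ^ 2 / rho ^ 2 * _) with
        (a k * (INR (N k) ^ 2 * rho ^ N k * Cmod (w - z) ^ 2 / rho ^ 2)) by (field; lra).
      apply Rmult_le_compat_l; [apply ha |].
      apply Rmult_le_reg_l with (rho ^ 2); [apply pow_lt; lra |].
      eapply Rle_trans; [exact k1 | right; field; lra].
    - apply Rmult_le_compat_l; [| apply hle].
      apply Rmult_le_pos; [apply pow2_ge_0 | left; apply Rinv_0_lt_compat, pow_lt; lra]. }
  assert (hb : ex_series (fun k => Cmod (w - z) ^ 2 / rho ^ 2 * dom k))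
    by now apply ex_series_Rmult_l.
  assert (hTs : ex_series (fun k => Cmod (T k))).
  { apply (ex_series_le (V := R_CompleteNormedModule)) with (2 := hb); intros k.
    change (Rabs (Cmod (T k)) <= Cmod (w - z) ^ 2 / rho ^ 2 * dom k).
    rewrite Rabs_pos_eq; [apply hT | apply Cmod_ge_0]. }
  assert (hfd : ex_series (fun k => Cmod (a k * w ^ N k - a k * z ^ N k))).
  { apply (ex_series_le (V := R_CompleteNormedModule)) with
      (fun k => Cmod (a k * w ^ N k) + Cmod (a k * z ^ N k)).
    - intros k; change (Rabs (Cmod (a k * w ^ N k - a k * z ^ N k)) <=
        Cmod (a k * w ^ N k) + Cmod (a k * z ^ N k)).
      rewrite Rabs_pos_eq by apply Cmod_ge_0.
      eapply Rle_trans; [apply Cmod_triangle | rewrite Cmod_opp; lra].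
    - now apply (ex_series_plus (V := R_NormedModule)). }
  assert (e : (lacunary_fun w - lacunary_fun z - (w - z) * Cseries D)%C = Cseries T).
  { unfold lacunary_fun; rewrite eD, <- Cseries_minus, <- Cseries_minus by assumption.
    reflexivity. }
  rewrite e; eapply Rle_trans; [now apply Cmod_Cseries_le |].
  rewrite Rmult_assoc; apply Rmult_le_compat_l; [lra |].
  replace (Series dom / rho ^ 2 * Cmod (w - z) ^ 2) with
    (Cmod (w - z) ^ 2 / rho ^ 2 * Series dom) by (field; lra).
  rewrite <- Series_scal_l; apply Series_le; [| exact hb].
  intros k; split; [apply Cmod_ge_0 | apply hT].
Qed.

End LacunarySeries.

(** * Monomials *)

(** Extension by zero, as [hfun_out] demands of the elements of [Hinf]. *)
Definition on_disc (f : C -> C) (z : C) : C :=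
  if excluded_middle_informative (disc z) then f z else RtoC 0.

Lemma on_discE f z : disc z -> on_disc f z = f z.
Proof. intros hz; unfold on_disc; now destruct (excluded_middle_informative (disc z)). Qed.

Lemma on_disc_out f z : ~ disc z -> on_disc f z = RtoC 0.
Proof. intros hz; unfold on_disc; now destruct (excluded_middle_informative (disc z)). Qed.

Lemma ex_derive_on_disc f z : disc z ->
  ex_derive (V := C_NormedModule) f z -> ex_derive (V := C_NormedModule) (on_disc f) z.
Proof.
  intros hz; apply (@ex_derive_ext_loc C_AbsRing C_NormedModule).
  assert (he : 0 < 1 - Cmod z) by (unfold disc in hz; lra).
  exists (mkposreal _ he); intros w hw.
  change (Cmod (w - z) < 1 - Cmod z) in hw.
  symmetry; apply on_discE; unfold disc.
  replace w with ((w - z) + z)%C by ring.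
  assert (h1 := Cmod_triangle (w - z) z); lra.
Qed.

Section Monomials.

Context (lambda : C) (hl : Cmod lambda = 1) (v : weight) (hv : typical v).

Lemma weighted_pow_le (j : nat) z : disc z -> v z * Cmod (z ^ j) <= v z.
Proof.
  intros hz; rewrite <- (Rmult_1_r (v z)) at 2.
  apply Rmult_le_compat_l; [left; now apply weight_pos |].
  rewrite Cmod_pow, <- (pow1 j); apply pow_incr; split; [apply Cmod_ge_0 | now left].
Qed.

Definition monomial (j : nat) : Hinf v.
Proof.
  refine (HinfElt (on_disc (fun z => z ^ j)%C) _ _ (on_disc_out _)).
  - intros z hz; apply ex_derive_on_disc; [exact hz | apply ex_derive_pow].
  - destruct (weight_bounded v) as [M hM]; exists M; intros z hz.
    rewrite on_discE by exact hz; eapply Rle_trans; [now apply weighted_pow_le | now apply hM].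
Defined.

Lemma monomialE j z : disc z -> hfun (monomial j) z = (z ^ j)%C.
Proof. exact (on_discE _ z). Qed.

Lemma monomial_H0 j : H0_subspace v (monomial j).
Proof.
  intros eps; destruct (typical_lim v hv eps) as [r [hr h]]; exists r; split; [exact hr |].
  intros z hz; rewrite monomialE by apply hz.
  eapply Rle_lt_trans; [| exact (h z hz)]; destruct hz as [_ hz].
  rewrite !Rabs_pos_eq.
  - now apply weighted_pow_le.
  - left; now apply weight_pos.
  - apply Rmult_le_pos; [left; now apply weight_pos | apply Cmod_ge_0].
Qed.

Definition monomial0 (j : nat) : H0 v := SubElt (monomial j) (monomial_H0 j).

Lemma norm_monomial_pos j : 0 < norm (monomial j).
Proof.
  assert (hd : disc (RtoC (1 / 2))) by (unfold disc; rewrite Cmod_R, Rabs_pos_eq; lra).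
  eapply Rlt_le_trans; [| exact (vnorm_ub v (monomial j) _ hd)].
  apply Rmult_lt_0_compat; [now apply weight_pos |].
  rewrite monomialE, Cmod_pow, Cmod_R, Rabs_pos_eq by (auto; lra).
  apply pow_lt; lra.
Qed.

Lemma Cmod_1_minus_pow_le (x : C) m : Cmod x = 1 -> Cmod (1 - x ^ m) <= INR m * Cmod (1 - x).
Proof.
  intros hx; induction m as [| m IH].
  - simpl; replace (1 - 1)%C with (RtoC 0) by ring; rewrite Cmod_0; lra.
  - rewrite S_INR, Cpow_S.
    replace (1 - x * x ^ m)%C with ((1 - x) + x * (1 - x ^ m))%C by ring.
    eapply Rle_trans; [apply Cmod_triangle |]; rewrite Cmod_mult, hx; lra.
Qed.

(** z^j is an eigenvector with eigenvalue x = lambda^j, and |1 - x^m| <= n |1 - x| for every m <=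
    n. *)
Lemma cesaro_monomial_almost_fixed n j : (1 <= n)%nat ->
  norm (minus (monomial j) (cesaro (comp_rotation lambda hl v hv) n (monomial j)))
    <= INR n * Cmod (1 - lambda ^ j) * norm (monomial j).
Proof.
  intros hn; apply vnorm_le; intros z hz.
  assert (hnp : 0 < INR n) by (apply lt_0_INR; lia).
  assert (e0 : forall m, hfun (monomial j) (lambda ^ m * z)%C =
                       ((lambda ^ j) ^ m * hfun (monomial j) z)%C).
  { intros m; rewrite !monomialE by (auto; now apply (disc_pow_lambda lambda hl)).
    rewrite Cpow_mult_l, <- !Cpow_mult_r; do 2 f_equal; lia. }
  rewrite hfun_minus, hfun_cesaro.
  set (y := hfun (monomial j) z) in *; set (x := (lambda ^ j)%C) in *.
  assert (e1 : forall k, sum_n_m (G := C_AbelianMonoid)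
      (fun m => hfun (monomial j) (lambda ^ m * z)%C) 1 k =
      (INR k * y - sum_n_m (G := C_AbelianMonoid) (fun m => (1 - x ^ m) * y)%C 1 k)%C).
  { induction k as [| k IH].
    - rewrite !sum_from_1_0; change zero with (RtoC 0); simpl; ring.
    - rewrite !sum_from_1_S, IH, e0, S_INR, RtoC_plus; change plus with Cplus.
      match goal with |- @eq _ ?a ?b => change (@eq C a b) end; ring. }
  rewrite e1; set (s := sum_n_m _ 1 n).
  replace (y - _)%C with (RtoC (/ INR n) * s)%C
    by (rewrite RtoC_inv by lra; field; apply RtoC_neq_0; lra).
  rewrite Cmod_mult, Cmod_R, Rabs_pos_eq by (left; now apply Rinv_0_lt_compat).
  assert (hvz := weight_pos v z hz).
  assert (hs : Cmod s <= INR n * (INR n * Cmod (1 - x) * Cmod y)).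
  { apply (norm_sum_from_1_le (V := C_NormedModule)); intros m hm.
    change (Cmod ((1 - x ^ m) * y) <= INR n * Cmod (1 - x) * Cmod y); rewrite Cmod_mult.
    apply Rmult_le_compat_r; [apply Cmod_ge_0 |].
    eapply Rle_trans; [apply Cmod_1_minus_pow_le; unfold x; now rewrite Cmod_pow, hl, pow1 |].
    apply Rmult_le_compat_r; [apply Cmod_ge_0 | apply le_INR; lia]. }
  apply Rle_trans with (v z * (/ INR n * (INR n * (INR n * Cmod (1 - x) * Cmod y)))).
  - apply Rmult_le_compat_l; [lra |]; apply Rmult_le_compat_l; [| exact hs].
    left; now apply Rinv_0_lt_compat.
  - replace (v z * _) with (INR n * Cmod (1 - x) * (v z * Cmod y)) by (field; lra).
    apply Rmult_le_compat_l; [apply Rmult_le_pos; [lra | apply Cmod_ge_0] |].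
    now apply vnorm_ub.
Qed.

(** A limit in operator norm is also a strong limit, hence is evaluation at 0, which vanishes on z^j
    for j >= 1. Fix n with the n-th mean within 1/4 of the limit, and only then choose j with n |1 -
    lambda^j| <= 1/4: the norm of z^j would be at most half of itself. *)
Lemma not_uniformly_mean_ergodic0 :
  (forall k : nat, (1 <= k)%nat -> (lambda ^ k)%C <> RtoC 1) ->
  (forall eps, 0 < eps -> exists j, (1 <= j)%nat /\ Cmod (1 - lambda ^ j) <= eps) ->
  ~ uniformly_mean_ergodic (comp_rotation0 lambda hl v hv).
Proof.
  intros hroot hsmall [P hP].
  set (T0 := comp_rotation0 lambda hl v hv) in *.
  assert (conv := opnorm_lim_sot _ _ (fun n => is_linear_cesaro T0 n (op_lin T0)) (op_lin P) hP).
  assert (hnorm : forall j, norm (monomial0 j) = norm (monomial j)) by reflexivity.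
  assert (hP0 : forall j, (1 <= j)%nat -> P (monomial0 j) = zero).
  { intros j hj; transitivity (eval_zero0 v hv (monomial0 j)).
    - apply (filterlim_locally_unique (F := eventually) (fun m => cesaro T0 m (monomial0 j)));
        [| apply comp_rotation0_sot, hroot].
      apply filterlim_norm_iff; intros eps; assert (he := cond_pos eps).
      assert (hL := norm_monomial_pos j); set (L := norm (monomial j)) in *.
      destruct (conv (monomial0 j) hL (eps / (2 * L))) as [M hM];
        [apply Rdiv_lt_0_compat; lra |].
      exists M; intros m hm; eapply Rle_lt_trans; [apply (hM m hm) |].
      rewrite hnorm; fold L.
      replace (eps / (2 * L) * L) with (eps / 2) by (field; lra); lra.
    - apply sub_elt_eq, Hinf_eq; intros z hz.
      change (hfun (Hinf_const v (hfun (monomial j) (RtoC 0))) z = RtoC 0).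
      rewrite Hinf_constE, monomialE by (auto; apply disc0).
      destruct j as [| j]; [lia | rewrite Cpow_S; ring]. }
  (* [P] kills [z^j], which [cesaro T0 n] almost fixes as soon as [lambda^j] is
     close to [1]. *)
  destruct (hP (mkposreal (1 / 4) ltac:(lra))) as [N hN].
  set (n := S N); specialize (hN n ltac:(unfold n; lia)); simpl pos in hN.
  assert (hnp : 0 < INR n) by (apply lt_0_INR; unfold n; lia).
  destruct (hsmall (/ (4 * INR n))) as [j [hj hx]]; [apply Rinv_0_lt_compat; lra |].
  assert (hL := norm_monomial_pos j).
  assert (k1 := opnorm_lt_homogeneous (fun y => minus (cesaro T0 n y) (P y)) (1 / 4) (monomial0 j)).
  cbv beta in k1; rewrite (hP0 j hj), hnorm in k1.
  assert (k2 := cesaro_monomial_almost_fixed n j ltac:(unfold n; lia)).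
  assert (k3 : INR n * Cmod (1 - lambda ^ j) <= 1 / 4).
  { apply (Rmult_le_compat_l (INR n)) in hx; [| lra].
    eapply Rle_trans; [exact hx | right; field; lra]. }
  specialize (k1 ltac:(intros k y;
    rewrite (linear_scal _ (is_linear_cesaro T0 n (op_lin T0))), (linear_scal _ (op_lin P));
    symmetry; apply (scal_minus_distr_l k (cesaro T0 n y) (P y))) hL hN).
  set (u := cesaro (comp_rotation lambda hl v hv) n (monomial j)) in *.
  assert (k4 : norm (minus (cesaro T0 n (monomial0 j)) zero) = norm u).
  { change (norm (sub_val (minus (cesaro T0 n (monomial0 j)) zero : H0 v)) = norm u).
    change (norm (minus (sub_val (cesaro T0 n (monomial0 j) : H0 v)) zero) = norm u).
    unfold T0; rewrite sub_val_cesaro; fold u; unfold minus; now rewrite opp_zero, plus_zero_r. }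
  assert (k1' : norm u <= 1 / 4 * norm (monomial j)) by (rewrite <- k4; exact k1).
  assert (k5 := norm_le_norm_minus_add (monomial j) u).
  assert (INR n * Cmod (1 - lambda ^ j) * norm (monomial j) <= 1 / 4 * norm (monomial j))
    by (apply Rmult_le_compat_r; lra).
  lra.
Qed.

End Monomials.

(** * The weight and the test function *)

Lemma sum_n_le_Series (a : nat -> R) K :
  (forall k, 0 <= a k) -> ex_series a -> sum_n a K <= Series a.
Proof.
  intros h0 hex; apply (is_lim_seq_incr_compare (sum_n a)).
  - exact (Series_correct a hex).
  - intros k; rewrite sum_Sn; unfold plus; simpl; generalize (h0 (S k)); lra.
Qed.

Lemma term_le_Series (a : nat -> R) k :
  (forall k, 0 <= a k) -> ex_series a -> a k <= Series a.
Proof.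
  intros h0 hex; eapply Rle_trans; [| apply (sum_n_le_Series a k h0 hex)].
  destruct k as [| k]; [rewrite sum_O; lra |].
  rewrite sum_Sn; unfold plus; simpl.
  assert (0 <= sum_n a k); [| lra].
  clear hex; induction k as [| k IH]; [rewrite sum_O; apply h0 |].
  rewrite sum_Sn; unfold plus; simpl; generalize (h0 (S k)); lra.
Qed.

Lemma Series_le_of_sum_n (a : nat -> R) M :
  ex_series a -> (forall K, sum_n a K <= M) -> Series a <= M.
Proof.
  intros hex h; apply (is_lim_seq_le (sum_n a) (fun _ => M) (Series a) M h);
    [exact (Series_correct a hex) | apply is_lim_seq_const].
Qed.

Lemma INR_le_pow2 j : INR j <= 2 ^ j.
Proof.
  induction j as [| j IH]; [simpl; lra |].
  rewrite S_INR; simpl; assert (1 <= 2 ^ j) by (apply pow_R1_Rle; lra); lra.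
Qed.

Lemma Rpower_pos x y : 0 < Rpower x y.
Proof. apply exp_pos. Qed.

Lemma Rpower_opp_anti x y p : 0 <= p -> 0 < x -> x <= y -> Rpower y (- p) <= Rpower x (- p).
Proof.
  intros hp hx hxy; rewrite !Rpower_Ropp; apply Rinv_le_contravar; [apply Rpower_pos |].
  now apply Rle_Rpower_l.
Qed.

(* Interchanging the two sums in the test function below costs only a constant
   because [W] grows geometrically: the terms [W_j <= S] are dominated by the
   last one and the terms [W_j > S] by the first one. *)
Section GeometricGrowth.

Context (theta : R) (htheta : 2 <= theta).
Context (W : nat -> R) (hW0 : 1 <= W 0%nat) (hW : forall j, theta * W j <= W (S j)).

Lemma growth_ge_1 j : 1 <= W j.
Proof. induction j as [| j IH]; [exact hW0 | assert (hWj := hW j); nra]. Qed.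

Lemma growth_ge_pow2 j : 2 ^ j <= W j.
Proof.
  induction j as [| j IH]; [exact hW0 |].
  assert (hWj := hW j); assert (k := growth_ge_1 j); simpl; nra.
Qed.

Lemma growth_pow_double p j : 0 <= p -> 2 <= Rpower theta p ->
  2 * Rpower (W j) p <= Rpower (W (S j)) p.
Proof.
  intros hp h; assert (k := growth_ge_1 j).
  apply Rle_trans with (Rpower (theta * W j) p).
  - rewrite <- Rpower_mult_distr by lra.
    apply Rmult_le_compat_r; [left; apply Rpower_pos | exact h].
  - apply Rle_Rpower_l; [exact hp | split; [nra | apply hW]].
Qed.

Context (alpha : R) (halpha : 0 < alpha < 1).
Context (h1 : 2 <= Rpower theta alpha) (h2 : 2 <= Rpower theta (1 - alpha)).

Local Notation b j := (Rpower (W j) (alpha - 1)).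

Lemma growth_coef_half j : 2 * b (S j) <= b j.
Proof.
  replace (alpha - 1) with (- (1 - alpha)) by ring; rewrite !Rpower_Ropp.
  assert (k := growth_pow_double (1 - alpha) j ltac:(lra) h2).
  assert (p0 := Rpower_pos (W j) (1 - alpha)).
  assert (p1 := Rpower_pos (W (S j)) (1 - alpha)).
  apply Rmult_le_reg_l with (Rpower (W j) (1 - alpha) * Rpower (W (S j)) (1 - alpha)); [nra |].
  replace (_ * (2 * _)) with (2 * Rpower (W j) (1 - alpha)) by (field; lra).
  replace (_ * / _) with (Rpower (W (S j)) (1 - alpha)) by (field; lra).
  exact k.
Qed.

Lemma growth_coef_le j : b j <= (1 / 2) ^ j.
Proof.
  induction j as [| j IH].
  - simpl; replace (alpha - 1) with (- (1 - alpha)) by ring.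
    assert (k := Rpower_opp_anti 1 (W 0%nat) (1 - alpha) ltac:(lra) ltac:(lra) hW0).
    eapply Rle_trans; [exact k |].
    unfold Rpower; rewrite ln_1, Rmult_0_r, exp_0; lra.
  - assert (k := growth_coef_half j); simpl; lra.
Qed.

Lemma ex_series_growth_coef : ex_series (fun j => b j).
Proof.
  apply (ex_series_le (V := R_CompleteNormedModule)) with (fun j => (1 / 2) ^ j).
  - intros j; change (Rabs (b j) <= (1 / 2) ^ j).
    rewrite Rabs_pos_eq by (left; apply Rpower_pos); apply growth_coef_le.
  - apply ex_series_geom; rewrite Rabs_pos_eq; lra.
Qed.

Lemma growth_coef_mul x : 0 < x -> Rpower x (alpha - 1) * x = Rpower x alpha.
Proof.
  intros hx; rewrite <- (Rpower_1 x) at 2 by exact hx.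
  rewrite <- Rpower_plus; f_equal; ring.
Qed.

Lemma growth_min_sum_le (s : R) J : 0 < s ->
  sum_n (fun j => b j * Rmin (W j) s) J <= 4 * Rpower s alpha.
Proof.
  intros hs; set (X := Rpower s alpha).
  assert (hX : 0 < X) by apply Rpower_pos.
  assert (hb : forall j, 0 < b j) by (intros j; apply Rpower_pos).
  assert (hsmall : forall j, W j <= s -> Rpower (W j) alpha <= X).
  { intros j hj; assert (k := growth_ge_1 j); apply Rle_Rpower_l; lra. }
  assert (hlarge : forall j, s <= W j -> s * b j <= X).
  { intros j hj; unfold X; rewrite <- growth_coef_mul, Rmult_comm by exact hs.
    apply Rmult_le_compat_r; [lra |].
    replace (alpha - 1) with (- (1 - alpha)) by ring; apply Rpower_opp_anti; lra. }
  (* While W_j <= s the terms W_j^alpha at least double, so the sum is at most twice the last one.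
     Beyond s the terms s b_j at least halve; subtracting s b_J from 4 X reserves room for the
     geometric tail, and the first such term fits because it is at most X. *)
  assert (key : (W J <= s -> sum_n (fun j => b j * Rmin (W j) s) J <= 2 * Rpower (W J) alpha) /\
                (s < W J -> sum_n (fun j => b j * Rmin (W j) s) J <= 4 * X - s * b J)).
  { induction J as [| J [IH1 IH2]].
    - rewrite sum_O; split; intros h.
      + assert (k := growth_ge_1 0).
        rewrite Rmin_left by exact h; rewrite growth_coef_mul by lra.
        assert (k1 := Rpower_pos (W 0%nat) alpha); lra.
      + rewrite Rmin_right by lra; assert (k := hlarge 0%nat ltac:(lra)); lra.
    - rewrite sum_Sn; unfold plus; simpl; assert (hWJ := hW J).
      assert (k := growth_ge_1 J); split; intros h.
      + rewrite Rmin_left by exact h; rewrite growth_coef_mul by nra.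
        assert (k1 := growth_pow_double alpha J ltac:(lra) h1).
        specialize (IH1 ltac:(nra)); lra.
      + rewrite Rmin_right by lra.
        assert (k1 := hlarge (S J) ltac:(lra)).
        destruct (Rle_lt_dec (W J) s) as [hJ | hJ].
        * specialize (IH1 hJ); assert (k2 := hsmall J hJ); lra.
        * specialize (IH2 hJ); assert (k2 := growth_coef_half J).
          apply (Rmult_le_compat_l s) in k2; lra. }
  destruct (Rle_lt_dec (W J) s) as [hJ | hJ].
  - assert (k := proj1 key hJ); assert (k1 := hsmall J hJ); lra.
  - assert (k := proj2 key hJ); assert (k1 := hb J); nra.
Qed.

End GeometricGrowth.

(** * The lacunary sum w and the weight built from it *)

Section LacunaryWeight.

Context (n : nat -> nat) (hn : forall k, (S k <= n (S k))%nat).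

(** Shifts the exponents, given from index 1 on, to the range of [Series], which starts at 0. *)
Let N (k : nat) : nat := n (S k).
Let hN k : (k <= N k)%nat.
Proof. unfold N; generalize (hn k); lia. Qed.

Local Notation w := (lacunary_sum n).

Lemma ex_series_lacunary_sum x : 0 <= x < 1 -> ex_series (fun k => x ^ N k).
Proof. apply ex_series_lacunary, hN. Qed.

Lemma lacunary_sum_incr x y : 0 <= x -> x <= y -> y < 1 -> w x <= w y.
Proof.
  intros hx hxy hy; apply Series_le; [| apply ex_series_lacunary_sum; lra].
  intros k; split; [now apply pow_le | apply pow_incr; lra].
Qed.

Lemma lacunary_sum_pos x : 0 < x < 1 -> 0 < w x.
Proof.
  intros hx; apply Rlt_le_trans with (x ^ N 0); [apply pow_lt; lra |].
  apply (term_le_Series (fun k => x ^ N k)); [| apply ex_series_lacunary_sum; lra].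
  intros k; apply pow_le; lra.
Qed.

Lemma lacunary_sum_le x : 0 <= x < 1 -> w x <= / (1 - x).
Proof.
  intros hx; rewrite <- Series_geom by (rewrite Rabs_pos_eq; lra).
  apply Series_le; [| apply ex_series_geom; rewrite Rabs_pos_eq; lra].
  intros k; split; [apply pow_le; lra |]; fold (N k).
  replace (N k) with (k + (N k - k))%nat by (generalize (hN k); lia).
  rewrite pow_add; apply Rle_trans with (x ^ k * 1); [| right; apply Rmult_1_r].
  apply Rmult_le_compat_l; [apply pow_le; lra |].
  rewrite <- (pow1 (N k - k)); apply pow_incr; lra.
Qed.

(** Each term tends to 1 at the boundary, so any number of terms eventually exceed 1/2
    simultaneously. *)
Lemma lacunary_sum_unbounded M : exists r, 0 < r < 1 /\ forall x, r <= x < 1 -> M <= w x.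
Proof.
  assert (h : forall K, exists r, 0 < r < 1 /\ forall x, r <= x < 1 ->
    INR (S K) / 2 <= sum_n (fun k => x ^ N k) K).
  { assert (hr : forall k, exists r, 0 < r < 1 /\ forall x, r <= x < 1 -> 1 / 2 <= x ^ N k).
    { intros k; set (m := N k); assert (hm := pos_INR m).
      (* Makes m (1 - x) <= 1/2, so that Bernoulli's inequality gives x^m >= 1/2. *)
      exists (1 - / (2 * (INR m + 1))).
      assert (hi : 0 < / (2 * (INR m + 1)) <= 1 / 2).
      { split; [apply Rinv_0_lt_compat; lra |].
        replace (1 / 2) with (/ 2) by field; apply Rinv_le_contravar; lra. }
      split; [lra |]; intros x hx.
      assert (hb : forall j, 1 - INR j * (1 - x) <= x ^ j).
      { induction j as [| j IH]; [simpl; lra |].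
        rewrite S_INR; simpl; assert (hj := pos_INR j).
        apply (Rmult_le_compat_l x) in IH; [| lra].
        assert (0 <= INR j * ((1 - x) * (1 - x)))
          by (apply Rmult_le_pos; [exact hj | apply Rle_0_sqr]).
        lra. }
      eapply Rle_trans; [| apply hb].
      assert (INR m * (1 - x) <= INR m * / (2 * (INR m + 1)))
        by (apply Rmult_le_compat_l; lra).
      assert (INR m * / (2 * (INR m + 1)) <= 1 / 2); [| lra].
      apply Rmult_le_reg_r with (2 * (INR m + 1)); [lra |].
      rewrite Rmult_assoc, Rinv_l by lra; lra. }
    induction K as [| K [r1 [hr1 IH]]].
    - destruct (hr 0%nat) as [r [h0 h1]]; exists r; split; [exact h0 |]; intros x hx.
      rewrite sum_O; simpl INR; now apply h1.
    - destruct (hr (S K)) as [r2 [hr2 h2]]; exists (Rmax r1 r2); split.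
      { split; [eapply Rlt_le_trans; [apply hr1 | apply Rmax_l] | now apply Rmax_lub_lt]. }
      intros x hx; assert (k1 := Rmax_l r1 r2); assert (k2 := Rmax_r r1 r2).
      rewrite sum_Sn, S_INR; unfold plus; simpl.
      specialize (IH x ltac:(lra)); specialize (h2 x ltac:(lra)); simpl in *; lra. }
  destruct (INR_unbounded (2 * M)) as [K hK].
  destruct (h K) as [r [hr h1]]; exists r; split; [exact hr |]; intros x hx.
  eapply Rle_trans; [| apply (sum_n_le_Series (fun k => x ^ N k) K)].
  - specialize (h1 x hx); rewrite S_INR in h1; lra.
  - intros k; apply pow_le; lra.
  - apply ex_series_lacunary_sum; lra.
Qed.

(** On [0, 1) the sum w is the real part of the holomorphic lacunary series with all coefficients
    1. *)
Lemma lacunary_sum_continuous x (eps : posreal) : 0 <= x < 1 ->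
  exists delta : posreal, forall y, 0 <= y < 1 -> Rabs (y - x) < delta ->
  Rabs (w y - w x) < eps.
Proof.
  intros hx.
  assert (ha : forall k : nat, 0 <= 1 <= 1) by (intros; lra).
  assert (hd : disc (RtoC x)) by (unfold disc; rewrite Cmod_R, Rabs_pos_eq; lra).
  destruct (holo_continuous_eps _ (ex_derive_lacunary_fun N hN (fun _ => 1) 1 ha) _ hd eps)
    as [de hde].
  exists de; intros y hy hxy; specialize (hde (RtoC y)).
  rewrite <- RtoC_minus, Cmod_R in hde; specialize (hde hxy).
  assert (e : forall t, w t = Re (lacunary_fun N (fun _ => 1) (RtoC t))).
  { intros t; apply Series_ext; intros k; fold (N k).
    rewrite <- RtoC_pow, <- RtoC_mult; simpl; ring. }
  rewrite !e; eapply Rle_lt_trans; [| exact hde].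
  change (Rabs (Re (lacunary_fun N (fun _ => 1) (RtoC y)
    - lacunary_fun N (fun _ => 1) (RtoC x))%C) <=
    Cmod (lacunary_fun N (fun _ => 1) (RtoC y) - lacunary_fun N (fun _ => 1) (RtoC x))).
  apply re_le_Cmod.
Qed.

(* If [w (x^2) < w x / 4] held near [1], iterating square roots would make [w]
   grow like [(1 - x)^(-2)], contradicting [lacunary_sum_le]. *)
Lemma lacunary_sum_doubling M r0 : 0 < r0 < 1 ->
  exists r, r0 <= r < 1 /\ M <= w r /\ w r / 4 <= w (r * r).
Proof.
  intros hr0.
  destruct (lacunary_sum_unbounded (Rmax M 1)) as [r1 [hr1 h1]].
  set (t0 := Rmax r0 r1).
  assert (ht0 : r0 <= t0 < 1) by (split; [apply Rmax_l | apply Rmax_lub_lt; lra]).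
  destruct (classic (exists r, r0 <= r < 1 /\ M <= w r /\ w r / 4 <= w (r * r)))
    as [| hno]; [assumption | exfalso].
  (* If doubling fails, each square root multiplies w by more than 4, while 1 - s^2 <= 2 (1 - s)
     shows that the distance to 1 is at most halved. *)
  assert (hiter : forall i, let t := Nat.iter i sqrt t0 in
    t0 <= t < 1 /\ 4 ^ i <= w t /\ 1 - t0 <= 2 ^ i * (1 - t)).
  { induction i as [| i [IH1 [IH2 IH3]]]; cbv zeta; simpl.
    - split; [lra |]; split; [| lra].
      eapply Rle_trans; [apply (Rmax_r M 1) | apply h1; split; [apply Rmax_r | lra]].
    - set (t := Nat.iter i sqrt t0) in *; set (s := sqrt t).
      assert (hs0 : 0 < s) by (apply sqrt_lt_R0; lra).
      assert (hss : s * s = t) by (apply sqrt_sqrt; lra).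
      assert (hs1 : s < 1) by nra.
      assert (hts : t <= s) by nra.
      repeat split; try lra.
      + destruct (Rle_lt_dec (w s / 4) (w (s * s))) as [h | h].
        * exfalso; apply hno; exists s; repeat split; try lra.
          eapply Rle_trans; [apply (Rmax_l M 1) | apply h1; split; [| lra]].
          eapply Rle_trans; [apply (Rmax_r r0 r1) | fold t0; lra].
        * rewrite hss in h; lra.
      + assert (0 < 2 ^ i) by (apply pow_lt; lra); nra. }
  (* Now 2^i (1 - t0) <= 4^i (1 - t) <= w t (1 - t) <= 1, which fails as soon as i > 1 / (1 -
     t0). *)
  destruct (INR_unbounded (/ (1 - t0))) as [i hi].
  assert (hI := INR_le_pow2 i).
  destruct (hiter i) as [k1 [k2 k3]]; set (t := Nat.iter i sqrt t0) in *.
  assert (k4 := lacunary_sum_le t ltac:(lra)).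
  assert (e4 : 4 ^ i = 2 ^ i * 2 ^ i) by (rewrite <- Rpow_mult_distr; f_equal; lra).
  assert (hp : 0 < 2 ^ i) by (apply pow_lt; lra).
  assert (k5 : 4 ^ i * (1 - t) <= 1).
  { apply Rle_trans with (/ (1 - t) * (1 - t)); [apply Rmult_le_compat_r; lra |].
    rewrite Rinv_l; lra. }
  assert (k6 : 2 ^ i * (1 - t0) <= 1) by (rewrite e4 in k5; nra).
  assert (k7 : 1 < INR i * (1 - t0)).
  { apply (Rmult_lt_compat_r (1 - t0)) in hi; [| lra]; rewrite Rinv_l in hi; lra. }
  nra.
Qed.

Context (alpha r0 : R) (halpha : 0 < alpha < 1) (hr0 : 0 < r0 < 1).

Let A : R := Rpower (w r0) alpha.
(** A form of [v_alpha] without case distinction: for |z| <= r0 the two powers of w(r0) cancel to 1.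
    Monotonicity, and continuity across |z| = r0, are then inherited from w. *)
Let W (z : C) : R := A * Rpower (w (Rmax r0 (Cmod z))) (- alpha).

Let hA : 0 < A.
Proof. apply Rpower_pos. Qed.

Lemma Rmax_r0_range z : disc z -> 0 < Rmax r0 (Cmod z) < 1.
Proof.
  intros hz; split; [eapply Rlt_le_trans; [apply hr0 | apply Rmax_l] |].
  apply Rmax_lub_lt; [lra | exact hz].
Qed.

Lemma v_alpha_weight_profile z : disc z -> v_alpha alpha r0 n z = W z.
Proof.
  intros hz; unfold v_alpha, W, A; destruct (Rle_dec r0 (Cmod z)) as [h | h].
  - now rewrite Rmax_right.
  - rewrite Rmax_left, <- Rpower_plus, Rplus_opp_r, Rpower_O by
      (try apply lacunary_sum_pos; lra); reflexivity.
Qed.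

Lemma weight_profile_antitone z z' : Cmod z <= Cmod z' -> disc z' -> W z' <= W z.
Proof.
  intros h hz'; apply Rmult_le_compat_l; [left; apply hA |].
  assert (hz : disc z) by (unfold disc in *; lra).
  apply Rpower_opp_anti; [lra | apply lacunary_sum_pos, Rmax_r0_range, hz |].
  apply lacunary_sum_incr; [left; apply Rmax_r0_range, hz | | apply Rmax_r0_range, hz'].
  apply Rle_max_compat_l, h.
Qed.

Lemma weight_profile_continuous z : disc z -> continuous W z.
Proof.
  intros hz; set (x := Cmod z).
  apply (continuous_comp (fun z : C => Cmod z)
           (fun x => A * Rpower (w (Rmax r0 x)) (- alpha)) z).
  { exact (filterlim_norm (V := C_NormedModule) z). }
  change (Cmod z) with x.
  apply (continuous_comp (fun x => w (Rmax r0 x)) (fun y => A * Rpower y (- alpha)) x).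
  - intros S [eps hS].
    destruct (lacunary_sum_continuous (Rmax r0 x) eps) as [de hde].
    { assert (k := Rmax_r0_range z hz); fold x in k; lra. }
    assert (hm : 0 < Rmin de (1 - x))
      by (apply Rmin_pos; [apply cond_pos | unfold disc in hz; fold x in hz; lra]).
    exists (mkposreal _ hm); intros y hy; apply hS; change (Rabs (y - x) < Rmin de (1 - x)) in hy.
    assert (k1 := Rlt_le_trans _ _ _ hy (Rmin_l _ _)).
    assert (k2 := Rlt_le_trans _ _ _ hy (Rmin_r _ _)).
    apply hde.
    + apply Rabs_lt_between in k2; split.
      * apply Rle_trans with r0; [lra | apply Rmax_l].
      * apply Rmax_lub_lt; lra.
    + eapply Rle_lt_trans; [| exact k1]; unfold Rmax, Rabs.
      repeat destruct (Rle_dec _ _); repeat destruct (Rcase_abs _); lra.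
  - apply (ex_derive_continuous (K := R_AbsRing) (V := R_NormedModule)).
    assert (hp : 0 < w (Rmax r0 x)) by apply lacunary_sum_pos, Rmax_r0_range, hz.
    apply (ex_derive_scal (fun y => Rpower y (- alpha))).
    eexists; apply is_derive_Reals, derivable_pt_lim_power, hp.
Qed.

Lemma weight_profile_vanishes : vanishes_at_boundary W.
Proof.
  intros eps; assert (he := cond_pos eps).
  (* The solution of A M^(-alpha) = eps / 2. *)
  set (M := Rpower (2 * A / eps) (/ alpha)).
  destruct (lacunary_sum_unbounded M) as [r [hr h]]; exists r; split; [apply hr |].
  intros z [hz1 hz]; unfold W.
  assert (hAe : 0 < 2 * A / eps) by (apply Rdiv_lt_0_compat; lra).
  assert (hM : M <= w (Rmax r0 (Cmod z))).
  { apply h; split; [| apply Rmax_r0_range, hz].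
    eapply Rle_trans; [left; exact hz1 | apply Rmax_r]. }
  assert (k := Rpower_opp_anti M _ alpha ltac:(lra) (Rpower_pos _ _) hM).
  assert (e : Rpower M (- alpha) = eps / (2 * A)).
  { unfold M; rewrite Rpower_Ropp, Rpower_mult, Rinv_l, Rpower_1 by lra; field; lra. }
  rewrite e in k.
  rewrite Rabs_pos_eq by (apply Rmult_le_pos; [lra | left; apply Rpower_pos]).
  apply (Rmult_le_compat_l A) in k; [| lra].
  replace (A * (eps / (2 * A))) with (eps / 2) in k by (field; lra); lra.
Qed.

Definition lacunary_weight : weight.
Proof.
  refine (Weight W weight_profile_continuous _ _).
  - intros z _; apply Rmult_lt_0_compat; [apply hA | apply Rpower_pos].
  - exists (W (RtoC 0)); intros z hz; apply weight_profile_antitone; [| exact hz].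
    rewrite Cmod_0; apply Cmod_ge_0.
Defined.

Lemma lacunary_weight_typical : typical lacunary_weight.
Proof.
  split.
  - intros z _; change (W z = W (RtoC (Cmod z))); unfold W.
    now rewrite Cmod_R, Rabs_pos_eq by apply Cmod_ge_0.
  - exact weight_profile_antitone.
  - exact weight_profile_vanishes.
Qed.

Lemma growth_ratio_exists : exists theta, 2 <= theta /\
  2 <= Rpower theta alpha /\ 2 <= Rpower theta (1 - alpha).
Proof.
  assert (i1 : 1 <= / alpha) by (rewrite <- Rinv_1; apply Rinv_le_contravar; lra).
  assert (i2 : 0 < / (1 - alpha)) by (apply Rinv_0_lt_compat; lra).
  assert (h2 : forall p, 1 <= p -> 2 <= Rpower 2 p).
  { intros p hp; rewrite <- (Rpower_1 2) at 1 by lra; apply Rle_Rpower; lra. }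
  (* Multiplying the exponent by alpha or by 1 - alpha leaves at least 1, so both powers are at
     least 2. *)
  exists (Rpower 2 (/ alpha + / (1 - alpha))); split; [apply h2; lra |].
  split; rewrite Rpower_mult; apply h2.
  - rewrite Rmult_plus_distr_r, Rinv_l by lra.
    assert (0 <= / (1 - alpha) * alpha) by (apply Rmult_le_pos; lra); lra.
  - rewrite Rmult_plus_distr_r, (Rinv_l (1 - alpha)) by lra.
    assert (0 <= / alpha * (1 - alpha)) by (apply Rmult_le_pos; lra); lra.
Qed.

(** * An almost invariant function outside H_v^0 *)

Section TestFunction.

Context (theta : R) (htheta : 2 <= theta).
Context (ht1 : 2 <= Rpower theta alpha) (ht2 : 2 <= Rpower theta (1 - alpha)).
Context (r : nat -> R) (hr : forall j, r0 <= r j < 1).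
Context (hr1 : 1 <= w (r 0%nat)) (hgrow : forall j, theta * w (r j) <= w (r (S j))).
Context (hdouble : forall j, w (r j) / 4 <= w (r j * r j)).

Let b (j : nat) : R := Rpower (w (r j)) (alpha - 1).
(** The coefficient of z^(N k) in sum_j b_j g(r_j z). Defining the function by its coefficients
    makes it a lacunary series, already known to be holomorphic, and leaves only nonnegative real
    sums to interchange. *)
Let a (k : nat) : R := Series (fun j => b j * r j ^ N k).

Let ex_b : ex_series b.
Proof.
  exact (ex_series_growth_coef theta htheta (fun j => w (r j)) hr1 hgrow alpha halpha ht2).
Qed.

Let b_pos j : 0 < b j.
Proof. apply Rpower_pos. Qed.

Let pow_r_range j k : 0 <= r j ^ N k <= 1.
Proof.
  assert (h := hr j); split; [apply pow_le; lra |].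
  rewrite <- (pow1 (N k)); apply pow_incr; lra.
Qed.

Let ex_a k : ex_series (fun j => b j * r j ^ N k).
Proof.
  apply (ex_series_le (V := R_CompleteNormedModule)) with (2 := ex_b); intros j.
  change (Rabs (b j * r j ^ N k) <= b j).
  assert (h1 := b_pos j); assert (h2 := pow_r_range j k).
  rewrite Rabs_pos_eq by (apply Rmult_le_pos; lra); nra.
Qed.

Let a_range k : 0 <= a k <= Series b.
Proof.
  split.
  - eapply Rle_trans; [| apply (term_le_Series _ 0 (fun j =>
      Rmult_le_pos _ _ (Rlt_le _ _ (b_pos j)) (proj1 (pow_r_range j k))) (ex_a k))].
    apply Rmult_le_pos; [left; apply b_pos | apply pow_r_range].
  - apply Series_le; [| exact ex_b]; intros j.
    assert (h1 := b_pos j); assert (h2 := pow_r_range j k); split; nra.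
Qed.

(** After interchange the sum is sum_j b_j w(r_j x), and w(r_j x) <= min(w(r_j), w(x)), which is the
    situation of [growth_min_sum_le]. Only finite partial sums in k are interchanged with the series
    in j. *)
Lemma coef_series_le x : 0 < x < 1 ->
  Series (fun k => a k * x ^ N k) <= 4 * Rpower (w x) alpha.
Proof.
  intros hx; assert (hwx := lacunary_sum_pos x hx).
  apply Series_le_of_sum_n.
  { apply (ex_series_coef_lacunary N hN a (Series b) a_range); lra. }
  intros K.
  set (p := fun j => sum_n (fun k => (r j * x) ^ N k) K).
  assert (hp0 : forall j, 0 <= p j).
  { intros j; unfold p; induction K as [| K IH].
    - rewrite sum_O; apply pow_le, Rmult_le_pos; generalize (hr j); lra.
    - rewrite sum_Sn; apply Rplus_le_le_0_compat; [exact IH |].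
      apply pow_le, Rmult_le_pos; generalize (hr j); lra. }
  assert (hp : forall j, p j <= Rmin (w (r j)) (w x)).
  { intros j; assert (h := hr j); assert (h0 : 0 <= r j * x < 1) by nra.
    apply Rle_trans with (w (r j * x)).
    - apply (sum_n_le_Series (fun k => (r j * x) ^ N k)); [| now apply ex_series_lacunary_sum].
      intros k; now apply pow_le.
    - apply Rmin_glb; apply lacunary_sum_incr; nra. }
  assert (hex : ex_series (fun j => b j * p j) /\
                sum_n (fun k => a k * x ^ N k) K = Series (fun j => b j * p j)).
  { unfold p; clear hp hp0 p; induction K as [| K [IH1 IH2]].
    - assert (e : forall j, x ^ N 0 * (b j * r j ^ N 0%nat) =
                       b j * sum_n (fun k => (r j * x) ^ N k) 0).
      { intros j; rewrite sum_O, Rpow_mult_distr; ring. }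
      split.
      + eapply ex_series_ext; [exact e | now apply ex_series_Rmult_l].
      + rewrite sum_O, <- (Series_ext _ _ e), Series_scal_l; apply Rmult_comm.
    - assert (e : forall j, b j * sum_n (fun k => (r j * x) ^ N k) K +
                            x ^ N (S K) * (b j * r j ^ N (S K)) =
                       b j * sum_n (fun k => (r j * x) ^ N k) (S K)).
      { intros j; rewrite sum_Sn; unfold plus; simpl; rewrite Rpow_mult_distr; ring. }
      assert (hx2 := ex_series_Rmult_l (x ^ N (S K)) _ (ex_a (S K))).
      split.
      + eapply ex_series_ext; [exact e |].
        now apply (ex_series_plus (V := R_NormedModule)).
      + rewrite sum_Sn, IH2, <- (Series_ext _ _ e), Series_plus by assumption.
        rewrite Series_scal_l; unfold plus; simpl; unfold a; ring. }
  destruct hex as [hex1 hex2]; rewrite hex2.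
  apply Series_le_of_sum_n; [exact hex1 |]; intros J.
  eapply Rle_trans; [| apply (growth_min_sum_le theta htheta (fun j => w (r j)) hr1 hgrow
                               alpha halpha ht1 ht2 (w x) J hwx)].
  apply sum_n_m_le; intros j; apply Rmult_le_compat_l; [left; apply b_pos | apply hp].
Qed.

(** Keeping only the j-th summand of every coefficient leaves b_j w(r_j^2), to which the doubling
    property applies. *)
Lemma coef_series_ge j :
  b j * (w (r j) / 4) <= Series (fun k => a k * r j ^ N k).
Proof.
  assert (h := hr j); assert (hb := b_pos j).
  apply Rle_trans with (b j * w (r j * r j)); [apply Rmult_le_compat_l; [lra | apply hdouble] |].
  unfold lacunary_sum; rewrite <- Series_scal_l; apply Series_le.
  - intros k; fold (N k); split; [apply Rmult_le_pos; [lra | apply pow_le; nra] |].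
    rewrite Rpow_mult_distr, <- Rmult_assoc; apply Rmult_le_compat_r; [apply pow_r_range |].
    apply (term_le_Series (fun j => b j * r j ^ N k) j); [| apply ex_a].
    intros i; apply Rmult_le_pos; [left; apply b_pos | apply pow_r_range].
  - apply (ex_series_coef_lacunary N hN a (Series b) a_range); lra.
Qed.

Definition test_function : Hinf lacunary_weight.
Proof.
  refine (HinfElt (on_disc (lacunary_fun N a)) _ _ (on_disc_out _)).
  - intros z hz; apply ex_derive_on_disc; [exact hz |].
    exact (ex_derive_lacunary_fun N hN a (Series b) a_range z hz).
  - exists (8 * A); intros z hz; rewrite on_discE by exact hz.
    assert (hm := Rmax_r0_range z hz); set (x := Rmax r0 (Cmod z)) in *.
    change (lacunary_weight z) with (A * Rpower (w x) (- alpha)).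
    apply Rle_trans with (A * Rpower (w x) (- alpha) * (2 * (4 * Rpower (w x) alpha))).
    + apply Rmult_le_compat_l.
      { apply Rmult_le_pos; left; [apply hA | apply Rpower_pos]. }
      eapply Rle_trans; [apply (Cmod_lacunary_fun_le N hN a (Series b) a_range z hz) |].
      apply Rmult_le_compat_l; [lra |].
      eapply Rle_trans; [| now apply coef_series_le].
      apply Series_le; [| apply (ex_series_coef_lacunary N hN a (Series b) a_range); lra].
      intros k; split; [apply Rmult_le_pos; [apply a_range | apply pow_le, Cmod_ge_0] |].
      apply Rmult_le_compat_l; [apply a_range |]; apply pow_incr.
      split; [apply Cmod_ge_0 | apply Rmax_r].
    + right; rewrite Rpower_Ropp; field; apply Rgt_not_eq, Rpower_pos.
Defined.

(** At z = r_j the powers of w(r_j) cancel, -alpha + (alpha - 1) + 1 = 0, and v |f| stays above A /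
    4. *)
Lemma test_function_not_H0 : ~ H0_subspace lacunary_weight test_function.
Proof.
  intros h; assert (hA8 : 0 < A / 8) by lra.
  destruct (h (mkposreal _ hA8)) as [s [hs hv]]; simpl pos in hv.
  (* The radii approach 1: otherwise w(r_j) would be bounded, although it is at least 2^j. *)
  assert (hj : exists j, s < r j).
  { destruct (classic (exists j, s < r j)) as [| hno]; [assumption | exfalso].
    assert (hle : forall j, w (r j) <= w (Rmax r0 s)).
    { intros j; assert (k := hr j); apply lacunary_sum_incr; [lra | | apply Rmax_lub_lt; lra].
      destruct (Rle_lt_dec (r j) s) as [k1 | k1].
      - eapply Rle_trans; [exact k1 | apply Rmax_r].
      - exfalso; apply hno; now exists j. }
    destruct (INR_unbounded (w (Rmax r0 s))) as [j hj].
    assert (k := growth_ge_pow2 theta htheta (fun j => w (r j)) hr1 hgrow j); cbv beta in k.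
    assert (hI := INR_le_pow2 j).
    specialize (hle j); lra. }
  destruct hj as [j hj]; assert (hrj := hr j).
  assert (hmod : Cmod (RtoC (r j)) = r j) by (rewrite Cmod_R, Rabs_pos_eq; lra).
  assert (hd : disc (RtoC (r j))) by (unfold disc; rewrite hmod; lra).
  specialize (hv (RtoC (r j)) ltac:(rewrite hmod; lra)).
  apply (Rle_lt_trans _ _ _ (Rle_abs _)) in hv.
  change (hfun test_function (RtoC (r j))) with (on_disc (lacunary_fun N a) (RtoC (r j))) in hv.
  rewrite on_discE in hv by exact hd.
  change (lacunary_weight (RtoC (r j))) with
    (A * Rpower (w (Rmax r0 (Cmod (RtoC (r j))))) (- alpha)) in hv.
  rewrite hmod, Rmax_right in hv by lra.
  assert (hF : b j * (w (r j) / 4) <= Cmod (lacunary_fun N a (RtoC (r j)))).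
  { eapply Rle_trans; [apply coef_series_ge |].
    eapply Rle_trans; [| apply re_le_Cmod]; eapply Rle_trans; [| apply Rle_abs].
    right; apply Series_ext; intros k.
    rewrite <- RtoC_pow, <- RtoC_mult; reflexivity. }
  assert (hw := lacunary_sum_pos (r j) ltac:(lra)).
  assert (hq := Rpower_pos (w (r j)) (- alpha)).
  apply (Rmult_le_compat_l (A * Rpower (w (r j)) (- alpha))) in hF;
    [| left; now apply Rmult_lt_0_compat].
  replace (A * Rpower (w (r j)) (- alpha) * (b j * (w (r j) / 4))) with (A / 4) in hF; [lra |].
  replace (b j * (w (r j) / 4)) with (Rpower (w (r j)) alpha / 4).
  - rewrite Rpower_Ropp; field; apply Rgt_not_eq, Rpower_pos.
  - unfold b; rewrite <- (growth_coef_mul alpha (w (r j)) hw); field.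
Qed.

(** The rotation multiplies the k-th term by lambda^(N k), so the difference is dominated by the
    geometric series with ratio / rho, times the bound [Series b] on the coefficients. *)
Lemma test_function_almost_invariant (lambda : C) (rho : R) :
  Cmod lambda = 1 -> 1 < rho ->
  (forall k, Cmod (RtoC 1 - lambda ^ N k)%C <= / rho ^ S k) ->
  exists d, forall z, disc z ->
    Cmod (hfun test_function (lambda * z)%C - hfun test_function z) <= d.
Proof.
  intros hl hrho hlam.
  assert (hgeo : ex_series (fun k => Series b * (/ rho) ^ S k)).
  { apply ex_series_Rmult_l; apply (ex_series_incr_1 (fun k => (/ rho) ^ k)).
    apply ex_series_geom; rewrite Rabs_pos_eq by (left; apply Rinv_0_lt_compat; lra).
    rewrite <- Rinv_1; apply Rinv_lt_contravar; lra. }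
  exists (2 * Series (fun k => Series b * (/ rho) ^ S k)); intros z hz.
  assert (hlz : disc (lambda * z)) by (unfold disc; now rewrite Cmod_mult, hl, Rmult_1_l).
  change (hfun test_function) with (on_disc (lacunary_fun N a)).
  rewrite !on_discE by assumption; unfold lacunary_fun.
  rewrite <- Cseries_minus by now apply (ex_series_Cmod_lacunary N hN a (Series b) a_range).
  assert (ht : forall k, Cmod (a k * (lambda * z) ^ N k - a k * z ^ N k) <=
                         Series b * (/ rho) ^ S k).
  { intros k.
    replace (a k * (lambda * z) ^ N k - a k * z ^ N k)%C with
      (a k * (- (1 - lambda ^ N k) * z ^ N k))%C by (rewrite Cpow_mult_l; ring).
    rewrite Cmod_mult, Cmod_R, Rabs_pos_eq by apply a_range.
    apply Rmult_le_compat; [apply a_range | apply Cmod_ge_0 | apply a_range |].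
    rewrite Cmod_mult, Cmod_opp, pow_inv, Cmod_pow, <- (Rmult_1_r (/ rho ^ S k)).
    apply Rmult_le_compat; [apply Cmod_ge_0 | apply pow_le, Cmod_ge_0 | apply hlam |].
    rewrite <- (pow1 (N k)); apply pow_incr; split; [apply Cmod_ge_0 | now left]. }
  assert (hex : ex_series (fun k => Cmod (a k * (lambda * z) ^ N k - a k * z ^ N k))).
  { apply (ex_series_le (V := R_CompleteNormedModule)) with (2 := hgeo); intros k.
    change (Rabs (Cmod (a k * (lambda * z) ^ N k - a k * z ^ N k)) <= Series b * (/ rho) ^ S k).
    rewrite Rabs_pos_eq; [apply ht | apply Cmod_ge_0]. }
  eapply Rle_trans; [now apply Cmod_Cseries_le |].
  apply Rmult_le_compat_l; [lra |]; apply Series_le; [| exact hgeo].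
  intros k; split; [apply Cmod_ge_0 | apply ht].
Qed.

End TestFunction.

Lemma almost_invariant_outside_H0 (lambda : C) (rho : R) :
  Cmod lambda = 1 -> 1 < rho ->
  (forall k, Cmod (RtoC 1 - lambda ^ n (S k))%C <= / rho ^ S k) ->
  exists (f : Hinf lacunary_weight) (d : R),
    (forall z, disc z -> Cmod (hfun f (lambda * z)%C - hfun f z) <= d) /\
    ~ H0_subspace lacunary_weight f.
Proof.
  intros hl hrho hlam; destruct growth_ratio_exists as (theta & htheta & ht1 & ht2).
  destruct (lacunary_sum_doubling 1 r0 hr0) as [s0 [hs1 [hs2 hs3]]].
  destruct (dependent_choice_inv
    (fun _ s => r0 <= s < 1 /\ 1 <= w s /\ w s / 4 <= w (s * s))
    (fun _ s s' => theta * w s <= w s') s0) as [r [er hr]].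
  - auto.
  - intros _ s (k1 & k2 & k3).
    (* The free lower bound of the doubling lemma supplies both the invariant w >= 1 and growth by
       the factor theta. *)
    destruct (lacunary_sum_doubling (Rmax 1 (theta * w s)) r0 hr0) as [s' [hs'1 [hs'2 hs'3]]].
    exists s'; split; [| eapply Rle_trans; [apply Rmax_r | exact hs'2]].
    split; [exact hs'1 |]; split; [| exact hs'3].
    eapply Rle_trans; [apply Rmax_l | exact hs'2].
  - assert (h1 : forall j, r0 <= r j < 1) by (intros j; apply (hr j)).
    assert (h2 : 1 <= w (r 0%nat)) by apply (hr 0%nat).
    assert (h3 : forall j, theta * w (r j) <= w (r (S j))) by (intros j; apply (hr j)).
    assert (h4 : forall j, w (r j) / 4 <= w (r j * r j)) by (intros j; apply (hr j)).
    destruct (test_function_almost_invariant theta htheta ht1 ht2 r h1 h2 h3 lambda rho hl hrho hlam)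
      as [d hd].
    exists (test_function theta htheta ht1 ht2 r h1 h2 h3), d; split; [exact hd |].
    now apply test_function_not_H0.
Qed.

End LacunaryWeight.

Theorem theorem3p12 (lambda : C) (hl : Cmod lambda = 1) :
  (forall (v : weight) (hv : typical v),
      power_bounded (comp_rotation lambda hl v hv))
  /\
  (forall k : nat, (1 <= k)%nat ->
    (lambda ^ k)%C = RtoC 1 ->
    (forall j : nat, (1 <= j < k)%nat -> (lambda ^ j)%C <> RtoC 1) ->
    forall (v : weight) (hv : typical v),
      uniformly_mean_ergodic (comp_rotation lambda hl v hv) /\
      forall f : Hinf v, exists g : Hinf v,
        (forall z : C, disc z ->
           hfun g z =
           (RtoC (/ INR k) *
              sum_n_m (G := C_AbelianMonoid)
                (fun m => hfun f (lambda ^ m * z)) 0 (k - 1))%C) /\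
        filterlim (fun n => cesaro (comp_rotation lambda hl v hv) n f)
          eventually (locally g))
  /\
  ((forall k : nat, (1 <= k)%nat -> (lambda ^ k)%C <> RtoC 1) ->
    (forall (v : weight) (hv : typical v),
       mean_ergodic (comp_rotation0 lambda hl v hv) /\
       sot_lim (cesaro (comp_rotation0 lambda hl v hv)) (eval_zero0 v hv))
    /\
    (forall (alpha rho r0 : R) (n : nat -> nat),
       0 < alpha < 1 -> 1 < rho -> 0 < r0 < 1 ->
       (forall k : nat, (1 <= k)%nat ->
          (k <= n k)%nat /\ Cmod (RtoC 1 - lambda ^ n k)%C <= / rho ^ k) ->
       exists (v : weight) (hv : typical v),
         (forall z : C, disc z -> v z = v_alpha alpha r0 n z) /\
         ~ uniformly_mean_ergodic (comp_rotation0 lambda hl v hv) /\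
         ~ mean_ergodic (comp_rotation lambda hl v hv))).
Proof.
  split; [| split].
  - intros v hv; apply comp_rotation_power_bounded.
  - intros k hk hroot _ v hv; split.
    + now apply (comp_rotation_ume lambda hl v hv k).
    + intros f; now apply cesaro_periodic_lim.
  - intros hroot; split.
    + intros v hv; split; [| now apply comp_rotation0_sot].
      exists (eval_zero0 v hv); now apply comp_rotation0_sot.
    + intros alpha rho r0 n halpha hrho hr0 hn.
      assert (hn1 : forall k, (S k <= n (S k))%nat) by (intros k; apply hn; lia).
      assert (hn2 : forall k, Cmod (RtoC 1 - lambda ^ n (S k))%C <= / rho ^ S k)
        by (intros k; apply hn; lia).
      exists (lacunary_weight n hn1 alpha r0 halpha hr0).
      exists (lacunary_weight_typical n hn1 alpha r0 halpha hr0); split; [| split].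
      * intros z hz; symmetry; now apply v_alpha_weight_profile.
      * apply not_uniformly_mean_ergodic0; [exact hroot |]; intros eps heps.
        assert (hi : 0 < / rho < 1).
        { split; [apply Rinv_0_lt_compat; lra |].
          rewrite <- Rinv_1; apply Rinv_lt_contravar; lra. }
        destruct (pow_lt_1_zero (/ rho) ltac:(rewrite Rabs_pos_eq; lra) eps heps) as [M hM].
        (* The given exponents themselves bring lambda^j close to 1; [S M] stays clear of index 0,
           about which nothing is assumed. *)
        exists (n (S M)); split; [generalize (hn1 M); lia |].
        eapply Rle_trans; [apply hn2 |]; rewrite <- pow_inv; left.
        eapply Rle_lt_trans; [apply Rle_abs | apply hM; lia].
      * destruct (almost_invariant_outside_H0 n hn1 alpha r0 halpha hr0 lambda rho hl hrho hn2)
          as (f & d & hd & hf).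
        exact (not_mean_ergodic_of_almost_invariant lambda hl _ _ hroot f d hd hf).
Qed.
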